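(* Let $\mathcal A,\mathcal B$ be finite-dimensional von Neumann algebras, let $\mathcal N\colon S(\mathcal A)\to S(\mathcal B)$ be a quantum channel, and let $\rho,\sigma\in S(\mathcal A)$ be states such that $\operatorname{supp}\rho\subseteq\operatorname{supp}\sigma$. Then $$D(\rho\Vert\sigma)-D(\mathcal N[\rho]\Vert\mathcal N[\sigma])\ge-2\log F\bigl(\rho,(\mathcal R_{\sigma,\mathcal N}\circ\mathcal N)[\rho]\bigr),$$ where $$\mathcal R_{\sigma,\mathcal N}[\gamma]:=\int_{\mathbb R}dt\,\beta_0(t)\,\sigma^{-it/2}\,\mathcal P_{\sigma,\mathcal N}\bigl[\mathcal N[\sigma]^{it/2}\,\gamma\,\mathcal N[\sigma]^{-it/2}\bigr]\,\sigma^{it/2}$$ is a quantum operation defined in terms of the Petz recovery map $$\mathcal P_{\sigma,\mathcal N}[\gamma]=\sigma^{1/2}\,\mathcal N^*\bigl[\mathcal N[\sigma]^{-1/2}\,\gamma\,\mathcal N[\sigma]^{-1/2}\bigr]\,\sigma^{1/2}$$ and the probability density $\beta_0(t)=\frac{\pi}{2}(\cosh(\pi t)+1)^{-1}$.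
   Context: A finite-dimensional von Neumann algebra is a unital ($*$-)subalgebra $\mathcal A\subseteq B(\mathcal H)$ of the linear operators on a finite-dimensional Hilbert space $\mathcal H$; $\operatorname{tr}$ is the trace on $\mathcal H$. Its states are $S(\mathcal A)=\mathcal A\cap S(\mathcal H)$, where $S(\mathcal H)$ is the set of density operators on $\mathcal H$. $P(\mathcal A)$ is the set of positive linear functionals on $\mathcal A$, identified with the positive semidefinite elements of $\mathcal A$. Write $\langle\phi\rangle_\rho=\operatorname{tr}\rho\phi$. The relative entropy is $D(\rho\Vert\sigma)=\operatorname{tr}[\rho\log\rho-\rho\log\sigma]$ and the fidelity is $F(\rho,\sigma)=\lVert\sqrt\rho\sqrt\sigma\rVert_1$, with $\lVert X\rVert_1=\operatorname{tr}|X|$; the same logarithm base is used on both sides of the inequality. Completely positive maps are understood as extended linearly to $\mathcal A\to\mathcal B$. The adjoint $\mathcal N^*\colon\mathcal B\to\mathcal A$ is defined by $\langle\phi\rangle_{\mathcal N[\rho]}=\langle\mathcal N^*[\phi]\rangle_\rho$ for all $\rho\in S(\mathcal A)$, $\phi\in\mathcal B$. A quantum channel is a completely positive trace-preserving map; a quantum operation (here $\mathcal R_{\sigma,\mathcal N}\colon P(\mathcal B)\to P(\mathcal A)$) is a completely positive trace non-increasing map. Negative and imaginary powers of a positive semidefinite operator are taken on its support (and are zero on its kernel). *)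

(* Defs.v *)
From HB Require Import structures.
From mathcomp Require Export all_boot all_order all_algebra.
From mathcomp Require Export spectral complex.
From mathcomp Require Export all_classical all_reals all_analysis.

Set Implicit Arguments.
Unset Strict Implicit.
Unset Printing Implicit Defensive.

Import Order.TTheory GRing.Theory Num.Theory.
Import numFieldNormedType.Exports.
Local Open Scope classical_set_scope.
Local Open Scope ring_scope.
Local Open Scope complex_scope.
Local Open Scope sesquilinear_scope.

(* Operators on the Hilbert space C^n, C = R[i], are the matrices 'M[R[i]]_n
   acting on column vectors; [A ^t*] is the adjoint of [A]. *)

Section Operators.
Context {R : realType}.
Local Notation C := R[i].

Definition psd n (X : 'M[C]_n) : Prop :=
  forall v : 'cV[C]_n, 0 <= (v ^t* *m X *m v) 0 0.

(* Functional calculus of a Hermitian matrix; [spectral_diag X] lists its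
   (real) eigenvalues and [spectralmx X] is a diagonalizing unitary matrix. *)
Definition mxfun n (f : R -> C) (X : 'M[C]_n) : 'M[C]_n :=
  invmx (spectralmx X)
    *m diag_mx (map_mx (fun x : C => f (complex.Re x)) (spectral_diag X))
    *m spectralmx X.

Definition expC (z : C) : C :=
  (expR (complex.Re z))%:C * (cos (complex.Im z) +i* sin (complex.Im z)).

(* [X ^ z] for [X] positive semidefinite and [z] an arbitrary complex exponent,
   taken on the support of [X] and zero on its kernel. *)
Definition mxpow n (X : 'M[C]_n) (z : C) : 'M[C]_n :=
  mxfun (fun x => if 0 < x then expC (z * (ln x)%:C) else 0) X.

Definition mxsqrt n (X : 'M[C]_n) : 'M[C]_n := mxpow X (2^-1)%:C.

(* Logarithm to base [b], taken on the support ([ln 0 = 0]). *)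
Definition mxlog (b : R) n (X : 'M[C]_n) : 'M[C]_n :=
  mxfun (fun x => (ln x / ln b)%:C) X.

(* The support of a Hermitian matrix (the orthogonal complement of its kernel)
   is its range, i.e. its column space, whence the transposes. *)
Definition supp_sub n (rho sigma : 'M[C]_n) : bool :=
  (rho^T <= sigma^T)%MS.

Definition density n (rho : 'M[C]_n) : Prop := psd rho /\ \tr rho = 1.

Definition rel_entropy (b : R) n (rho sigma : 'M[C]_n) : \bar R :=
  if supp_sub rho sigma then
    (complex.Re (\tr (rho *m mxlog b rho - rho *m mxlog b sigma)))%:E
  else +oo%E.

Definition trnorm n (X : 'M[C]_n) : R :=
  complex.Re (\tr (mxsqrt (X ^t* *m X))).

Definition fidelity n (rho sigma : 'M[C]_n) : R :=
  trnorm (mxsqrt rho *m mxsqrt sigma).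

(* Logarithm to base [b] with value -oo at 0. *)
Definition elog (b x : R) : \bar R := (((ln b)^-1)%:E * lne x%:E)%E.

Definition mxintegral n (f : R -> 'M[C]_n) : 'M[C]_n :=
  \matrix_(i, j)
    ((\int[@lebesgue_measure R]_t complex.Re (f t i j))
     +i* (\int[@lebesgue_measure R]_t complex.Im (f t i j))).

End Operators.

Section Algebras.
Context {R : realType}.
Local Notation C := R[i].

Definition vn_algebra n (A : {vspace 'M[C]_n}) : Prop :=
  [/\ 1%:M \in A,
      forall x y, x \in A -> y \in A -> x *m y \in A
    & forall x, x \in A -> x ^t* \in A].

Definition state n (A : {vspace 'M[C]_n}) (rho : 'M[C]_n) : Prop :=
  rho \in A /\ density rho.

(* A map from [A] to [B] is given by a function on the ambient matrix algebra,
   whose values outside [A] are irrelevant. *)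
Definition linear_map n m (A : {vspace 'M[C]_n}) (B : {vspace 'M[C]_m})
    (N : 'M[C]_n -> 'M[C]_m) : Prop :=
  (forall x, x \in A -> N x \in B) /\
  (forall (c : C) x y, x \in A -> y \in A -> N (c *: x + y) = c *: N x + N y).

(* Positivity of [N] tensored with the identity of the k x k matrices, for
   every k; elements of the tensor product are block matrices over [A]. *)
Definition completely_positive n m (A : {vspace 'M[C]_n})
    (B : {vspace 'M[C]_m}) (N : 'M[C]_n -> 'M[C]_m) : Prop :=
  linear_map A B N /\
  forall (k : nat) (X : 'I_k -> 'I_k -> 'M[C]_n),
    (forall i j, X i j \in A) ->
    psd (\mxblock_(i < k, j < k) X i j) ->
    psd (\mxblock_(i < k, j < k) N (X i j)).

Definition channel n m (A : {vspace 'M[C]_n}) (B : {vspace 'M[C]_m})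
    (N : 'M[C]_n -> 'M[C]_m) : Prop :=
  completely_positive A B N /\ (forall x, x \in A -> \tr (N x) = \tr x).

Definition operation n m (A : {vspace 'M[C]_n}) (B : {vspace 'M[C]_m})
    (N : 'M[C]_n -> 'M[C]_m) : Prop :=
  completely_positive A B N /\
  (forall x, x \in A -> psd x -> \tr (N x) <= \tr x).

Definition expect n (phi rho : 'M[C]_n) : C := \tr (rho *m phi).

(* [adjoint_map A N phi] is the unique element of [A] representing
   [rho |-> expect phi (N rho)] on the states of [A]; see [adjoint_mapP] and
   [adjoint_map_uniq]. *)
Definition adjoint_map n m (A : {vspace 'M[C]_n}) (N : 'M[C]_n -> 'M[C]_m)
    (phi : 'M[C]_m) : 'M[C]_n :=
  xget 0 [set a | a \in A /\
    forall rho, state A rho -> expect phi (N rho) = expect a rho].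

End Algebras.

Section AdjointWellDefined.
Context {R : realType} {n m : nat}.
Local Notation C := R[i].
Variables (A : {vspace 'M[C]_n}) (N : 'M[C]_n -> 'M[C]_m).

Lemma mxtrace_adj_eq0 (a : 'M[C]_n) : \tr (a ^t* *m a) = 0 -> a = 0.
Proof.
have -> : \tr (a ^t* *m a) = \sum_i \sum_j `|a j i| ^+ 2.
  apply: eq_bigr => i _; rewrite mxE; apply: eq_bigr => j _.
  by rewrite !mxE normCKC.
move=> a0; apply/matrixP => i j; rewrite mxE.
have s0 k : 0 <= \sum_l `|a l k| ^+ 2 by apply: sumr_ge0 => l _; rewrite exprn_ge0.
have /(_ j isT) := psumr_eq0P (fun k _ => s0 k) a0.
have t0 l : true -> 0 <= `|a l j| ^+ 2 by rewrite exprn_ge0.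
by move=> /(psumr_eq0P t0) /(_ i isT) /eqP; rewrite sqrf_eq0 normr_eq0 => /eqP.
Qed.

Lemma psd_gram (a : 'M[C]_n) : psd (a ^t* *m a).
Proof.
move=> v; have -> : v ^t* *m (a ^t* *m a) *m v = (a *m v) ^t* *m (a *m v).
  by rewrite trmx_mul map_mxM !mulmxA.
by rewrite mxE sumr_ge0 // => i _; rewrite !mxE mulrC mul_conjC_ge0.
Qed.

Hypothesis hA : vn_algebra A.

(* The states of [A] separate its elements. *)
Lemma state_separating (a : 'M[C]_n) : a \in A ->
  (forall rho, state A rho -> expect a rho = 0) -> a = 0.
Proof.
case: hA => A1 AM Aadj aA a0.
have gram0 c : c \in A -> \tr (c ^t* *m c *m a) = 0.
  move=> cA; set g := c ^t* *m c.
  have [g0|g0] := eqVneq (\tr g) 0.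
    by rewrite /g (mxtrace_adj_eq0 g0) mulmx0 mul0mx mxtrace0.
  have gge0 : 0 <= \tr g.
    rewrite /g; apply: sumr_ge0 => i _; rewrite mxE; apply: sumr_ge0 => j _.
    by rewrite !mxE mulrC mul_conjC_ge0.
  have : state A ((\tr g)^-1 *: g).
    split; first by rewrite memvZ // AM // Aadj.
    split; last by rewrite mxtraceZ mulVf.
    move=> v; rewrite -scalemxAr -scalemxAl mxE mulr_ge0 ?invr_ge0 //.
    exact: psd_gram.
  move=> /a0; rewrite /expect -scalemxAl mxtraceZ => /eqP.
  by rewrite mulf_eq0 invr_eq0 (negbTE g0) => /eqP.
pose f (c d : 'M[C]_n) := \tr (c ^t* *m d *m a).
have fD c d : c \in A -> d \in A -> f c d + f d c = 0.
  move=> cA dA; have := gram0 _ (memvD cA dA).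
  have -> : (c + d) ^t* = c ^t* + d ^t*.
    by apply/matrixP => i j; rewrite !mxE rmorphD.
  rewrite !mulmxDl !mulmxDr !mulmxDl !mxtraceD (gram0 c cA) (gram0 d dA).
  by rewrite add0r addr0.
have fi c d : f c ('i *: d) = 'i * f c d.
  by rewrite /f -scalemxAr -scalemxAl mxtraceZ.
have fj c d : f ('i *: c) d = - 'i * f c d.
  rewrite /f; have -> : ('i *: c) ^t* = - 'i *: c ^t*.
    by apply/matrixP => i j; rewrite !mxE rmorphM /= conjCi.
  by rewrite -!scalemxAl mxtraceZ.
have f1 : f a 1%:M = 0.
  have h1 := fD a 1%:M aA A1.
  have := fD a ('i *: 1%:M) aA (memvZ _ A1); rewrite fi fj mulNr -mulrBr.
  move/eqP; rewrite mulf_eq0 (negbTE (neq0Ci _)) /= subr_eq0 => /eqP h2.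
  by move/eqP: h1; rewrite -h2 -mulr2n mulrn_eq0 => /eqP.
apply: mxtrace_adj_eq0; by rewrite -[RHS]f1 /f mulmx1.
Qed.

Lemma adjoint_map_uniq (phi : 'M[C]_m) (a : 'M[C]_n) : a \in A ->
  (forall rho, state A rho -> expect phi (N rho) = expect a rho) ->
  adjoint_map A N phi = a.
Proof.
move=> aA ha; apply: xget_unique => // c [cA hc].
apply/eqP; rewrite eq_sym -subr_eq0; apply/eqP/state_separating; first exact: memvB.
by move=> rho hrho; rewrite /expect mulmxBr raddfB /= -!/(expect _ _) -ha // -hc // subrr.
Qed.

Lemma adjoint_mapP (B : {vspace 'M[C]_m}) (phi : 'M[C]_m) :
  linear_map A B N ->
  adjoint_map A N phi \in A /\
  forall rho, state A rho ->
    expect phi (N rho) = expect (adjoint_map A N phi) rho.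
Proof.
move=> [_ Nlin]; suff [a [aA ha]] : exists a, a \in A /\
    forall rho, rho \in A -> expect phi (N rho) = expect a rho.
  have hs rho (hrho : state A rho) := ha rho hrho.1.
  by rewrite (adjoint_map_uniq aA hs).
pose X := vbasis A; pose d := \dim A.
pose L (a : subvs_of A) : 'rV[C]_d := \row_i \tr (X`_i *m vsval a).
have Llin : linear L.
  move=> c x y; apply/rowP => i.
  by rewrite !mxE [vsval _]linearP /= mulmxDr -scalemxAr mxtraceD mxtraceZ.
pose Lm := GRing.isLinear.Build _ _ _ _ L Llin.
pose LL : {linear subvs_of A -> 'rV[C]_d} := HB.pack L Lm.
have trA (a : 'M[C]_n) : (forall i : 'I_d, \tr (X`_i *m a) = 0) ->
    forall x, x \in A -> \tr (x *m a) = 0.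
  move=> h x /coord_vbasis ->; rewrite mulmx_suml raddf_sum big1 //= => i _.
  by rewrite -scalemxAl mxtraceZ h mulr0.
have ker0 : lker (linfun LL) == 0%VS.
  apply/lker0P => x y; rewrite !lfunE /= => /rowP hxy.
  apply/val_inj/eqP; rewrite -subr_eq0.
  apply/eqP; apply: mxtrace_adj_eq0; apply: trA; last first.
    by case: hA => _ _; apply; rewrite memvB // subvsP.
  move=> i; rewrite mulmxBr raddfB /=; move: (hxy i); rewrite !mxE => ->.
  by rewrite subrr.
have full : limg (linfun LL) = fullv.
  apply/eqP; rewrite eqEdim subvf limg_dim_eq ?(eqP ker0) ?capv0 //.
  by rewrite !dimvf /dim /= mul1n.
pose r : 'rV[C]_d := \row_i \tr (N X`_i *m phi).
have /memv_imgP[a _ ra] : r \in limg (linfun LL) by rewrite full memvf.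
exists (vsval a); split; first exact: subvsP.
have NX (k : 'I_d -> C) : N (\sum_i k i *: X`_i) = \sum_i k i *: N X`_i.
  have N0 : N 0 = 0 by have := Nlin (-1) 0 0 (mem0v _) (mem0v _); rewrite scaler0 addr0 scaleN1r addNr.
  suff [] : N (\sum_i k i *: X`_i) = \sum_i k i *: N X`_i /\ \sum_i k i *: X`_i \in A by [].
  apply: (big_rec2 (fun y z => N y = z /\ y \in A)) => [|i y z _ [<- yA]].
    by rewrite mem0v.
  have XA : X`_i \in A by rewrite vbasis_mem // mem_nth // size_tuple.
  by rewrite Nlin // memvD ?memvZ.
move=> x /coord_vbasis ->; rewrite /expect NX !mulmx_suml !raddf_sum /=.
apply: eq_bigr => i _; rewrite -!scalemxAl !mxtraceZ; congr (_ * _).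
by move/rowP/(_ i): ra; rewrite lfunE !mxE.
Qed.

End AdjointWellDefined.

Section Recovery.
Context {R : realType}.
Local Notation C := R[i].

Definition petz n m (A : {vspace 'M[C]_n}) (sigma : 'M[C]_n)
    (N : 'M[C]_n -> 'M[C]_m) (gamma : 'M[C]_m) : 'M[C]_n :=
  mxsqrt sigma
  *m adjoint_map A N
       (mxpow (N sigma) (- 2^-1)%:C *m gamma *m mxpow (N sigma) (- 2^-1)%:C)
  *m mxsqrt sigma.

Definition cosh (t : R) : R := (expR t + expR (- t)) / 2.

Definition beta0 (t : R) : R := pi / 2 * (cosh (pi * t) + 1)^-1.

Definition recovery n m (A : {vspace 'M[C]_n}) (sigma : 'M[C]_n)
    (N : 'M[C]_n -> 'M[C]_m) (gamma : 'M[C]_m) : 'M[C]_n :=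
  mxintegral (fun t : R =>
    (beta0 t)%:C *:
      (mxpow sigma (0 +i* (- (t / 2)))
       *m petz A sigma N
            (mxpow (N sigma) (0 +i* (t / 2)) *m gamma
             *m mxpow (N sigma) (0 +i* (- (t / 2))))
       *m mxpow sigma (0 +i* (t / 2)))).

End Recovery.

(* Main.v *)
(* Let T be the adjoint of N, and put
     f(z) = tr (rho^(1 - z/2) T(N(rho)^(z/2) N(sigma)^(-z/2)) sigma^(z/2)).
   In the eigenbases f is a finite sum of exponentials, f(0) = 1, and 2 f'(0) is minus the
   difference of relative entropies (in natural logarithms). Complete positivity of T and the
   Cauchy-Schwarz inequality give |f| <= 1 on the line Re z = 0, and bound the real part of
   the mean of f(1 + it) against beta0 by the fidelity F of rho and its recovered state: the
   integrand is an overlap of sqrt rho with a vector that purifies the rotated Petz recovery.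
   The density beta0 is the normal derivative at the boundary of the Poisson kernel
   sin(pi x) / (2 (cosh(pi t) - cos(pi x))) of the strip 0 < Re z < 1. Comparing the Poisson
   formula for f(z) exp(-c z) with its boundary values as Re z tends to 0 gives
   Re f'(0) - c <= exp(-c) F - 1 for every real c, and c = ln F is the claim (when F = 0, the
   inequality for all c is contradictory). The Poisson formula is only needed for exponentials,
   for which it is proved by differentiating in x under the integral. *)
Require Import Defs.
From mathcomp Require Import measurable_realfun ring lra.
Import Order.TTheory GRing.Theory Num.Theory.
Import numFieldNormedType.Exports.
Set Implicit Arguments.
Unset Strict Implicit.
Unset Printing Implicit Defensive.
Local Open Scope classical_set_scope.
Local Open Scope sesquilinear_scope.
Local Open Scope ring_scope.

(** The factor exp (- c z) stands in for the logarithm of |f|: every inequality stays linear in f,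
    and the choice of [c] restores the logarithm at the end. Linearity lets the mean over t be taken
    before the fidelity, so that one averaged recovery map appears rather than a mean of logarithms
    of fidelities.

    The obstacle is that [beta0] is the Poisson kernel of no interior point. With C = cosh (pi t),
    the kernel of the right edge seen from x is sin (pi x) / (2 (C + cos (pi x))); for small x it is
    x (pi / 2) / (C + 1), which is x beta0 t, up to a relative error that tends to 0 uniformly in t.
    On the left edge the real part is at most 1 and the kernel has mass 1 - x.

    At a real point the halves t < 0 and t > 0 fold together and leave only cosines, so the Poisson
    integrals run over t >= 0. The matrix part is kept apart from R[i] and from Lebesgue measure:
    powers are known by four rules, the average by the rules of a mean, and N, once its adjoint T is
    known to be unital and completely positive, by tr (N(rho) x) = tr (rho T(x)) and the same for
    sigma. *)

(** * Computing real derivatives *)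

Section RealDerivatives.
Context {R : realType}.
Implicit Types (f g : R -> R) (x a b k : R).

(* A copy of [is_derive _ 1] kept away from type class resolution, whose
   derivatives come in an unreadable form. *)
Definition has_der x f a : Prop := is_derive x 1 f a.

Lemma der_eq f x a b : has_der x f a -> a = b -> has_der x f b.
Proof. by move=> fa <-. Qed.

Lemma der_cst k x : has_der x (fun _ : R => k) 0.
Proof. exact: is_derive_cst. Qed.

Lemma der_id x : has_der x (fun y : R => y) 1.
Proof. exact: is_derive_id. Qed.

Lemma der_add f g x a b : has_der x f a -> has_der x g b ->
  has_der x (fun y => f y + g y) (a + b).
Proof. exact: is_deriveD. Qed.

Lemma der_opp f x a : has_der x f a -> has_der x (fun y => - f y) (- a).
Proof. exact: is_deriveN. Qed.

Lemma der_mul f g x a b : has_der x f a -> has_der x g b ->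
  has_der x (fun y => f y * g y) (a * g x + f x * b).
Proof.
move=> fa gb; have := is_deriveM fa gb.
by rewrite /GRing.scale /= (mulrC (g x)) addrC.
Qed.

Lemma der_inv f x a : f x != 0 -> has_der x f a ->
  has_der x (fun y => (f y)^-1) (- a * (f x ^+ 2)^-1).
Proof.
move=> f0 fa; have := is_deriveV f0 fa.
by rewrite /GRing.scale /= mulNr mulrC mulNr.
Qed.

Lemma der_expR f x a : has_der x f a ->
  has_der x (fun y => expR (f y)) (expR (f x) * a).
Proof. by move=> fa; apply: (is_derive1_comp (is_derive_expR _) fa). Qed.

Lemma der_sin f x a : has_der x f a ->
  has_der x (fun y => sin (f y)) (cos (f x) * a).
Proof. by move=> fa; apply: (is_derive1_comp (is_derive_sin _) fa). Qed.

Lemma der_cos f x a : has_der x f a ->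
  has_der x (fun y => cos (f y)) (- sin (f x) * a).
Proof. by move=> fa; apply: (is_derive1_comp (is_derive_cos _) fa). Qed.

Lemma der_continuous f : (forall x, exists a, has_der x f a) -> continuous f.
Proof.
move=> df x; have [a [fx _]] := df x.
exact/differentiable_continuous/derivable1_diffP.
Qed.

End RealDerivatives.

(** Recursion on the shape of the function fills in the derivative as an existential. [eassumption]
    comes first, so that hypotheses serve as rules for opaque subterms; nonvanishing conditions of
    inverses are left as goals. *)
Ltac der := first
  [ eassumption | exact: der_cst | exact: der_id | apply: der_add; der | apply: der_opp; der
  | apply: der_expR; der | apply: der_sin; der | apply: der_cos; der
  | apply: der_inv; [ | der] | apply: der_mul; der | idtac ].
Ltac derive_by := (eapply der_eq; [der | rewrite /=]).

(** * The Poisson formula for the strip *)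

Section HalfLine.
Context {R : realType}.
Notation mu := (@lebesgue_measure R).
Implicit Types (f F g : R -> R) (x a b k C : R).

Lemma continuous_measurable_EFin (D : set R) f : measurable D -> continuous f ->
  measurable_fun D (EFin \o f).
Proof.
move=> mD cf; apply/measurable_EFinP; apply: measurable_funTS.
exact: continuous_measurable_fun.
Qed.

Lemma cvg_expRN a : 0 < a -> expR (- (a * x)) @[x --> +oo] --> (0 : R).
Proof.
move=> a0; apply: (@cvg_comp _ _ _ (fun x => a * x) (fun x => expR (- x)) +oo +oo).
  under eq_fun do rewrite mulrC.
  exact: (gt0_cvgMly a0 (@cvg_id _ (pinfty_nbhs R))).
exact: cvgr_expR.
Qed.

Lemma integral_expRN a : 0 < a ->
  (\int[mu]_(t in `[0%R, +oo[) (expR (- (a * t))%R)%:E = a^-1%:E)%E.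
Proof.
move=> a0; have an0 := lt0r_neq0 a0.
have dF (x : R) : has_der x (fun t => - (a^-1 * expR (- (a * t)))) (expR (- (a * x))).
  by derive_by; field.
rewrite (@ge0_continuous_FTC2y _ _ (fun t => - (a^-1 * expR (- (a * t)))) 0 0).
- by rewrite mulr0 oppr0 expR0 mulr1 -EFinB sub0r opprK.
- by move=> x _; exact: expR_ge0.
- apply/continuous_subspaceT/der_continuous => x; eexists; der.
- rewrite -oppr0 -(mulr0 a^-1); apply: cvgN; apply: cvgMl_tmp; exact: cvg_expRN.
- by move=> x _; case: (dF x).
- apply: cvg_at_right_filter; exact: (der_continuous (fun x => ex_intro _ _ (dF x))).
- by move=> x _; rewrite derive1E; case: (dF x) => _ ->.
Qed.

Lemma integrable_expRN a : 0 < a ->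
  mu.-integrable `[0%R, +oo[ (EFin \o (fun t : R => expR (- (a * t)))).
Proof.
move=> a0; apply/integrableP; split.
  by apply: continuous_measurable_EFin => //; apply: der_continuous => x; eexists; der.
under eq_integral do rewrite /= ger0_norm ?expR_ge0 //.
by rewrite integral_expRN // ltry.
Qed.

Lemma dominated_integrable f C a : 0 < a -> continuous f ->
  (forall t, 0 <= t -> `|f t| <= C * expR (- (a * t))) ->
  mu.-integrable `[0%R, +oo[ (EFin \o f).
Proof.
move=> a0 cf fC.
apply: (@le_integrable _ _ _ mu _ _ _ (EFin \o (fun t => C * expR (- (a * t))))) => //.
- exact: continuous_measurable_EFin.
- move=> t /=; rewrite in_itv /= andbT => t0; rewrite lee_fin.
  by rewrite (le_trans (fC t t0)) // ler_norm.
- rewrite (_ : _ \o _ = (fun t => C%:E * (EFin \o (fun t => expR (- (a * t)))) t)%E) //.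
  by apply: integrableZl => //; exact: integrable_expRN.
Qed.

Lemma dominated_Rintegral_le f C a : 0 < a -> continuous f ->
  (forall t, 0 <= t -> `|f t| <= C * expR (- (a * t))) ->
  `|\int[mu]_(t in `[0%R, +oo[) f t| <= C / a.
Proof.
move=> a0 cf fC; have intf := dominated_integrable a0 cf fC.
have intC : mu.-integrable `[0%R, +oo[ (EFin \o (fun t => C * expR (- (a * t)))).
  apply: (@dominated_integrable _ `|C| a) => //.
    by apply: der_continuous => x; eexists; der.
  by move=> t _; rewrite normrM (ger0_norm (expR_ge0 _)).
apply: (le_trans (le_normr_Rintegral _ intf)) => //.
rewrite (_ : C / a = \int[mu]_(t in `[0%R, +oo[) (C * expR (- (a * t)))); last first.
  rewrite RintegralZl //; last exact: integrable_expRN.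
  by rewrite /Rintegral integral_expRN.
apply: le_Rintegral => //.
- exact: integrable_norm.
- by move=> t /=; rewrite in_itv /= andbT; exact: fC.
Qed.

(* Adding a dominating exponential makes the integrand nonnegative. *)
Lemma dominated_FTC2y f F C a l : 0 < a -> continuous f ->
  (forall t, 0 <= t -> `|f t| <= C * expR (- (a * t))) ->
  (forall t, has_der t F (f t)) -> F t @[t --> +oo] --> l ->
  \int[mu]_(t in `[0%R, +oo[) f t = l - F 0.
Proof.
move=> a0 cf fC dF Fl; have an0 := lt0r_neq0 a0.
pose h t := C * expR (- (a * t)); pose H t := - (C / a * expR (- (a * t))).
have dH (x : R) : has_der x H (h x).
  by derive_by; rewrite /h; field.
have ch : continuous h by apply: der_continuous => x; eexists; der.
have inth : mu.-integrable `[0%R, +oo[ (EFin \o h).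
  apply: (@dominated_integrable _ `|C| a) => //.
  by move=> t _; rewrite normrM (ger0_norm (expR_ge0 _)).
have intf := dominated_integrable a0 cf fC.
have dFH t : has_der t (fun t => F t + H t) (f t + h t) by apply: der_add.
have Ih : \int[mu]_(t in `[0%R, +oo[) h t = C / a.
  rewrite RintegralZl //; last exact: integrable_expRN.
  by rewrite /Rintegral integral_expRN.
have : \int[mu]_(t in `[0%R, +oo[) (f t + h t) = l - (F 0 + H 0).
  apply: (@Rintegral_ge0_continuous_FTC2y _ _ (fun t => F t + H t)).
  - move=> t t0; have := fC t t0; rewrite ler_norml => /andP[+ _].
    by rewrite -subr_ge0 opprK.
  - apply: continuous_subspaceT => x; apply: cvgD; [exact: cf|exact: ch].
  - rewrite -[l]addr0; apply: cvgD => //.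
    rewrite -oppr0 -(mulr0 (C / a)); apply: cvgN; apply: cvgMl_tmp; exact: cvg_expRN.
  - by move=> x _; case: (dFH x).
  - by apply: cvg_at_right_filter; exact: (der_continuous (fun x => ex_intro _ _ (dFH x))).
  - by move=> x _; rewrite derive1E; case: (dFH x) => _ ->.
rewrite RintegralD // Ih /H mulr0 oppr0 expR0 mulr1; set q := C / a; lra.
Qed.

End HalfLine.

(** * The Poisson kernel of the strip, its conjugate and the Cauchy-Riemann equations *)

Section StripKernel.
Context {R : realType}.
Notation mu := (@lebesgue_measure R).
Implicit Types (l x t q : R).

Definition strip_den x t : R := cosh (pi * t) - cos (pi * x).
Definition poisson x t : R := sin (pi * x) / (2 * strip_den x t).
(** Minus the imaginary part of (cot (pi z / 2) + i) / 2. The added i cancels the limit - i of the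
    cotangent as t tends to +oo, and turns sinh in the numerator into a decaying exponential. *)
Definition poisson_conj x t : R :=
  (cos (pi * x) - expR (- (pi * t))) / (2 * strip_den x t).

(* [strip_re l x t - i strip_im l x t] is [exp (- l z) (cot (pi z / 2) + i) / 2] at
   [z = x + i t], holomorphic and exponentially decaying as [t] tends to +oo. *)
Definition strip_re l x t : R :=
  expR (- (l * x)) * (poisson x t * cos (l * t) - poisson_conj x t * sin (l * t)).
Definition strip_im l x t : R :=
  expR (- (l * x)) * (poisson_conj x t * cos (l * t) + poisson x t * sin (l * t)).

Definition dpoisson x t : R :=
  pi / 2 * (cos (pi * x) * cosh (pi * t) - 1) / strip_den x t ^+ 2.
Definition dpoisson_conj x t : R :=
  - (pi / 2 * (sin (pi * x) * ((expR (pi * t) - expR (- (pi * t))) / 2)) /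
     strip_den x t ^+ 2).
Definition dstrip l x t : R :=
  - (l * strip_re l x t) + expR (- (l * x)) *
    (dpoisson x t * cos (l * t) - dpoisson_conj x t * sin (l * t)).

Lemma expRMN (y : R) : expR y * expR (- y) = 1.
Proof. by rewrite -expRD subrr expR0. Qed.

Lemma cosh_ge1 (y : R) : 1 <= cosh y.
Proof.
rewrite /cosh; have := expRMN y; have := expR_gt0 y; have := expR_gt0 (- y).
set a := expR y; set b := expR (- y) => b0 a0 ab; have := sqr_ge0 (a - b); nra.
Qed.

Lemma cos_pi_lt1 x : 0 < x < 1 -> `|cos (pi * x)| < 1.
Proof.
move=> /andP[x0 x1]; have p0 := pi_gt0 R.
have s0 : 0 < sin (pi * x).
  by apply: sin_gt0_pi; rewrite ?mulr_gt0 // -subr_gt0 -{1}[pi]mulr1 -mulrBr mulr_gt0 // subr_gt0.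
have := cos2Dsin2 (pi * x); rewrite ltr_norml; set c := cos _; set s := sin _ in s0 *.
move=> cs; apply/andP; split; nra.
Qed.

Lemma sin_pi_gt0 x : 0 < x < 1 -> 0 < sin (pi * x).
Proof.
move=> /andP[x0 x1]; have p0 := pi_gt0 R.
by apply: sin_gt0_pi; rewrite ?mulr_gt0 // -subr_gt0 -{1}[pi]mulr1 -mulrBr mulr_gt0 // subr_gt0.
Qed.

Lemma strip_den_gt0 x t : 0 < x < 1 -> 0 < strip_den x t.
Proof.
move=> /cos_pi_lt1; rewrite ltr_norml => /andP[_ c1].
by have := cosh_ge1 (pi * t); rewrite /strip_den; lra.
Qed.

Lemma der_poisson x t : 0 < x < 1 ->
  has_der x (poisson ^~ t) (dpoisson x t).
Proof.
move=> x01; have D0 := lt0r_neq0 (strip_den_gt0 t x01).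
rewrite /poisson /strip_den; derive_by; first by rewrite mulf_neq0 ?pnatr_eq0.
rewrite /dpoisson; have := cos2Dsin2 (pi * x); move: D0; rewrite /strip_den.
set c := cos _; set s := sin _; set ch := cosh _ => D0 cs.
have -> : c * ch - 1 = c * (ch - c) - s ^+ 2 by rewrite -cs; ring.
by field.
Qed.

Lemma der_poisson_conj x t : 0 < x < 1 ->
  has_der x (poisson_conj ^~ t) (dpoisson_conj x t).
Proof.
move=> x01; have D0 := lt0r_neq0 (strip_den_gt0 t x01).
rewrite /poisson_conj /strip_den; derive_by; first by rewrite mulf_neq0 ?pnatr_eq0.
rewrite /dpoisson_conj; move: D0; rewrite /strip_den /cosh.
set c := cos _; set s := sin _; set E := expR _; set E' := expR _ => D0.
have D1 : E + E' + - c * 2 != 0.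
  apply: contra_neq D0 => h; have -> : (E + E') / 2 - c = (E + E' + - c * 2) / 2 by field.
  by rewrite h mul0r.
by field.
Qed.

(** A Cauchy-Riemann equation for the holomorphic function with real part [poisson] and imaginary
    part [- poisson_conj]: the same [dpoisson_conj] is the derivative of [poisson_conj] in x. *)
Lemma der_poisson_t x t : 0 < x < 1 ->
  has_der t (poisson x) (dpoisson_conj x t).
Proof.
move=> x01; have D0 := lt0r_neq0 (strip_den_gt0 t x01).
rewrite /poisson /strip_den /cosh; derive_by.
  by rewrite mulf_neq0 ?pnatr_eq0.
rewrite /dpoisson_conj; move: D0; rewrite /strip_den /cosh.
set c := cos _; set s := sin _; set E := expR _; set E' := expR _ => D0.
have D1 : E + E' + - c * 2 != 0.
  apply: contra_neq D0 => h; have -> : (E + E') / 2 - c = (E + E' + - c * 2) / 2 by field.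
  by rewrite h mul0r.
by field.
Qed.

Lemma der_poisson_conj_t x t : 0 < x < 1 ->
  has_der t (poisson_conj x) (- dpoisson x t).
Proof.
move=> x01; have D0 := lt0r_neq0 (strip_den_gt0 t x01).
rewrite /poisson_conj /strip_den /cosh; derive_by.
  by rewrite mulf_neq0 ?pnatr_eq0.
rewrite /dpoisson; move: D0; rewrite /strip_den /cosh; have := expRMN (pi * t).
set c := cos _; set E := expR _; set E' := expR _ => EE D0.
have D1 : E + E' + - c * 2 != 0.
  apply: contra_neq D0 => h; have -> : (E + E') / 2 - c = (E + E' + - c * 2) / 2 by field.
  by rewrite h mul0r.
have -> : c * ((E + E') / 2) - 1 = c * ((E + E') / 2) - E * E' by rewrite EE.
by field.
Qed.

Lemma der_strip_re l x t : 0 < x < 1 ->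
  has_der x (fun y => strip_re l y t) (dstrip l x t).
Proof.
move=> x01; have dA := der_poisson t x01; have dB := der_poisson_conj t x01.
by rewrite /strip_re; derive_by; rewrite /dstrip /strip_re; ring.
Qed.

(** Cauchy-Riemann again: the x-derivative of [strip_re] is a t-derivative, so integrating it over t
    leaves only boundary terms. *)
Lemma der_strip_im l x t : 0 < x < 1 ->
  has_der t (strip_im l x) (- dstrip l x t).
Proof.
move=> x01; have dA := der_poisson_t t x01; have dB := der_poisson_conj_t t x01.
by rewrite /strip_im; derive_by; rewrite /dstrip /strip_re; ring.
Qed.

End StripKernel.

(** * Decay of the kernels and differentiation under the integral *)

Section StripBounds.
Context {R : realType}.
Notation mu := (@lebesgue_measure R).
Implicit Types (l x t q : R).

(** Since cosh >= 1, cosh - q >= (1 - q) cosh, and cosh (pi t) >= exp (pi t) / 2. Having [q] as a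
    parameter makes the estimate uniform for x in a neighbourhood. *)
Lemma strip_den_ge x t q : 0 <= t -> `|cos (pi * x)| <= q -> q < 1 ->
  (strip_den x t)^-1 <= 2 / (1 - q) * expR (- (pi * t)).
Proof.
move=> t0 cq q1; have p0 := pi_gt0 R.
have E1 : 1 <= expR (pi * t) by rewrite -[leLHS]expR0 ler_expR mulr_ge0 // ltW.
have E0 := expR_gt0 (- (pi * t)); have EE := expRMN (pi * t).
have q0 : 0 <= q by apply: le_trans cq; apply: normr_ge0.
have cq' : cos (pi * x) <= q by apply: le_trans cq; exact: ler_norm.
have D : (1 - q) / 2 * expR (pi * t) <= strip_den x t.
  have := cosh_ge1 (pi * t); rewrite /strip_den /cosh.
  move: cq' E0 EE E1; set a := expR _; set b := expR _ => cq' E0 EE E1 h; nra.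
have D1 : 0 < (1 - q) / 2 * expR (pi * t) by rewrite mulr_gt0 ?expR_gt0 // divr_gt0 // subr_gt0.
apply: (@le_trans _ _ ((1 - q) / 2 * expR (pi * t))^-1).
  by rewrite lef_pV2 // posrE // (lt_le_trans D1).
by rewrite expRN invfM invf_div.
Qed.

Lemma poisson_norm_le x t q : 0 < x < 1 -> 0 <= t -> `|cos (pi * x)| <= q -> q < 1 ->
  `|poisson x t| <= 2 / (1 - q) * expR (- (pi * t)).
Proof.
move=> x01 t0 cq q1; apply: le_trans (strip_den_ge t0 cq q1).
have D0 := strip_den_gt0 t x01.
rewrite /poisson normrM normfV [`|2 * _|]gtr0_norm ?mulr_gt0 // ler_pdivrMr ?mulr_gt0 //.
rewrite mulrCA mulVf ?lt0r_neq0 // mulr1.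
by rewrite (le_trans _ (_ : 1 <= 2)) ?ler1n // ler_norml sin_geN1 sin_le1.
Qed.

Lemma expRN_le1 t : 0 <= t -> expR (- (pi * t)) <= 1 :> R.
Proof. by move=> t0; rewrite -[leRHS]expR0 ler_expR oppr_le0 mulr_ge0 // ltW // pi_gt0. Qed.

Lemma poisson_conj_norm_le x t q : 0 < x < 1 -> 0 <= t -> `|cos (pi * x)| <= q -> q < 1 ->
  `|poisson_conj x t| <= 2 / (1 - q) * expR (- (pi * t)).
Proof.
move=> x01 t0 cq q1; apply: le_trans (strip_den_ge t0 cq q1).
have D0 := strip_den_gt0 t x01.
rewrite /poisson_conj normrM normfV [`|2 * _|]gtr0_norm ?mulr_gt0 // ler_pdivrMr ?mulr_gt0 //.
rewrite mulrCA mulVf ?lt0r_neq0 // mulr1.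
have := expRN_le1 t0; have := expR_ge0 (- (pi * t)).
have := cos_le1 (pi * x); have := cos_geN1 (pi * x).
by rewrite ler_norml => *; apply/andP; split; lra.
Qed.

(** The numerator grows at most like exp (pi t) and the inverse square of the denominator decays
    like exp (- 2 pi t), so one decaying exponential is left. *)
Lemma dpoisson_bound x t q (y : R) : 0 < x < 1 -> 0 <= t -> `|cos (pi * x)| <= q ->
  q < 1 -> `|y| <= 2 * expR (pi * t) ->
  `|pi / 2 * y / strip_den x t ^+ 2| <= 4 * pi / (1 - q) ^+ 2 * expR (- (pi * t)).
Proof.
move=> x01 t0 cq q1 hy; have p0 := pi_gt0 R.
have D0 := strip_den_gt0 t x01; have := strip_den_ge t0 cq q1.
set d := (strip_den x t)^-1 => hd; have d0 : 0 < d by rewrite invr_gt0.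
have E0 := expR_gt0 (- (pi * t)); have EE := expRMN (pi * t).
have -> : pi / 2 * y / strip_den x t ^+ 2 = pi / 2 * (y * d ^+ 2) by rewrite exprVn mulrA.
rewrite normrM gtr0_norm ?divr_gt0 // normrM (gtr0_norm (exprn_gt0 _ d0)).
have -> : 4 * pi / (1 - q) ^+ 2 * expR (- (pi * t)) =
    pi / 2 * (2 * expR (pi * t) * (2 / (1 - q) * expR (- (pi * t))) ^+ 2).
  transitivity (4 * pi / (1 - q) ^+ 2 * expR (- (pi * t)) * (expR (pi * t) * expR (- (pi * t)))).
    by rewrite EE mulr1.
  by field; lra.
apply: ler_wpM2l; first by rewrite divr_ge0 // ltW.
apply: ler_pM => //; first exact: exprn_ge0 (ltW d0).
by rewrite lerXn2r ?nnegrE ?(ltW d0) // (le_trans (ltW d0)).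
Qed.

Lemma dpoisson_norm_le x t q : 0 < x < 1 -> 0 <= t -> `|cos (pi * x)| <= q -> q < 1 ->
  `|dpoisson x t| <= 4 * pi / (1 - q) ^+ 2 * expR (- (pi * t)).
Proof.
move=> x01 t0 cq q1; apply: dpoisson_bound => //.
have E1 : 1 <= expR (pi * t) by rewrite -[leLHS]expR0 ler_expR mulr_ge0 // ltW // pi_gt0.
have := expRN_le1 t0; have := expR_ge0 (- (pi * t)).
have := cos_le1 (pi * x); have := cos_geN1 (pi * x).
rewrite /cosh; move: E1; set c := cos _; set a := expR _; set b := expR _.
by move=> a1 c1 c2 b0 b1; rewrite ler_norml; apply/andP; split; nra.
Qed.

Lemma dpoisson_conj_norm_le x t q : 0 < x < 1 -> 0 <= t -> `|cos (pi * x)| <= q -> q < 1 ->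
  `|dpoisson_conj x t| <= 4 * pi / (1 - q) ^+ 2 * expR (- (pi * t)).
Proof.
move=> x01 t0 cq q1; rewrite normrN; apply: dpoisson_bound => //.
have E1 : 1 <= expR (pi * t) by rewrite -[leLHS]expR0 ler_expR mulr_ge0 // ltW // pi_gt0.
have := expRN_le1 t0; have := expR_ge0 (- (pi * t)).
have := sin_le1 (pi * x); have := sin_geN1 (pi * x).
move: E1; set c := sin _; set a := expR _; set b := expR _.
by move=> a1 c1 c2 b0 b1; rewrite ler_norml; apply/andP; split; nra.
Qed.

Lemma rotation_norm_le (a b y k : R) : `|a| <= k -> `|b| <= k ->
  `|a * cos y - b * sin y| <= 2 * k.
Proof.
move=> ak bk; apply: (le_trans (ler_normB _ _)).
rewrite !normrM mulr_natl mulr2n; apply: lerD.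
  by rewrite -[k]mulr1; apply: ler_pM => //; rewrite ler_norml cos_geN1 cos_le1.
by rewrite -[k]mulr1; apply: ler_pM => //; rewrite ler_norml sin_geN1 sin_le1.
Qed.

Lemma expRNM_le l x : 0 < x < 1 -> expR (- (l * x)) <= expR `|l|.
Proof.
move=> /andP[x0 x1]; rewrite ler_expR (le_trans (ler_norm _)) // normrN normrM.
by rewrite (gtr0_norm x0) ler_piMr // ltW.
Qed.

Definition strip_const l q : R :=
  `|l| * (expR `|l| * (2 * (2 / (1 - q)))) + expR `|l| * (2 * (4 * pi / (1 - q) ^+ 2)).

Lemma strip_re_norm_le l x t q : 0 < x < 1 -> 0 <= t -> `|cos (pi * x)| <= q -> q < 1 ->
  `|strip_re l x t| <= expR `|l| * (2 * (2 / (1 - q))) * expR (- (pi * t)).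
Proof.
move=> x01 t0 cq q1; rewrite normrM -[leRHS]mulrA; apply: ler_pM => //.
  by rewrite gtr0_norm ?expR_gt0 // expRNM_le.
rewrite -[leRHS]mulrA; apply: rotation_norm_le; first exact: poisson_norm_le.
exact: poisson_conj_norm_le.
Qed.

Lemma strip_im_norm_le l x t q : 0 < x < 1 -> 0 <= t -> `|cos (pi * x)| <= q -> q < 1 ->
  `|strip_im l x t| <= expR `|l| * (2 * (2 / (1 - q))) * expR (- (pi * t)).
Proof.
move=> x01 t0 cq q1; rewrite normrM -[leRHS]mulrA; apply: ler_pM => //.
  by rewrite gtr0_norm ?expR_gt0 // expRNM_le.
rewrite -[leRHS]mulrA -[poisson _ _ * sin _]opprK -mulNr; apply: rotation_norm_le.
  exact: poisson_conj_norm_le.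
by rewrite normrN; exact: poisson_norm_le.
Qed.

Lemma dstrip_norm_le l x t q : 0 < x < 1 -> 0 <= t -> `|cos (pi * x)| <= q -> q < 1 ->
  `|dstrip l x t| <= strip_const l q * expR (- (pi * t)).
Proof.
move=> x01 t0 cq q1; rewrite /strip_const mulrDl.
apply: (le_trans (ler_normD _ _)); rewrite normrN normrM; apply: lerD.
  by rewrite -[leRHS]mulrA; apply: ler_wpM2l => //; exact: strip_re_norm_le.
rewrite normrM -[leRHS]mulrA; apply: ler_pM => //.
  by rewrite gtr0_norm ?expR_gt0 // expRNM_le.
rewrite -[leRHS]mulrA; apply: rotation_norm_le; first exact: dpoisson_norm_le.
exact: dpoisson_conj_norm_le.
Qed.

Lemma continuous_poisson x : 0 < x < 1 -> continuous (poisson x).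
Proof. by move=> x01; apply: der_continuous => t; eexists; exact: der_poisson_t. Qed.

Lemma continuous_strip_re l x : 0 < x < 1 -> continuous (strip_re l x).
Proof.
move=> x01; apply: der_continuous => t.
have dA := der_poisson_t t x01; have dB := der_poisson_conj_t t x01.
by rewrite /strip_re; eexists; der.
Qed.

Lemma continuous_dstrip l x : 0 < x < 1 -> continuous (dstrip l x).
Proof.
move=> x01; apply: der_continuous => t.
have dA := der_poisson_t t x01; have dB := der_poisson_conj_t t x01.
have D0 := lt0r_neq0 (strip_den_gt0 t x01).
rewrite /dstrip /strip_re /dpoisson /dpoisson_conj /strip_den /cosh.
by eexists; der; rewrite sqrf_eq0.
Qed.

(** [- strip_im] is a primitive in t that vanishes at +oo; at t = 0 [poisson_conj] is - 1/2 for
    every x, whence an elementary value. *)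
Lemma strip_Rintegral_dstrip l x : 0 < x < 1 ->
  \int[mu]_(t in `[0%R, +oo[) dstrip l x t = - (2^-1 * expR (- (l * x))).
Proof.
move=> x01; have c1 := cos_pi_lt1 x01; have p0 := pi_gt0 R.
have S0 : strip_im l x 0 = - (2^-1 * expR (- (l * x))).
  have D0 := lt0r_neq0 (strip_den_gt0 0 x01).
  move: D0; rewrite /strip_im /poisson_conj /poisson /strip_den /cosh !mulr0 oppr0.
  by rewrite expR0 cos0 sin0 => D0; field; lra.
have dF t : has_der t (fun t => - strip_im l x t) (dstrip l x t).
  by rewrite -[dstrip _ _ _]opprK; apply: der_opp; exact: der_strip_im.
have F0 : - strip_im l x t @[t --> +oo] --> (0 : R).
  rewrite -oppr0; apply: cvgN; apply: norm_cvg0.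
  set k := expR `|l| * (2 * (2 / (1 - `|cos (pi * x)|))).
  apply: (@squeeze_cvgr _ _ _ _ (cst 0) (fun t => k * expR (- (pi * t)))).
  - apply: filterS (nbhs_pinfty_ge (num_real 0)) => t t0.
    by rewrite normr_ge0 /=; exact: strip_im_norm_le.
  - exact: cvg_cst.
  - by rewrite -(mulr0 k); apply: cvgMl_tmp; exact: cvg_expRN.
have cd := @continuous_dstrip l x x01.
have bd t (t0 : 0 <= t) := dstrip_norm_le l x01 t0 (lexx _) c1.
by rewrite (dominated_FTC2y p0 cd bd dF F0) sub0r opprK S0.
Qed.

Definition strip_integral l x : R := \int[mu]_(t in `[0%R, +oo[) strip_re l x t.

Lemma der_strip_integral l x : 0 < x < 1 ->
  has_der x (strip_integral l) (- (2^-1 * expR (- (l * x)))).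
Proof.
move=> x01; have c1 := cos_pi_lt1 x01; have p0 := pi_gt0 R.
(* The midpoint between |cos (pi x)| and 1 leaves room for |cos (pi y)| <= q for all y near x, which
   gives one dominating function for all of them. *)
set q := (1 + `|cos (pi * x)|) / 2.
have q1 : q < 1 by rewrite /q; lra.
have [e /= e0 he] : nbhs x (fun y => 0 < y < 1 /\ `|cos (pi * y)| <= q).
  have cc : {for x, continuous (fun y : R => `|cos (pi * y)|)}.
    apply: cvg_norm; apply: (der_continuous (f := fun y : R => cos (pi * y))) => y.
    by eexists; der.
  have cq : `|cos (pi * x)| < q by rewrite /q; lra.
  have nI : nbhs x (fun y => y \in `]0, 1[) by apply: near_in_itvoo; rewrite in_itv.
  apply: filterS2 nI (cvgr_lt _ cc _ cq) => y; rewrite in_itv /= => y01 yq.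
  by split => //; exact: ltW.
pose J : set R := `]x - e, x + e[%classic.
have I y : J y -> 0 < y < 1 /\ `|cos (pi * y)| <= q.
  rewrite /J /= in_itv /= => /andP[y1 y2]; apply: he.
  by rewrite /ball_ /= ltr_norml; apply/andP; split; lra.
have Ix : J x by rewrite /J /= in_itv /=; apply/andP; split; lra.
have int1 y : J y -> mu.-integrable `[0%R, +oo[ (EFin \o strip_re l y).
  move=> /I[y01 cy]; apply: (dominated_integrable p0 (@continuous_strip_re l y y01)).
  by move=> t t0; exact: (strip_re_norm_le l y01 t0 cy q1).
have d1 y t : J y -> is_derive y 1 (strip_re l ^~ t) (dstrip l y t).
  by move=> /I[y01 _]; exact: der_strip_re.
have derf y t : J y -> (`[0%R, +oo[%classic : set R) t -> derivable (strip_re l ^~ t) y 1.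
  by move=> Iy _; case: (d1 y t Iy).
have d1E y t : J y -> partial1of2 (strip_re l) y t = dstrip l y t.
  by move=> Iy; rewrite partial1of2E; case: (d1 y t Iy).
pose k := `|strip_const l q|; pose G t := k * expR (- (pi * t)).
have intG : mu.-integrable `[0%R, +oo[ (EFin \o G).
  apply: (@dominated_integrable R _ k pi) => //.
    by apply: der_continuous => t; rewrite /G; eexists; der.
  by move=> t _; rewrite /G ger0_norm ?mulr_ge0 ?expR_ge0 ?normr_ge0.
have G0 t : 0 <= G t by apply: mulr_ge0; rewrite ?normr_ge0 ?expR_ge0.
have Gub y t : J y -> (`[0%R, +oo[%classic : set R) t -> `|partial1of2 (strip_re l) y t| <= G t.
  move=> Iy; rewrite d1E // /= in_itv /= andbT => t0; have [y01 cy] := I _ Iy.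
  apply: (le_trans (dstrip_norm_le l y01 t0 cy q1)).
  by rewrite ler_wpM2r ?expR_ge0 // ler_norm.
have mI : measurable (`[0%R, +oo[%classic : set (measurableTypeR R)).
  exact: measurable_itv.
have D1 := @derivable_under_integral R _ _ mu _ _ mI x _ _ Ix int1 derf G G0 intG Gub.
have D2 := @differentiation_under_integral R _ _ mu _ _ mI x _ _ Ix int1 derf G G0 intG Gub.
rewrite -strip_Rintegral_dstrip //.
apply: DeriveDef; first exact: D1.
by rewrite -derive1E D2; apply: eq_Rintegral => t _; rewrite d1E.
Qed.

End StripBounds.

(** * Poisson integrals of cosines and their behaviour at the edges *)

Section StripPoisson.
Context {R : realType}.
Notation mu := (@lebesgue_measure R).
Implicit Types (l x t q : R).

Lemma constant_on01 (f : R -> R) : (forall x, 0 < x < 1 -> has_der x f 0) ->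
  exists c, forall x, 0 < x < 1 -> f x = c.
Proof.
move=> df; have key a b : 0 < a < 1 -> 0 < b < 1 -> a < b -> f a = f b.
  move=> /andP[a0 _] /andP[_ b1] ab.
  have I y : y \in `[a, b] -> 0 < y < 1.
    by rewrite in_itv /= => /andP[ay yb]; rewrite (lt_le_trans a0) // (le_lt_trans yb).
  have df' y : y \in `]a, b[ -> is_derive y 1 f 0.
    by move=> yab; apply/df/I; apply: subset_itv_oo_cc yab.
  have cf : {within `[a, b], continuous f}.
    by apply: derivable_within_continuous => y /I/df [].
  have [c _ /eqP] := MVT ab df' cf.
  by rewrite mul0r subr_eq0 => /eqP.
exists (f 2^-1) => x x01; have h01 : 0 < (2^-1 : R) < 1 by apply/andP; split; lra.
have [xh|hx|-> //] := ltgtP x 2^-1; first exact: key.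
by apply/esym/key.
Qed.

Lemma strip_integralE l : l != 0 -> exists c, forall x, 0 < x < 1 ->
  strip_integral l x = expR (- (l * x)) / (2 * l) + c.
Proof.
move=> l0.
have [x x01|c hc] := @constant_on01
    (fun x => strip_integral l x - expR (- (l * x)) / (2 * l)).
  have dS := der_strip_integral l x01.
  by derive_by; field.
by exists c => x /hc <-; rewrite addrC subrK.
Qed.

(** Half of the integral over the whole line, the integrand being even in t; hence the factors 2 in
    [poisson_formula]. *)
Definition poisson_cos l x : R :=
  \int[mu]_(t in `[0%R, +oo[) (poisson x t * cos (l * t)).

Lemma integrable_strip_re l x : 0 < x < 1 ->
  mu.-integrable `[0%R, +oo[ (EFin \o strip_re l x).
Proof.
move=> x01; apply: (dominated_integrable (pi_gt0 R) (@continuous_strip_re _ l x x01)).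
by move=> t t0; exact: (strip_re_norm_le l x01 t0 (lexx _) (cos_pi_lt1 x01)).
Qed.

(** Once the factors exp (- l x) and exp (l x) are removed, passing from l to - l changes only the
    sign of the term with the conjugate kernel, so that term drops out of the average. *)
Lemma poisson_cos_strip l x : 0 < x < 1 -> poisson_cos l x =
  (expR (l * x) * strip_integral l x + expR (- (l * x)) * strip_integral (- l) x) / 2.
Proof.
move=> x01; have i1 := integrable_strip_re l x01; have i2 := integrable_strip_re (- l) x01.
rewrite -RintegralZl // -RintegralZl // -RintegralD //; last 2 first.
- by apply: (@integrableZl _ _ _ mu _ (measurable_itv _) (expR (l * x)) (EFin \o strip_re l x)).
- by apply: (@integrableZl _ _ _ mu _ (measurable_itv _) (expR (- (l * x)))
    (EFin \o strip_re (- l) x)).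
rewrite -RintegralZr //; last first.
  apply: (@integrableD _ _ _ mu _ (measurable_itv _)
    (fun t => (expR (l * x) * strip_re l x t)%:E)
    (fun t => (expR (- (l * x)) * strip_re (- l) x t)%:E)).
  - by apply: (@integrableZl _ _ _ mu _ (measurable_itv _) (expR (l * x)) (EFin \o strip_re l x)).
  - by apply: (@integrableZl _ _ _ mu _ (measurable_itv _) (expR (- (l * x)))
    (EFin \o strip_re (- l) x)).
apply: eq_Rintegral => t _; rewrite /strip_re !mulNr opprK cosN sinN.
have := expRMN (l * x); set a := expR _; set b := expR _ => ab.
transitivity (a * b * (poisson x t * cos (l * t))); first by rewrite ab mul1r.
by field.
Qed.

Lemma poisson_ge0 x t : 0 < x < 1 -> 0 <= poisson x t.
Proof.
move=> x01; rewrite /poisson divr_ge0 // ?mulr_ge0 //; first exact/ltW/sin_pi_gt0.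
exact/ltW/strip_den_gt0.
Qed.

Lemma continuous_poisson_cos l x : 0 < x < 1 -> continuous (fun t => poisson x t * cos (l * t)).
Proof.
move=> x01; apply: der_continuous => t; have dA := der_poisson_t t x01.
by eexists; der.
Qed.

(** For x >= 1/2 the cosine in the denominator is nonpositive, so the kernel is at most sin (pi x)
    exp (- pi t). The bound tends to 0 with x tending to 1. *)
Lemma poisson_cos_right l x : 2^-1 <= x -> x < 1 -> `|poisson_cos l x| <= sin (pi * x) / pi.
Proof.
move=> hx x1; have x01 : 0 < x < 1 by apply/andP; split; lra.
have p0 := pi_gt0 R; have s0 := sin_pi_gt0 x01.
apply: dominated_Rintegral_le => //; first exact: continuous_poisson_cos.
move=> t t0; rewrite normrM -[leRHS]mulr1; apply: ler_pM => //; last first.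
  by rewrite ler_norml cos_geN1 cos_le1.
rewrite ger0_norm ?poisson_ge0 // /poisson ler_wpM2l //; first exact: ltW.
have c0 : cos (pi * x) <= 0.
  have -> : pi * x = pi * (x - 2^-1) + pi / 2 by field.
  rewrite cosDpihalf oppr_le0; apply: sin_ge0_pi; apply/andP; split; nra.
have E0 := expR_gt0 (pi * t); have E1 := expR_gt0 (- (pi * t)).
rewrite expRN lef_pV2 ?posrE //; first by rewrite /strip_den /cosh; lra.
by rewrite mulr_gt0 // strip_den_gt0.
Qed.

Lemma sin_norm_le (y : R) : 0 <= y -> `|sin y| <= y.
Proof.
move=> y0; have dsin z : z \in `]0, y[ -> is_derive z 1 (@sin R) (cos z).
  by move=> _; exact: is_derive_sin.
have csin : {within `[0, y], continuous (@sin R)}.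
  by apply: continuous_subspaceT; exact: continuous_sin.
have [c _] := MVT_segment y0 dsin csin.
rewrite sin0 !subr0 => ->; rewrite normrM (ger0_norm y0) ler_piMl //.
by rewrite ler_norml cos_geN1 cos_le1.
Qed.

(** The half-angle formula 1 - cos y = 2 sin (y / 2) ^ 2 together with |sin| <= id. *)
Lemma one_sub_cos_le (y : R) : 0 <= y -> 1 - cos y <= y ^+ 2 / 2.
Proof.
move=> y0; set z := y / 2; have -> : y = z + z by rewrite /z; field.
have z0 : 0 <= z by rewrite divr_ge0.
have : `|sin z| ^+ 2 <= z ^+ 2 by rewrite lerXn2r ?nnegrE ?sin_norm_le.
have := cos2Dsin2 z; rewrite cosD real_normK ?num_real // -!expr2.
have -> : (z + z) ^+ 2 = 4 * z ^+ 2 by ring.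
by set a := sin z ^+ 2; set b := z ^+ 2; set c := cos z ^+ 2; lra.
Qed.

Lemma one_sub_cos_norm l t : 0 <= t -> 1 - cos (l * t) <= (l * t) ^+ 2 / 2.
Proof.
move=> t0; have -> : cos (l * t) = cos (`|l| * t).
  by have [_|_] := ger0P l => //; rewrite mulNr cosN.
have -> : (l * t) ^+ 2 = (`|l| * t) ^+ 2 by rewrite !exprMn real_normK ?num_real.
by apply: one_sub_cos_le; rewrite mulr_ge0.
Qed.

(** With h = pi t / 4, a = exp h and b = exp (- h), cosh (4 h) - 1 = ((a - b) (a + b)) ^ 2 / 2,
    where a - b >= h and a + b >= a. The factor t ^ 2 will cancel the zero of 1 - cos (l t), and the
    exponential is kept for integrability. *)
Lemma cosh_sub1_ge t : 0 <= t ->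
  pi ^+ 2 / 32 * t ^+ 2 * expR (pi / 2 * t) <= cosh (pi * t) - 1.
Proof.
move=> t0; have p0 := pi_gt0 R; set h := pi * t / 4.
have h0 : 0 <= h by rewrite divr_ge0 // mulr_ge0 // ltW.
have -> : pi / 2 * t = h + h by rewrite /h; field.
rewrite /cosh; have -> : pi * t = (h + h) + (h + h) by rewrite /h; field.
rewrite !opprD !expRD; have := expR_ge1Dx h.
have := expRMN h; have := expR_gt0 (- h); have := expR_gt0 h.
have -> : pi ^+ 2 / 32 * t ^+ 2 = h ^+ 2 / 2 by rewrite /h; field.
set a := expR _; set b := expR _ => a0 b0 ab ha.
have hab : h <= a - b by nra.
have -> : (a * a * (a * a) + b * b * (b * b)) / 2 - 1 = ((a - b) * (a + b)) ^+ 2 / 2.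
  transitivity ((a * a * (a * a) + b * b * (b * b)) / 2 - (a * b) ^+ 2).
    by rewrite ab expr1n.
  by field.
have : h * a <= (a - b) * (a + b) by apply: ler_pM => //; lra.
set u := (a - b) * (a + b) => hu.
have ha0 : 0 <= h * a by rewrite mulr_ge0 // ltW.
have : (h * a) ^+ 2 <= u ^+ 2 by rewrite lerXn2r ?nnegrE // (le_trans ha0 hu).
by rewrite exprMn; set v := u ^+ 2; lra.
Qed.

(** As x tends to 0 the kernel concentrates at t = 0. Subtracting frequency 0 brings in 1 - cos (l
    t), whose double zero compensates the double zero of cosh (pi t) - 1, a lower bound for the
    denominator. *)
Lemma poisson_cos_left l x : 0 < x < 1 ->
  `|poisson_cos l x - poisson_cos 0 x| <= sin (pi * x) * (8 * l ^+ 2 / pi ^+ 2) / (pi / 2).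
Proof.
move=> x01; have p0 := pi_gt0 R; have s0 := sin_pi_gt0 x01.
have int k : mu.-integrable `[0%R, +oo[ (EFin \o (fun t => poisson x t * cos (k * t))).
  apply: (dominated_integrable p0 (@continuous_poisson_cos k x x01)) => t t0.
  rewrite normrM -[leRHS]mulr1; apply: ler_pM => //.
    exact: (poisson_norm_le x01 t0 (lexx _) (cos_pi_lt1 x01)).
  by rewrite ler_norml cos_geN1 cos_le1.
rewrite /poisson_cos -RintegralB; [|exact: measurable_itv|exact: int|exact: int].
apply: dominated_Rintegral_le; first by rewrite divr_gt0.
  move=> t; apply: cvgB; exact: continuous_poisson_cos.
move=> t t0; rewrite mul0r cos0 -mulrBr normrM ger0_norm ?poisson_ge0 // distrC.
rewrite ger0_norm ?subr_ge0 ?cos_le1 // /poisson -!mulrA; apply: ler_wpM2l; first exact: ltW.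
have D0 := strip_den_gt0 t x01; rewrite mulrC ler_pdivrMr ?mulr_gt0 //.
apply: (le_trans (one_sub_cos_norm l t0)).
have D1 : cosh (pi * t) - 1 <= strip_den x t by rewrite /strip_den lerB ?cos_le1.
have {D1}D1 := le_trans (cosh_sub1_ge t0) D1.
have EE := expRMN (pi / 2 * t); have E0 := expR_gt0 (- (pi / 2 * t)).
have -> : (l * t) ^+ 2 / 2 = (8 * (l ^+ 2 / pi ^+ 2)) * expR (- (pi / 2 * t)) *
   (2 * (pi ^+ 2 / 32 * t ^+ 2 * expR (pi / 2 * t))).
  transitivity ((l * t) ^+ 2 / 2 * (expR (pi / 2 * t) * expR (- (pi / 2 * t)))).
    by rewrite EE mulr1.
  by field; lra.
have -> : 8 * (l * (l * (pi ^- 2 * expR (- (pi * (2^-1 * t)))))) =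
    8 * (l ^+ 2 / pi ^+ 2) * expR (- (pi / 2 * t)) by rewrite !mulrA.
apply: ler_wpM2l; last by rewrite ler_pM2l.
apply: mulr_ge0; last exact: ltW.
by apply: mulr_ge0 => //; apply: divr_ge0; exact: sqr_ge0.
Qed.

End StripPoisson.

(** * Boundary values and the Poisson formula for exponentials *)

Section StripLimit.
Context {R : realType}.
Notation mu := (@lebesgue_measure R).
Implicit Types (l x t q : R).

(** Meant for closed forms that are continuous at the endpoint but agree with Poisson integrals only
    inside the interval; the estimates there then determine their value at the endpoint. *)
Lemma squeeze_at0 (h k : R -> R) : {for 0, continuous h} -> {for 0, continuous k} ->
  k 0 = 0 -> (forall x, 0 < x < 2^-1 -> `|h x| <= k x) -> h 0 = 0.
Proof.
move=> ch ck k0 hk; apply/eqP; rewrite -normr_le0; suff: `|h 0| <= k 0 by rewrite k0.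
have cnh : `|h x| @[x --> 0^'+] --> `|h 0|.
  by apply: cvg_norm; apply: cvg_at_right_filter.
have ckr : k x @[x --> 0^'+] --> k 0 by apply: cvg_at_right_filter.
apply: ler_cvg_to cnh ckr _; near=> x; apply: hk; apply/andP; split; near: x.
  exact: nbhs_right_gt.
by apply: nbhs_right_lt; lra.
Unshelve. all: by end_near. Qed.

Lemma squeeze_at1 (h k : R -> R) : continuous h -> continuous k ->
  k 1 = 0 -> (forall x, 2^-1 <= x -> x < 1 -> `|h x| <= k x) -> h 1 = 0.
Proof.
move=> ch ck k1 hk; have c1 : continuous (fun x : R => 1 - x).
  by apply: der_continuous => x; eexists; der.
have := @squeeze_at0 (fun x => h (1 - x)) (fun x => k (1 - x)); rewrite subr0; apply.
- by apply: continuous_comp; [exact: c1|exact: ch].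
- by apply: continuous_comp; [exact: c1|exact: ck].
- by [].
- by move=> x /andP[x0 x1]; apply: hk; lra.
Qed.

Lemma poisson_cos0 x : 0 < x < 1 -> poisson_cos 0 x = (1 - x) / 2.
Proof.
have [y y01|c hc] := @constant_on01 R (fun x => strip_integral 0 x + x / 2).
  have dS := der_strip_integral 0 y01.
  by derive_by; rewrite mul0r oppr0 expR0; field.
have E y : 0 < y < 1 -> poisson_cos 0 y = c - y / 2.
  move=> y01; rewrite poisson_cos_strip // mul0r !oppr0 expR0 -(hc y) //; by field.
have : c - 1 / 2 = 0.
  apply: (@squeeze_at1 (fun y => c - y / 2) (fun y => sin (pi * y) / pi)).
  - by apply: der_continuous => z; eexists; der.
  - by apply: der_continuous => z; eexists; der.
  - by rewrite mulr1 sinpi mul0r.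
  - by move=> z z0 z1; rewrite -E ?poisson_cos_right //; apply/andP; split; lra.
by move=> h x01; rewrite E //; lra.
Qed.

(** For l != 0 the particular solutions exp (- l x) / (2 l) for l and - l cancel, and
    [poisson_cos l] is a combination of exp (l x) and exp (- l x). The edge values 1/2 at 0 and 0 at
    1 make it sinh (l (1 - x)) / (2 sinh l). *)
Lemma poisson_formula l x : 0 < x < 1 ->
  expR (l * x) = 2 * poisson_cos l x + expR l * (2 * poisson_cos l (1 - x)).
Proof.
move=> x01; have y01 : 0 < 1 - x < 1 by move: x01 => /andP[? ?]; apply/andP; split; lra.
have [->|l0] := eqVneq l 0.
  by rewrite mul0r expR0 !poisson_cos0 //; field.
have [c1 h1] := strip_integralE l0.
have [c2 h2] : exists c, forall x, 0 < x < 1 ->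
    strip_integral (- l) x = expR (- (- l * x)) / (2 * - l) + c.
  by apply: strip_integralE; rewrite oppr_eq0.
have E y : 0 < y < 1 -> poisson_cos l y = (c1 * expR (l * y) + c2 * expR (- (l * y))) / 2.
  move=> y0; rewrite poisson_cos_strip // h1 // h2 // mulNr opprK; field.
  by rewrite l0.
have cE : continuous (fun y => (c1 * expR (l * y) + c2 * expR (- (l * y))) / 2).
  by apply: der_continuous => z; eexists; der.
have L1 : (c1 * expR (l * 1) + c2 * expR (- (l * 1))) / 2 = 0.
  apply: (@squeeze_at1 (fun y => (c1 * expR (l * y) + c2 * expR (- (l * y))) / 2)
    (fun y => sin (pi * y) / pi)) => //.
  - by apply: der_continuous => z; eexists; der.
  - by rewrite mulr1 sinpi mul0r.
  - by move=> z z0 z1; rewrite -E ?poisson_cos_right //; apply/andP; split; lra.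
have L0 : (c1 * expR (l * 0) + c2 * expR (- (l * 0))) / 2 - (1 - 0) / 2 = 0.
  apply: (@squeeze_at0 (fun y => (c1 * expR (l * y) + c2 * expR (- (l * y))) / 2 - (1 - y) / 2)
    (fun y => sin (pi * y) * (8 * l ^+ 2 / pi ^+ 2) / (pi / 2))) => //.
  - apply: (der_continuous (f := fun y =>
      (c1 * expR (l * y) + c2 * expR (- (l * y))) / 2 - (1 - y) / 2)) => y.
    by eexists; der.
  - apply: (der_continuous (f := fun y => sin (pi * y) * (8 * l ^+ 2 / pi ^+ 2) / (pi / 2))) => y.
    by eexists; der.
  - by rewrite mulr0 sin0 !mul0r.
  - move=> y /andP[y0 y1]; have y01' : 0 < y < 1 by apply/andP; split; lra.
    by rewrite -E // -poisson_cos0 //; exact: poisson_cos_left.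
rewrite !E // mulrBr mulr1 opprB expRB [expR (l * x - l)]expRB.
move: L1 L0; rewrite mulr1 mulr0 oppr0 expR0 expRN; have := expRMN (l * x).
have := expR_gt0 l; set a := expR (l * x); set b := expR (- _); set L := expR l.
move=> L0 ab hL h1'; have Ln := lt0r_neq0 L0.
have a0 : a != 0 by rewrite gt_eqF ?expR_gt0.
have eb : b = a^-1 by rewrite /b expRN.
have e2 : c2 = - c1 * L ^+ 2.
  have hL' : c1 * L + c2 / L = 0 by lra.
  have : (c1 * L + c2 / L) * L = 0 by rewrite hL' mul0r.
  by rewrite mulrDl divfK // => h; apply/eqP; rewrite -subr_eq0 -h; apply/eqP; ring.
have e1 : c1 + c2 = 1 by lra.
rewrite eb; transitivity ((c1 + c2) * a); first by rewrite e1 mul1r.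
rewrite e2; field.
by rewrite Ln.
Qed.

Lemma has_der_ge0 (f : R -> R) d : has_der 0 f d -> f 0 = 0 ->
  (forall x, 0 < x < 1 -> 0 <= f x) -> 0 <= d.
Proof.
move=> [df <-] f0 fge0.
have h1 : (fun h => h^-1 *: (f (h *: (1:R) + 0) - f 0)) @ 0^' --> 'D_1 f 0.
  have -> : (fun h => h^-1 *: (f (h *: (1:R) + 0) - f 0)) =
            (fun h => h^-1 *: ((f \o shift 0) (h *: (1 : R)) - f 0)) by [].
  exact: df.
have h2 : (fun h => h^-1 *: (f (h *: (1:R) + 0) - f 0)) @ 0^'+ --> 'D_1 f 0.
  exact: cvg_dnbhs_at_right.
have h3 : (fun=> 0 : R) @ (0 : R)^'+ --> (0 : R) by exact: cvg_cst.
apply: ler_cvg_to h3 h2 _; near=> x.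
have x01 : 0 < x < 1.
  apply/andP; split; near: x; first exact: nbhs_right_gt.
  by apply: nbhs_right_lt; lra.
rewrite addr0 f0 subr0 /GRing.scale /= mulr1 mulr_ge0 ?fge0 //.
by rewrite invr_ge0; case/andP: x01 => /ltW.
Unshelve. all: by end_near. Qed.

End StripLimit.

(** * The derivative estimate at the boundary of the strip *)

Section BoundaryInequality.
Context {R : realType}.
Notation mu := (@lebesgue_measure R).
Implicit Types (l x t q : R).

Lemma der_sum (I : Type) (s : seq I) (h : I -> R -> R) x (d : I -> R) :
  (forall i, has_der x (h i) (d i)) ->
  has_der x (fun y => \sum_(i <- s) h i y) (\sum_(i <- s) d i).
Proof.
move=> hd; elim: s => [|i s ih].
  by rewrite big_nil; under eq_fun do rewrite big_nil; exact: der_cst.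
by rewrite big_cons; under eq_fun do rewrite big_cons; apply: der_add.
Qed.

Lemma Rintegral_sum (D : set R) (I : Type) (s : seq I) (h : I -> R -> R) :
  measurable D -> (forall i, mu.-integrable D (EFin \o h i)) ->
  mu.-integrable D (EFin \o (fun t => \sum_(i <- s) h i t)) /\
  \int[mu]_(t in D) (\sum_(i <- s) h i t) = \sum_(i <- s) \int[mu]_(t in D) h i t.
Proof.
move=> mD hi; elim: s => [|i s [ih1 ih2]].
  rewrite big_nil; under eq_Rintegral do rewrite big_nil.
  split; last by rewrite Rintegral_cst // mul0r.
  rewrite (_ : _ \o _ = cst 0%E); first exact: integrable0.
  by apply/funext => t /=; rewrite big_nil.
rewrite big_cons; under eq_Rintegral do rewrite big_cons.
rewrite RintegralD // ih2; split => //.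
pose g t := \sum_(i <- s) h i t.
rewrite (_ : _ \o _ = ((EFin \o h i) \+ (EFin \o g))%E).
  exact: integrableD.
by apply/funext => t /=; rewrite big_cons EFinD.
Qed.

Lemma beta0_gt0 t : 0 < beta0 t.
Proof.
rewrite /beta0 mulr_gt0 ?divr_gt0 ?pi_gt0 // invr_gt0.
by have := cosh_ge1 (pi * t); lra.
Qed.

Lemma beta0_le t : beta0 t <= pi * expR (- (pi * t)) :> R.
Proof.
have p0 := pi_gt0 R; rewrite /beta0 -[pi / 2 * _]mulrA ler_pM2l // -invfM expRN.
have E0 := expR_gt0 (pi * t); have E1 := expR_gt0 (- (pi * t)).
have := cosh_ge1 (pi * t) => c1.
by rewrite lef_pV2 ?posrE // /cosh; lra.
Qed.

Lemma continuous_beta0 : continuous (@beta0 R).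
Proof.
apply: der_continuous => t; rewrite /beta0 /cosh; eexists; der.
by have := cosh_ge1 (pi * t); rewrite /cosh => h; apply: lt0r_neq0; lra.
Qed.

Lemma beta0N t : beta0 (- t) = beta0 t :> R.
Proof. by rewrite /beta0 /cosh mulrN opprK [expR (- _) + _]addrC. Qed.

Lemma integrable_beta0_bounded (v : R -> R) M : continuous v ->
  (forall t, 0 <= t -> `|v t| <= M) ->
  mu.-integrable `[0%R, +oo[ (EFin \o (fun t => beta0 t * v t)).
Proof.
move=> cv vM; apply: (@dominated_integrable R _ (pi * M) pi (pi_gt0 R)).
  by move=> t; apply: cvgM; [exact: continuous_beta0|exact: cv].
move=> t t0; rewrite normrM (gtr0_norm (beta0_gt0 t)) [leRHS]mulrAC.
by apply: ler_pM; [exact: ltW (beta0_gt0 t)|exact: normr_ge0|exact: beta0_le|exact: vM].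
Qed.

(* The relative error of [x beta0 t] as an approximation of the Poisson kernel at
   distance [x] from the boundary, up to a factor. *)
Definition poisson_err x : R :=
  x * (2 / (1 + cos (pi * x)) - 1) + (x - sin (pi * x) / pi).

(** The kernel equals u r beta0 with u = sin (pi x) / pi <= x and r = (C + 1) / (C + c), where C =
    cosh (pi t) and c = cos (pi x). Since 1 <= r <= 2 / (1 + c), u r - x lies between - (x - u) and
    x (2 / (1 + c) - 1). *)
Lemma poisson_approx x t : 0 < x < 1 ->
  `|poisson (1 - x) t - x * beta0 t| <= poisson_err x * beta0 t.
Proof.
move=> x01; have p0 := pi_gt0 R; have s0 := sin_pi_gt0 x01.
have := cos_pi_lt1 x01; rewrite ltr_norml => /andP[c1 c2].
have sx : sin (pi * (1 - x)) = sin (pi * x).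
  by rewrite mulrBr mulr1 sinB sinpi cospi; ring.
have cx : cos (pi * (1 - x)) = - cos (pi * x).
  by rewrite mulrBr mulr1 cosB sinpi cospi; ring.
rewrite /poisson /strip_den sx cx opprK /poisson_err /beta0.
have sle : sin (pi * x) / pi <= x.
  rewrite ler_pdivrMr // mulrC; apply: le_trans (ler_norm _) _; apply: sin_norm_le.
  by case/andP: x01 => x0 _; rewrite mulr_ge0 // ltW.
have := cosh_ge1 (pi * t); move: sle c1 c2 s0; set c := cos _; set s := sin _; set C := cosh _.
set u := s / pi => sle c1 c2 s0 C1; have us : s = pi * u by rewrite /u; field; lra.
have u0 : 0 < u by rewrite divr_gt0.
set B := pi / 2 * (C + 1)^-1; have B0 : 0 < B by rewrite mulr_gt0 ?divr_gt0 // invr_gt0; lra.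
have -> : s / (2 * (C + c)) = u * ((C + 1) / (C + c)) * B.
  by rewrite us /B; field; apply/andP; split; lra.
set r := (C + 1) / (C + c).
have r1 : 1 <= r by rewrite /r ler_pdivlMr; lra.
have r2 : r <= 2 / (1 + c).
  by rewrite /r ler_pdivrMr ?ler_pdivlMr; [rewrite mulrAC ler_pdivlMr; nra|lra..].
have x0 : 0 < x by case/andP: x01.
set w := 2 / (1 + c) in r2 *.
by rewrite -mulrBl normrM (gtr0_norm B0) ler_pM2r // ler_norml; apply/andP; split; nra.
Qed.

Lemma integrable_poisson_bounded (v : R -> R) M x : 0 < x < 1 -> continuous v ->
  (forall t, 0 <= t -> `|v t| <= M) ->
  mu.-integrable `[0%R, +oo[ (EFin \o (fun t => poisson x t * v t)).
Proof.
move=> x01 cv vM.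
apply: (@dominated_integrable R _ (2 / (1 - `|cos (pi * x)|) * M) pi (pi_gt0 R)).
  by move=> t; apply: cvgM; [exact: continuous_poisson|exact: cv].
move=> t t0; rewrite normrM [leRHS]mulrAC; apply: ler_pM => //; last exact: vM.
exact: (poisson_norm_le x01 t0 (lexx _) (cos_pi_lt1 x01)).
Qed.

Lemma poisson_Rintegral_le (v : R -> R) M x : 0 < x < 1 -> continuous v ->
  (forall t, 0 <= t -> `|v t| <= M) ->
  \int[mu]_(t in `[0%R, +oo[) (poisson (1 - x) t * v t) <=
  x * \int[mu]_(t in `[0%R, +oo[) (beta0 t * v t) + poisson_err x * M.
Proof.
move=> x01 cv vM; have y01 : 0 < 1 - x < 1 by case/andP: x01 => *; apply/andP; split; lra.
have i1 := integrable_poisson_bounded y01 cv vM.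
have i2 := integrable_beta0_bounded cv vM.
have i3 : mu.-integrable `[0%R, +oo[ (EFin \o (fun t => x * (beta0 t * v t))).
  exact: (@integrableZl _ _ _ mu _ (measurable_itv _) x _ i2).
rewrite -lerBlDl -RintegralZl; [|exact: measurable_itv|exact: i2].
rewrite -RintegralB; [|exact: measurable_itv|exact: i1|exact: i3].
have M0 : 0 <= M by apply: le_trans (vM 0 (lexx _)).
apply: le_trans (ler_norm _) _.
have e0 : 0 <= poisson_err x.
  have := le_trans (normr_ge0 _) (poisson_approx 0 x01).
  by rewrite pmulr_lge0 // beta0_gt0.
(* The dominating function pi exp (- pi t) of [beta0] has integral 1 on the half line. *)
have -> : poisson_err x * M = (poisson_err x * M * pi) / pi by rewrite mulfK // lt0r_neq0 // pi_gt0.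
apply: dominated_Rintegral_le; first exact: pi_gt0.
  move=> t; apply: cvgB; first by apply: cvgM; [exact: continuous_poisson|exact: cv].
  apply: cvgMl_tmp.
  exact: (cvgM (@continuous_beta0 t) (cv t)).
move=> t t0; rewrite mulrA -mulrBl normrM.
have := ler_pM (normr_ge0 _) (normr_ge0 _) (poisson_approx t x01) (vM t t0).
move=> /le_trans; apply; rewrite mulrAC -[leRHS]mulrA.
by apply: ler_wpM2l; [exact: mulr_ge0|exact: beta0_le].
Qed.

(* The three lines estimate for [g z = sum_i a_i exp (l_i z)]: the symmetrization of [Re g]
   in [t] is at most [1] on the line [Re z = 0], with [g 0 = 1]; the conclusion bounds
   [Re g' 0] by the mean of [Re g] on the line [Re z = 1]. *)
Lemma boundary_inequality (I : finType) (a l : I -> R) :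
  (forall t, 0 <= t -> \sum_i a i * cos (l i * t) <= 1) -> \sum_i a i = 1 ->
  \sum_i a i * l i <=
  2 * \int[mu]_(t in `[0%R, +oo[) (beta0 t * \sum_i a i * expR (l i) * cos (l i * t)) - 1.
Proof.
move=> u1 a1; pose u t := \sum_i a i * cos (l i * t).
pose v t := \sum_i a i * expR (l i) * cos (l i * t).
pose M := \sum_i `|a i * expR (l i)|; pose M' := \sum_i `|a i|.
have cv : continuous v.
  by apply: der_continuous => t; eexists; apply: der_sum => i; der.
have cu : continuous u.
  by apply: der_continuous => t; eexists; apply: der_sum => i; der.
have cos1 (y : R) : `|cos y| <= 1 by rewrite ler_norml cos_geN1 cos_le1.
have vM t : 0 <= t -> `|v t| <= M.
  move=> _; apply: (le_trans (ler_norm_sum _ _ _)); apply: ler_sum => i _.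
  by rewrite normrM ler_piMr.
have uM t : 0 <= t -> `|u t| <= M'.
  move=> _; apply: (le_trans (ler_norm_sum _ _ _)); apply: ler_sum => i _.
  by rewrite normrM ler_piMr.
have intc k x : 0 < x < 1 ->
    mu.-integrable `[0%R, +oo[ (EFin \o (fun t => poisson x t * cos (k * t))).
  move=> x01; apply: (@integrable_poisson_bounded _ 1) => //.
  by apply: der_continuous => s; eexists; der.
have sumE (c : I -> R) x : 0 < x < 1 ->
    \int[mu]_(t in `[0%R, +oo[) (poisson x t * \sum_i c i * cos (l i * t)) =
    \sum_i c i * poisson_cos (l i) x.
  move=> x01; under eq_Rintegral do rewrite mulr_sumr.
  have [||_ ->] := @Rintegral_sum `[0%R, +oo[ I (index_enum I)
      (fun i t => poisson x t * (c i * cos (l i * t))).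
  - exact: measurable_itv.
  - move=> i; pose g t := poisson x t * cos (l i * t).
    rewrite (_ : _ \o _ = (fun t => (c i)%:E * (EFin \o g) t)%E).
      by apply: integrableZl; [exact: measurable_itv|exact: intc].
    by apply/funext => t /=; rewrite -EFinM mulrCA.
  - apply: eq_bigr => i _; rewrite /poisson_cos -RintegralZl //; last exact: intc.
    by apply: eq_Rintegral => t _; rewrite mulrCA.
set J := \int[mu]_(t in _) _.
(* On the left edge the values are at most 1, whose Poisson integral is 1 - x; on the right edge the
   kernel is replaced by x [beta0] at the cost of [poisson_err]. *)
have main x : 0 < x < 1 ->
    \sum_i a i * expR (l i * x) <= (1 - x) + 2 * (x * J + poisson_err x * M).
  move=> x01; have y01 : 0 < 1 - x < 1 by case/andP: x01 => *; apply/andP; split; lra.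
  have -> : \sum_i a i * expR (l i * x) =
      2 * \int[mu]_(t in `[0%R, +oo[) (poisson x t * u t) +
      2 * \int[mu]_(t in `[0%R, +oo[) (poisson (1 - x) t * v t).
    rewrite !sumE // !mulr_sumr -big_split /=; apply: eq_bigr => i _.
    by rewrite poisson_formula //; ring.
  apply: lerD; last by rewrite ler_pM2l //; exact: poisson_Rintegral_le.
  have -> : 1 - x = 2 * poisson_cos 0 x by rewrite poisson_cos0 //; field.
  rewrite ler_pM2l // /poisson_cos; apply: le_Rintegral.
  - exact: measurable_itv.
  - exact: (integrable_poisson_bounded x01 cu uM).
  - exact: intc.
  - move=> t /=; rewrite in_itv /= andbT => t0; rewrite mul0r cos0.
    by apply: ler_wpM2l; [exact: poisson_ge0|exact: u1].
(* [phi] is nonnegative on (0, 1) and vanishes at 0, and [poisson_err] has derivative 0 there, so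
   the sign of the derivative of [phi] at 0 is the claim. *)
pose phi x := (1 - x) + 2 * (x * J + poisson_err x * M) - \sum_i a i * expR (l i * x).
suff : 0 <= 2 * J - 1 - \sum_i a i * l i by rewrite subr_ge0.
apply: (@has_der_ge0 R phi).
- have dsum : has_der 0 (fun x => \sum_i a i * expR (l i * x)) (\sum_i a i * l i).
    apply: der_sum => i; apply: (@der_eq R _ _ _ (a i * l i)); first by der.
    by rewrite /= mulr0 expR0; ring.
  rewrite /phi /poisson_err; derive_by.
    by rewrite mulr0 cos0; apply: lt0r_neq0; lra.
  rewrite /= !mulr0 cos0 sin0; move: (lt0r_neq0 (pi_gt0 R)); move: (@pi R) => p p0.
  by field.
- rewrite /phi /poisson_err mulr0 sin0; under eq_bigr do rewrite mulr0 expR0 mulr1.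
  by rewrite a1; ring.
- by move=> x x01; rewrite subr_ge0; exact: main.
Qed.

End BoundaryInequality.

(** * Integrals over the real line *)

Section RealLine.
Context {R : realType}.
Notation mu := (@lebesgue_measure R).
Implicit Types (t : R) (f : R -> R).

Lemma integrable_scale (D : set R) f M : measurable D ->
  mu.-integrable D (EFin \o f) -> mu.-integrable D (EFin \o (fun t => M * f t)).
Proof.
move=> mD fi; rewrite (_ : _ \o _ = (fun t => M%:E * (EFin \o f) t)%E) //.
exact: integrableZl.
Qed.

Lemma integrable_sum2 (D : set R) f g : measurable D ->
  mu.-integrable D (EFin \o f) -> mu.-integrable D (EFin \o g) ->
  mu.-integrable D (EFin \o (fun t => f t + g t)).
Proof.
move=> mD fi gi; rewrite (_ : _ \o _ = ((EFin \o f) \+ (EFin \o g))%E) //.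
exact: integrableD.
Qed.

Lemma Rintegral_beta0_half : \int[mu]_(t in `[0%R, +oo[) beta0 t = 2^-1.
Proof.
have p0 := pi_gt0 R.
(* With e = exp (pi t), [beta0] is pi e / (e + 1) ^ 2. *)
pose F t : R := - (expR (pi * t) + 1)^-1.
have E1 t : expR (pi * t) + 1 != 0 by apply: lt0r_neq0; have := expR_gt0 (pi * t); lra.
have dF t : has_der t F (beta0 t).
  rewrite /F; derive_by; first exact: E1.
  rewrite /beta0 /cosh expRN; have := E1 t; have := lt0r_neq0 (expR_gt0 (pi * t)).
  set e := expR _ => e0 e1; move: (pi) => p; field.
  rewrite e0 e1 /= andbT; apply: contra_neq e1 => h.
  have : (e + 1) ^+ 2 = 0 by rewrite -h; ring.
  by move/eqP; rewrite sqrf_eq0 => /eqP.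
have F0 : F t @[t --> +oo] --> (0 : R).
  apply: norm_cvg0; apply: (@squeeze_cvgr _ _ _ _ (cst 0) (fun t => expR (- (pi * t)))).
  - apply: filterS (nbhs_pinfty_ge (num_real 0)) => t t0.
    have e0 := expR_gt0 (pi * t).
    rewrite normr_ge0 /= normrN gtr0_norm ?invr_gt0 ?expRN; last by lra.
    by rewrite lef_pV2 ?posrE //; lra.
  - exact: cvg_cst.
  - exact: cvg_expRN.
have bd t : 0 <= t -> `|beta0 t| <= pi * expR (- (pi * t)).
  by move=> _; rewrite (gtr0_norm (beta0_gt0 t)) beta0_le.
rewrite (dominated_FTC2y p0 (@continuous_beta0 R) bd dF F0) /F mulr0 expR0.
by field.
Qed.

Lemma integrable_beta0_half : mu.-integrable `[0%R, +oo[ (EFin \o @beta0 R).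
Proof.
apply: (@dominated_integrable R _ pi pi (pi_gt0 R) (@continuous_beta0 R)) => t _.
by rewrite (gtr0_norm (beta0_gt0 t)) beta0_le.
Qed.

Lemma ge0_integral_fold f : (forall t, 0 <= f t) -> continuous f ->
  (\int[mu]_t (f t)%:E = \int[mu]_(t in `[0%R, +oo[) (f t)%:E +
    \int[mu]_(t in `[0%R, +oo[) (f (- t))%:E)%E.
Proof.
move=> f0 cf; have mf := continuous_measurable_EFin (measurableT : measurable [set: R]) cf.
have mposnums : measurable [set x : R | 0 <= x] by rewrite -set_itvcy.
rewrite -(setUv [set x : R | 0 <= x]) ge0_integral_setU //= ; last 4 first.
- exact: measurableC.
- by rewrite setUv.
- by move=> x _; rewrite lee_fin.
- exact/disj_setPCl.
congr (_ + _)%E; first by rewrite set_itvcy.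
rewrite -set_itvcy// setCitvr.
rewrite integral_itv_bndo_bndc; last exact/measurable_funTS.
rewrite -{1}oppr0 ge0_integration_by_substitutionNy//.
exact: continuous_subspaceT.
Qed.

Lemma integral_beta0 : (\int[mu]_(t in [set: R]) (beta0 t)%:E = 1)%E.
Proof.
rewrite ge0_integral_fold; last 2 first.
- by move=> t; exact: ltW (beta0_gt0 t).
- exact: continuous_beta0.
under [X in (_ + X)%E]eq_integral do rewrite beta0N.
have fin : (\int[mu]_(t in `[0%R, +oo[) (beta0 t)%:E)%E \is a fin_num.
  by apply: integrable_fin_num integrable_beta0_half; exact: measurable_itv.
rewrite -[X in (X + X)%E]fineK // -/(Rintegral _ _ _) Rintegral_beta0_half -EFinD.
by congr EFin; field.
Qed.

Lemma integrable_beta0 : mu.-integrable setT (EFin \o @beta0 R).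
Proof.
apply/integrableP; split.
  by apply: continuous_measurable_EFin; [exact: measurableT|exact: continuous_beta0].
under eq_integral => t _ do rewrite /= gtr0_norm ?beta0_gt0 //.
by rewrite integral_beta0 ltry.
Qed.

Lemma integrable_beta0_dom f (M : R) : measurable_fun setT f ->
  (forall t, `|f t| <= M) -> mu.-integrable setT (EFin \o (fun t => beta0 t * f t)).
Proof.
move=> mf fM; apply: (@le_integrable _ _ _ mu _ measurableT _
  (fun t => (M%:E * (EFin \o @beta0 R) t)%E)).
- apply/measurable_EFinP; apply: measurable_funM => //.
  by apply: continuous_measurable_fun; exact: continuous_beta0.
- move=> t _ /=; rewrite lee_fin !normrM mulrC; apply: ler_wpM2r => //.
  exact: le_trans (fM t) (ler_norm _).
- by apply: integrableZl; [exact: measurableT|exact: integrable_beta0].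
Qed.

Lemma Rintegral_beta0 : \int[mu]_t beta0 t = 1.
Proof. by rewrite /Rintegral integral_beta0. Qed.

(** Adding the bound [M] to f makes the integrand nonnegative, so that [ge0_integral_fold] applies;
    [M] then contributes M on the line and M / 2 on each half, which cancel. *)
Lemma Rintegral_beta0_fold f (M : R) : continuous f -> (forall t, `|f t| <= M) ->
  \int[mu]_t (beta0 t * f t) =
  \int[mu]_(t in `[0%R, +oo[) (beta0 t * (f t + f (- t))).
Proof.
move=> cf fM; pose g t := beta0 t * (f t + M).
have cg : continuous g.
  move=> t; apply: cvgM; first exact: continuous_beta0.
  by apply: cvgD; [exact: cf|exact: cvg_cst].
have g0 t : 0 <= g t.
  apply: mulr_ge0; first exact/ltW/beta0_gt0.
  by have := fM t; rewrite ler_norml => /andP[+ _]; rewrite -subr_ge0 opprK.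
have M0 : 0 <= M by apply: le_trans (fM 0).
have cfN : continuous (fun t => f (- t)).
  by move=> t; apply: continuous_comp; [exact: opp_continuous|exact: cf].
have mfT := continuous_measurable_fun cf.
have i1 := integrable_beta0_dom mfT fM.
have i2 := @integrable_beta0_bounded R _ M cf (fun t _ => fM t).
have i3 := @integrable_beta0_bounded R _ M cfN (fun t _ => fM (- t)).
have ib : mu.-integrable setT (EFin \o (fun t => M * beta0 t)).
  by apply: integrable_scale; [exact: measurableT|exact: integrable_beta0].
have ibh : mu.-integrable `[0%R, +oo[ (EFin \o (fun t => M * beta0 t)).
  by apply: integrable_scale; [exact: measurable_itv|exact: integrable_beta0_half].
have gE t : g t = beta0 t * f t + M * beta0 t by rewrite /g mulrDr [_ * M]mulrC.
have gNE t : g (- t) = beta0 t * f (- t) + M * beta0 t.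
  by rewrite gE beta0N.
have I0 : \int[mu]_t g t = \int[mu]_t (beta0 t * f t) + M.
  under eq_Rintegral do rewrite gE.
  rewrite RintegralD; [|exact: measurableT|exact: i1|exact: ib].
  by rewrite RintegralZl; [rewrite Rintegral_beta0 mulr1|exact: measurableT
    |exact: integrable_beta0].
have Ih : M / 2 = \int[mu]_(t in `[0%R, +oo[) (M * beta0 t).
  rewrite RintegralZl;
    [by rewrite Rintegral_beta0_half|exact: measurable_itv|exact: integrable_beta0_half].
have I1 : \int[mu]_(t in `[0%R, +oo[) g t =
    \int[mu]_(t in `[0%R, +oo[) (beta0 t * f t) + M / 2.
  by under eq_Rintegral do rewrite gE; rewrite Ih -RintegralD;
    [|exact: measurable_itv|exact: i2|exact: ibh].
have I2 : \int[mu]_(t in `[0%R, +oo[) g (- t) =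
    \int[mu]_(t in `[0%R, +oo[) (beta0 t * f (- t)) + M / 2.
  by under eq_Rintegral do rewrite gNE; rewrite Ih -RintegralD;
    [|exact: measurable_itv|exact: i3|exact: ibh].
have ig1 : mu.-integrable `[0%R, +oo[ (EFin \o g).
  rewrite (_ : g = fun t => beta0 t * f t + M * beta0 t); last exact/funext.
  by apply: integrable_sum2 => //; exact: measurable_itv.
have ig2 : mu.-integrable `[0%R, +oo[ (EFin \o (fun t => g (- t))).
  rewrite (_ : (fun t => g (- t)) = fun t => beta0 t * f (- t) + M * beta0 t); last exact/funext.
  by apply: integrable_sum2 => //; exact: measurable_itv.
have : \int[mu]_t g t = \int[mu]_(t in `[0%R, +oo[) g t + \int[mu]_(t in `[0%R, +oo[) g (- t).
  rewrite {1}/Rintegral ge0_integral_fold // fineD //.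
    by apply: integrable_fin_num ig1; exact: measurable_itv.
  by apply: integrable_fin_num ig2; exact: measurable_itv.
move=> H; under [RHS]eq_Rintegral do rewrite mulrDr.
rewrite RintegralD; [|exact: measurable_itv|exact: i2|exact: i3].
by move: H; rewrite I0 I1 I2; lra.
Qed.

End RealLine.

(** * Functional calculus *)

Section Adjoint.
Context {C : numClosedFieldType}.

Lemma adjM m n p (A : 'M[C]_(m, n)) (B : 'M[C]_(n, p)) :
  (A *m B) ^t* = B ^t* *m A ^t*.
Proof. by rewrite trmx_mul map_mxM. Qed.

Lemma adjD m n (A B : 'M[C]_(m, n)) : (A + B) ^t* = A ^t* + B ^t*.
Proof. by apply/matrixP => i j; rewrite !mxE rmorphD. Qed.

Lemma adjB m n (A B : 'M[C]_(m, n)) : (A - B) ^t* = A ^t* - B ^t*.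
Proof. by apply/matrixP => i j; rewrite !mxE rmorphB. Qed.

Lemma adjZ m n (c : C) (A : 'M[C]_(m, n)) : (c *: A) ^t* = c^* *: A ^t*.
Proof. by apply/matrixP => i j; rewrite !mxE rmorphM. Qed.

Lemma adj1 n : (1%:M : 'M[C]_n) ^t* = 1%:M.
Proof. by rewrite trmx1 map_mx1. Qed.

Lemma adj_delta m n (i : 'I_m) (j : 'I_n) : (delta_mx i j : 'M[C]_(m, n)) ^t* = delta_mx j i.
Proof. by rewrite trmx_delta map_delta_mx. Qed.

Lemma mxtrace_adj n (A : 'M[C]_n) : \tr (A ^t*) = (\tr A)^*.
Proof. by rewrite /mxtrace rmorph_sum; apply: eq_bigr => i _; rewrite !mxE. Qed.

Lemma addmxE m n (A B : 'M[C]_(m, n)) i j : (A + B) i j = A i j + B i j.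
Proof. by rewrite mxE. Qed.

Lemma submxE m n (A B : 'M[C]_(m, n)) i j : (A - B) i j = A i j - B i j.
Proof. by rewrite !mxE. Qed.

Lemma scalemxE m n (c : C) (A : 'M[C]_(m, n)) i j : (c *: A) i j = c * A i j.
Proof. by rewrite mxE. Qed.

Lemma adjE m n (A : 'M[C]_(m, n)) i j : (A ^t*) i j = (A j i)^*.
Proof. by rewrite !mxE. Qed.

Lemma delta_quad m n (Y : 'M[C]_(m, n)) i j :
  ((delta_mx 0 i : 'rV_m) *m Y *m (delta_mx j 0 : 'cV_n)) 0 0 = Y i j.
Proof. by rewrite -rowE -colE !mxE. Qed.

(** Polarization: the vectors e_i + c e_j with c = 1 and c = i separate the entries (i, j) and (j,
    i). *)
Lemma quad_eq0 n (Y : 'M[C]_n) :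
  (forall v : 'cV[C]_n, (v ^t* *m Y *m v) 0 0 = 0) -> Y = 0.
Proof.
move=> h; have pol i j (c : C) : Y i i + c * Y i j + c^* * (Y j i + c * Y j j) = 0.
  have := h (delta_mx i 0 + c *: delta_mx j 0); rewrite adjD adjZ !adj_delta.
  rewrite !mulmxDl !mulmxDr -!scalemxAl -!scalemxAr.
  by rewrite !addmxE !scalemxE !delta_quad !mulrDr !addrA => <-; ring.
have d0 i : Y i i = 0 by have := h (delta_mx i 0); rewrite adj_delta delta_quad.
apply/matrixP => i j; rewrite mxE.
have := pol i j 1; have := pol i j 'i; rewrite !d0 conjCi rmorph1 !mul1r !mulr0 !add0r !addr0.
rewrite mulNr -mulrBr => /eqP; rewrite mulf_eq0 (negbTE (neq0Ci _)) /= subr_eq0 => /eqP ->.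
by move/eqP; rewrite -mulr2n mulrn_eq0 => /eqP.
Qed.

Lemma ge0_conj (z : C) : 0 <= z -> z^* = z.
Proof. by move/ger0_real/CrealP. Qed.

(** Over an arbitrary closed numeric field, so that the algebra never meets the structure of R[i];
    over R[i] it is convertible with [psd]. *)
Definition psdm n (X : 'M[C]_n) : Prop :=
  forall v : 'cV[C]_n, 0 <= (v ^t* *m X *m v) 0 0.

Lemma psdm_adj n (X : 'M[C]_n) : psdm X -> X ^t* = X.
Proof.
move=> hX; apply/eqP; rewrite eq_sym -subr_eq0; apply/eqP/quad_eq0 => v.
rewrite mulmxBr mulmxBl submxE.
have -> : v ^t* *m X ^t* *m v = (v ^t* *m X *m v) ^t*.
  by rewrite !adjM trmxCK mulmxA.
by rewrite adjE (ge0_conj (hX v)) subrr.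
Qed.

Lemma psdmD n (X Y : 'M[C]_n) : psdm X -> psdm Y -> psdm (X + Y).
Proof. by move=> hX hY v; rewrite mulmxDr mulmxDl mxE addr_ge0. Qed.

Lemma psdmZ n (c : C) (X : 'M[C]_n) : 0 <= c -> psdm X -> psdm (c *: X).
Proof. by move=> c0 hX v; rewrite -scalemxAr -scalemxAl mxE mulr_ge0. Qed.

Lemma psdm0 n : psdm (0 : 'M[C]_n).
Proof. by move=> v; rewrite mulmx0 mul0mx mxE. Qed.

Lemma psdm_conj m n (a : 'M[C]_(m, n)) (X : 'M[C]_m) : psdm X -> psdm (a ^t* *m X *m a).
Proof. by move=> hX v; have := hX (a *m v); rewrite adjM !mulmxA. Qed.

Lemma psdm_gram m n (a : 'M[C]_(m, n)) : psdm (a ^t* *m a).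
Proof.
have := @psdm_conj m n a 1%:M; rewrite mulmx1; apply => v.
rewrite mulmx1 mxE sumr_ge0 // => i _; rewrite !mxE mulrC; exact: mul_conjC_ge0.
Qed.

Lemma psdm_sum (I : Type) (s : seq I) n (X : I -> 'M[C]_n) :
  (forall i, psdm (X i)) -> psdm (\sum_(i <- s) X i).
Proof.
move=> hX; elim: s => [|i s ih]; first by rewrite big_nil; exact: psdm0.
by rewrite big_cons; apply: psdmD.
Qed.

Lemma psdm_tr_ge0 n (X : 'M[C]_n) : psdm X -> 0 <= \tr X.
Proof.
move=> hX; apply: sumr_ge0 => i _.
by have := hX (delta_mx i 0); rewrite adj_delta delta_quad.
Qed.

End Adjoint.

Section FunctionalCalculus.
Context {C : numClosedFieldType}.
Implicit Types (f g : C -> C).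

(** Written with the adjoint of the diagonalizing unitary, where [mxfun] has its inverse, so that
    adjoints compute directly; locked to keep unification from unfolding it. *)
Definition spfun n f (X : 'M[C]_n) : 'M[C]_n :=
  locked ((spectralmx X) ^t* *m diag_mx (map_mx f (spectral_diag X)) *m spectralmx X).

Lemma spfunE n f (X : 'M[C]_n) : spfun f X =
  (spectralmx X) ^t* *m diag_mx (map_mx f (spectral_diag X)) *m spectralmx X.
Proof. by rewrite /spfun -lock. Qed.

Definition eigproj n (X : 'M[C]_n) (i : 'I_n) : 'M[C]_n :=
  (spectralmx X) ^t* *m delta_mx i i *m spectralmx X.

Lemma spectralmxK n (X : 'M[C]_n) : spectralmx X *m (spectralmx X) ^t* = 1%:M.
Proof. exact/unitarymxP/spectral_unitarymx. Qed.

Lemma spectralmxVK n (X : 'M[C]_n) : (spectralmx X) ^t* *m spectralmx X = 1%:M.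
Proof. by rewrite -invmx_unitary ?spectral_unitarymx // mulVmx // spectral_unit. Qed.

Lemma spfun_sum n f (X : 'M[C]_n) :
  spfun f X = \sum_i f (spectral_diag X 0 i) *: eigproj X i.
Proof.
rewrite spfunE diag_mx_sum_delta mulmx_sumr mulmx_suml; apply: eq_bigr => i _.
by rewrite mxE -scalemxAr -scalemxAl.
Qed.

Lemma eq_spfun n f g (X : 'M[C]_n) :
  (forall i, f (spectral_diag X 0 i) = g (spectral_diag X 0 i)) -> spfun f X = spfun g X.
Proof. by move=> fg; rewrite !spfun_sum; apply: eq_bigr => i _; rewrite fg. Qed.

Lemma spfunM n f g (X : 'M[C]_n) :
  spfun f X *m spfun g X = spfun (fun x => f x * g x) X.
Proof.
rewrite !spfunE !mulmxA.
rewrite -[_ *m spectralmx X *m (spectralmx X) ^t*]mulmxA spectralmxK mulmx1.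
rewrite -[_ *m diag_mx _ *m diag_mx _]mulmxA mulmx_diag.
by congr (_ *m diag_mx _ *m _); apply/rowP => i; rewrite !mxE.
Qed.

Lemma spfunD n f g (X : 'M[C]_n) :
  spfun f X + spfun g X = spfun (fun x => f x + g x) X.
Proof. by rewrite !spfun_sum -big_split; apply: eq_bigr => i _; rewrite scalerDl. Qed.

Lemma spfunZ n c f (X : 'M[C]_n) : c *: spfun f X = spfun (fun x => c * f x) X.
Proof. by rewrite !spfun_sum scaler_sumr; apply: eq_bigr => i _; rewrite scalerA. Qed.

Lemma spfunB n f g (X : 'M[C]_n) :
  spfun f X - spfun g X = spfun (fun x => f x - g x) X.
Proof.
by rewrite !spfun_sum -sumrB; apply: eq_bigr => i _; rewrite scalerBl.
Qed.

Lemma spfun1 n (X : 'M[C]_n) : spfun (fun=> 1) X = 1%:M.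
Proof.
rewrite spfunE; have -> : diag_mx (map_mx (fun=> 1) (spectral_diag X)) = 1%:M :> 'M[C]_n.
  by apply/matrixP => i j; rewrite !mxE.
by rewrite mulmx1 spectralmxVK.
Qed.

Lemma spfun_adj n f (X : 'M[C]_n) : (spfun f X) ^t* = spfun (fun x => (f x)^*) X.
Proof.
rewrite !spfunE !adjM trmxCK mulmxA; congr (_ *m _ *m _).
by rewrite tr_diag_mx map_diag_mx; congr diag_mx; apply/rowP => i; rewrite !mxE.
Qed.

Lemma psdm_spfun n f (X : 'M[C]_n) :
  (forall i, 0 <= f (spectral_diag X 0 i)) -> psdm (spfun f X).
Proof.
move=> f0; rewrite spfun_sum; apply: psdm_sum => i; apply: psdmZ => //.
have -> : eigproj X i = (delta_mx i i *m spectralmx X) ^t* *m (delta_mx i i *m spectralmx X).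
  by rewrite adjM adj_delta mulmxA -[_ *m delta_mx i i *m delta_mx i i]mulmxA mul_delta_mx.
exact: psdm_gram.
Qed.

Lemma spfun_id n (X : 'M[C]_n) : X ^t* = X -> spfun id X = X.
Proof.
move=> hX; have /orthomx_spectralP E : X \is normalmx by apply/normalmxP; rewrite hX.
rewrite invmx_unitary ?spectral_unitarymx // in E.
by rewrite [RHS]E spfunE; congr (_ *m diag_mx _ *m _); apply/rowP => i; rewrite !mxE.
Qed.

Lemma spfun_mul_id n f (X : 'M[C]_n) : X ^t* = X ->
  X *m spfun f X = spfun (fun x => x * f x) X.
Proof. by move=> hX; rewrite -{1}(spfun_id hX) spfunM. Qed.

Lemma eigv_ge0 n (X : 'M[C]_n) i : psdm X -> 0 <= spectral_diag X 0 i.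
Proof.
move=> hX; have hXa := psdm_adj hX.
have := hX ((spectralmx X) ^t* *m delta_mx i 0).
rewrite adjM trmxCK adj_delta -[X in _ *m X *m _](spfun_id hXa) spfunE !mulmxA.
rewrite -[_ *m spectralmx X *m (spectralmx X) ^t*]mulmxA spectralmxK mulmx1.
rewrite -[_ *m spectralmx X *m (spectralmx X) ^t*]mulmxA spectralmxK mulmx1.
by rewrite delta_quad !mxE eqxx mulr1n.
Qed.

(** A function of X is a polynomial in X. [S] is a predicate and not a subspace, so that it may also
    say that every block of a block matrix lies in an algebra. *)
Lemma spfun_closed n (S : 'M[C]_n -> Prop) f (X : 'M[C]_n) :
  X ^t* = X -> S X -> S 1%:M -> (forall Y Z, S Y -> S Z -> S (Y + Z)) ->
  (forall c Y, S Y -> S (c *: Y)) -> (forall Y Z, S Y -> S Z -> S (Y *m Z)) ->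
  S (spfun f X).
Proof.
move=> hX SX S1 SD SZ SM.
(* Lagrange interpolation on the spectrum. *)
suff [h Sh hf] : exists2 h, S (spfun h X) &
    {in [seq spectral_diag X 0 i | i <- enum 'I_n], f =1 h}.
  by rewrite (@eq_spfun _ f h) // => i; apply: hf; rewrite map_f ?mem_enum.
elim: [seq _ | i <- _] => [|x s [h Sh hs]].
  exists (fun=> 0) => //; rewrite (@eq_spfun _ _ (fun=> 0 * 1)); last by move=> i; rewrite mul0r.
  by rewrite -spfunZ spfun1; exact: SZ.
have [xs|xs] := boolP (x \in s).
  by exists h => // y; rewrite inE => /orP[/eqP->|]; exact: hs.
pose p (y : C) : C := \prod_(z <- s) (y - z).
have Sp : S (spfun p X).
  rewrite /p; elim: s {hs xs p} => [|z s ih].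
    by rewrite (@eq_spfun _ _ (fun=> 1)) ?spfun1 // => i; rewrite big_nil.
  rewrite (@eq_spfun _ _ (fun y => (y - z * 1) * \prod_(z <- s) (y - z))); last first.
    by move=> i; rewrite big_cons mulr1.
  rewrite -spfunM; apply: SM => //; rewrite -spfunB -spfunZ spfun1 spfun_id //.
  by rewrite -scaleN1r; apply: SD => //; apply: (SZ); apply: (SZ).
have px : p x != 0.
  rewrite prodf_seq_neq0; apply/allP => z zs /=; rewrite subr_eq0.
  by apply: contraNneq xs => ->.
exists (fun y => h y + (f x - h x) / p x * p y).
  by rewrite -spfunD -spfunZ; apply: SD => //; exact: SZ.
move=> y; rewrite inE => /orP[/eqP->|ys]; first by rewrite divfK // addrC subrK.
have -> : p y = 0 by rewrite /p (big_rem y) //= subrr mul0r.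
by rewrite (hs _ ys) mulr0 addr0.
Qed.

End FunctionalCalculus.

(** * Complex powers, supports and the fidelity bound *)

Section Powers.
Context {C : numClosedFieldType}.

(* [pw z x] stands for [x ^ z], taken to be [0] at [x = 0]. *)
Record is_power (pw : C -> C -> C) : Prop := IsPower {
  powD : forall z w x, pw z x * pw w x = pw (z + w) x;
  pow_conj : forall z x, (pw z x)^* = pw z^* x;
  pow_ge0 : forall z x, z \is Num.real -> 0 <= pw z x;
  pow1 : forall x, 0 <= x -> pw 1 x = x }.

Variable pw : C -> C -> C.
Hypothesis hpw : is_power pw.
Implicit Types (z w : C).

Definition mpow n (X : 'M[C]_n) z : 'M[C]_n := spfun (pw z) X.
(** The support projection, because powers vanish on the kernel; its absorption rules are then
    instances of [mpowD]. *)
Definition suppmx n (X : 'M[C]_n) : 'M[C]_n := mpow X 0.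

Lemma mpowD n (X : 'M[C]_n) z w : mpow X z *m mpow X w = mpow X (z + w).
Proof. by rewrite /mpow spfunM; apply: eq_spfun => i; rewrite (powD hpw). Qed.

Lemma mpow_adj n (X : 'M[C]_n) z : (mpow X z) ^t* = mpow X z^*.
Proof. by rewrite /mpow spfun_adj; apply: eq_spfun => i; rewrite (pow_conj hpw). Qed.

Lemma mpow_adjr n (X : 'M[C]_n) z : z \is Num.real -> (mpow X z) ^t* = mpow X z.
Proof. by move=> zr; rewrite mpow_adj (CrealP zr). Qed.

Lemma psdm_mpow n (X : 'M[C]_n) z : z \is Num.real -> psdm (mpow X z).
Proof. by move=> zr; apply: psdm_spfun => i; exact: (pow_ge0 hpw). Qed.

Lemma mpow1 n (X : 'M[C]_n) : psdm X -> mpow X 1 = X.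
Proof.
move=> hX; rewrite -[RHS]spfun_id ?psdm_adj //; apply: eq_spfun => i.
by rewrite (pow1 hpw) // eigv_ge0.
Qed.

Lemma suppmx_mpow n (X : 'M[C]_n) z : suppmx X *m mpow X z = mpow X z.
Proof. by rewrite mpowD add0r. Qed.

Lemma mpow_suppmx n (X : 'M[C]_n) z : mpow X z *m suppmx X = mpow X z.
Proof. by rewrite mpowD addr0. Qed.

Lemma mul_suppmx n (X : 'M[C]_n) : psdm X -> suppmx X *m X = X.
Proof. by move=> hX; rewrite -[X in _ *m X](mpow1 hX) suppmx_mpow mpow1. Qed.

Lemma mulmx_supp n (X : 'M[C]_n) : psdm X -> X *m suppmx X = X.
Proof. by move=> hX; rewrite -[X in X *m _](mpow1 hX) mpow_suppmx mpow1. Qed.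

Lemma suppmx_adj n (X : 'M[C]_n) : (suppmx X) ^t* = suppmx X.
Proof. by rewrite mpow_adjr ?rpred0. Qed.

Lemma suppmx_idem n (X : 'M[C]_n) : suppmx X *m suppmx X = suppmx X.
Proof. exact: suppmx_mpow. Qed.

Lemma psdm_csuppmx n (X : 'M[C]_n) : psdm (1%:M - suppmx X).
Proof.
have -> : 1%:M - suppmx X = (1%:M - suppmx X) ^t* *m (1%:M - suppmx X).
  rewrite adjB adj1 suppmx_adj mulmxBr !mulmxBl suppmx_idem !mulmx1 !mul1mx subrr subr0 //.
exact: psdm_gram.
Qed.

(** An imaginary power is a partial isometry: its Gram matrix is X ^ 0, a projection. *)
Lemma mpow_contraction n (X : 'M[C]_n) z : z^* = - z ->
  psdm (1%:M - (mpow X z) ^t* *m mpow X z).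
Proof. by move=> hz; rewrite mpow_adj hz mpowD addNr; exact: psdm_csuppmx. Qed.

Lemma half_real : (2^-1 : C) \is Num.real.
Proof. by rewrite rpredV rpred_nat. Qed.

Lemma mpow_half_mul n (X : 'M[C]_n) : psdm X -> mpow X 2^-1 *m mpow X 2^-1 = X.
Proof. by move=> hX; rewrite mpowD -[RHS]mpow1 //; congr (mpow _ _); field. Qed.

Lemma mpow_half_adj n (X : 'M[C]_n) : (mpow X 2^-1) ^t* = mpow X 2^-1.
Proof. exact: mpow_adjr half_real. Qed.


Lemma gram_eq0 m n (a : 'M[C]_(m, n)) : \tr (a ^t* *m a) = 0 -> a = 0.
Proof.
move=> h; have s0 (j : 'I_n) : true -> 0 <= (a ^t* *m a) j j.
  by move=> _; have := psdm_gram a (delta_mx j 0); rewrite adj_delta delta_quad.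
have d0 (j : 'I_n) : (a ^t* *m a) j j = 0 by apply: (psumr_eq0P s0 h).
apply/matrixP => i j; rewrite mxE; have := d0 j; rewrite mxE => hj.
have t0 (k : 'I_m) : true -> 0 <= (a ^t*) j k * a k j.
  by move=> _; rewrite adjE mulrC mul_conjC_ge0.
have : (a ^t*) j i * a i j = 0 by apply: (psumr_eq0P t0 hj).
rewrite adjE => /eqP.
by rewrite mulf_eq0 conjC_eq0 orbb => /eqP.
Qed.

(** tr (X Y) is the squared Hilbert-Schmidt norm of X^(1/2) Y^(1/2). *)
Lemma psdm_tr_mul_eq0 n (X Y : 'M[C]_n) : psdm X -> psdm Y -> \tr (X *m Y) = 0 -> X *m Y = 0.
Proof.
move=> hX hY h.
have h0 : mpow X 2^-1 *m mpow Y 2^-1 = 0.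
  apply: gram_eq0; rewrite adjM !mpow_half_adj -[RHS]h.
  rewrite -[X in RHS](mpow_half_mul hX) -[Y in RHS](mpow_half_mul hY).
  by rewrite mulmxA mxtrace_mulC [RHS]mxtrace_mulC !mulmxA.
rewrite -(mpow_half_mul hX) -(mpow_half_mul hY).
by rewrite mulmxA -[X in X *m _]mulmxA h0 mulmx0 mul0mx.
Qed.

Lemma gram_le_kernel m n p (Z : 'M[C]_(m, n)) (T : 'M[C]_n) (Q : 'M[C]_(n, p)) :
  psdm (T - Z ^t* *m Z) -> T *m Q = 0 -> Z *m Q = 0.
Proof.
move=> h TQ; apply: gram_eq0; apply/eqP; rewrite eq_le psdm_tr_ge0 ?andbT; last exact: psdm_gram.
have := psdm_tr_ge0 (psdm_conj Q h).
rewrite mulmxBr mulmxBl -[Q ^t* *m T *m Q]mulmxA TQ mulmx0 sub0r raddfN /= oppr_ge0.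
by rewrite adjM !mulmxA.
Qed.

(** Cauchy-Schwarz in additive form, from the positivity of the squared norm of A - B. *)
Lemma tr_mul_adj_le m n (A B : 'M[C]_(m, n)) :
  \tr (A *m B ^t*) + (\tr (A *m B ^t*))^* <= \tr (A *m A ^t*) + \tr (B *m B ^t*).
Proof.
have := psdm_tr_ge0 (psdm_gram ((A - B) ^t*)).
rewrite trmxCK adjB mulmxBl !mulmxBr !raddfB /= opprK.
have -> : \tr (B *m A ^t*) = (\tr (A *m B ^t*))^*.
  by rewrite -mxtrace_adj adjM trmxCK.
set a := \tr _; set b := \tr _; set c := \tr (B *m _).
by rewrite (_ : a - b + (- b^* + c) = a + c - (b + b^*)) ?subr_ge0 //; ring.
Qed.

(* If [1, Z; Z', T] is positive semidefinite, [Z'] being the adjoint of [Z], then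
   [Z = W T^(1/2)] with [W] a contraction, and [Re tr (W X') <= tr |X|] for
   [X = S^(1/2) T^(1/2)]. *)
Lemma block_fidelity_le n (S T Z : 'M[C]_n) (X := mpow S 2^-1 *m mpow T 2^-1) :
  psdm S -> psdm T ->
  (forall v w : 'cV[C]_n, 0 <= (v ^t* *m v) 0 0 + (v ^t* *m Z *m w) 0 0 +
     ((v ^t* *m Z *m w) 0 0)^* + (w ^t* *m T *m w) 0 0) ->
  \tr (mpow S 2^-1 *m Z) + (\tr (mpow S 2^-1 *m Z))^* <=
  2 * \tr (mpow (X ^t* *m X) 2^-1).
Proof.
move=> hS hT hZ.
have hTZ : psdm (T - Z ^t* *m Z).
  (* The form is minimal in v at v = - Z w, where it is the Schur complement. *)
  move=> w; have := hZ (- (Z *m w)) w.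
  have -> : (- (Z *m w)) ^t* = - (w ^t* *m Z ^t*).
    by rewrite -scaleN1r adjZ adjM rmorphN1 scaleN1r.
  rewrite !mulNmx mulmxN opprK mulmxBr mulmxBl submxE !mulmxA.
  set a := w ^t* *m Z ^t* *m Z *m w.
  have -> : (- a) 0 0 = - a 0 0 by rewrite mxE.
  have -> : (- a 0 0)^* = - a 0 0.
    rewrite rmorphN; congr (- _); apply: ge0_conj.
    by have := psdm_gram Z w; rewrite /a !mulmxA.
  by rewrite subrr add0r addrC.
pose W := Z *m mpow T (- 2^-1).
have Nr : - 2^-1 \is @Num.real C by rewrite rpredN half_real.
have WT : W *m mpow T 2^-1 = Z.
  rewrite /W -mulmxA mpowD addNr -/(suppmx T).
  have := @gram_le_kernel n n n Z T (1%:M - suppmx T) hTZ.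
  rewrite !mulmxBr !mulmx1 mulmx_supp // subrr => /(_ erefl) /eqP.
  by rewrite subr_eq0 => /eqP.
have hW : psdm (1%:M - W ^t* *m W).
  have -> : 1%:M - W ^t* *m W = (1%:M - suppmx T) +
      (mpow T (- 2^-1)) ^t* *m (T - Z ^t* *m Z) *m mpow T (- 2^-1).
    rewrite mulmxBr mulmxBl adjM !mulmxA addrA; congr (_ - _).
    have -> : (mpow T (- 2^-1)) ^t* *m T *m mpow T (- 2^-1) = suppmx T.
      rewrite mpow_adjr // -{2}(mpow1 hT) !mpowD.
      by rewrite (_ : - 2^-1 + 1 - 2^-1 = 0 :> C) //; field.
    by rewrite subrK.
  by apply: psdmD; [exact: psdm_csuppmx|exact: psdm_conj].
pose Y := X ^t* *m X; rewrite -/Y.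
have hY : psdm Y := psdm_gram X.
have qr : 4^-1 \is @Num.real C by rewrite rpredV rpred_nat.
have qNr : - 4^-1 \is @Num.real C by rewrite rpredN.
(* Quarter powers of Y balance the additive Cauchy-Schwarz inequality: the squared norms of W p and
   X q are both at most tr Y^(1/2), for W p because W is a contraction. *)
pose p := mpow Y 4^-1; pose q := mpow Y (- 4^-1).
have XS : X *m suppmx Y = X.
  have := @gram_le_kernel n n n X Y (1%:M - suppmx Y).
  rewrite {1}/Y subrr mulmxBr mulmx1 mulmx_supp // subrr => /(_ (@psdm0 _ _) erefl).
  by rewrite mulmxBr mulmx1 => /eqP; rewrite subr_eq0 => /eqP.
have -> : \tr (mpow S 2^-1 *m Z) = \tr ((W *m p) *m (X *m q) ^t*).
  rewrite adjM mpow_adjr // !mulmxA -[W *m p *m q]mulmxA mpowD subrr -/(suppmx Y).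
  rewrite -mulmxA -{1}(suppmx_adj Y) -adjM XS /X adjM !mpow_half_adj mulmxA WT.
  by rewrite mxtrace_mulC.
apply: (le_trans (tr_mul_adj_le _ _)); rewrite mulr_natl mulr2n; apply: lerD.
  rewrite mxtrace_mulC adjM mpow_adjr //.
  have := psdm_tr_ge0 (psdm_conj p hW).
  rewrite mulmxBr mulmxBl mulmx1 raddfB /= subr_ge0 !mulmxA.
  rewrite mpow_adjr // mpowD => /le_trans; apply.
  by rewrite (_ : 4^-1 + 4^-1 = 2^-1 :> C) //; field.
rewrite mxtrace_mulC adjM mpow_adjr //.
rewrite -mulmxA [X ^t* *m _]mulmxA -/Y -{2}(mpow1 hY) !mpowD.
by rewrite (_ : - 4^-1 + (1 - 4^-1) = 2^-1 :> C) //; field.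
Qed.

End Powers.

(** * Completely positive maps *)

Section BlockMatrices.
Context {C : numClosedFieldType}.

(** Positivity of a block matrix stated on the family of its blocks, free of the index arithmetic of
    [mxblock]; [psdm_mxblock] is the bridge. *)
Definition bpsd k n (X : 'I_k -> 'I_k -> 'M[C]_n) : Prop :=
  forall v : 'I_k -> 'cV[C]_n, 0 <= \sum_i \sum_j ((v i) ^t* *m X i j *m v j) 0 0.

Lemma mxcol_quad k n (X : 'I_k -> 'I_k -> 'M[C]_n) (v : 'I_k -> 'cV[C]_n) :
  ((\mxcol_i v i) ^t* *m (\mxblock_(i < k, j < k) X i j) *m (\mxcol_i v i)) 0 0 =
  \sum_i \sum_j ((v i) ^t* *m X i j *m v j) 0 0.
Proof.
have -> : (\mxcol_i v i) ^t* = \mxrow_i (v i) ^t*.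
  by apply/matrixP => i j; rewrite !mxE.
rewrite mul_mxrow_mxblock mul_mxrow_mxcol summxE exchange_big /=.
by apply: eq_bigr => j _; rewrite mulmx_suml summxE.
Qed.

Lemma psdm_mxblock k n (X : 'I_k -> 'I_k -> 'M[C]_n) :
  psdm (\mxblock_(i < k, j < k) X i j) <-> bpsd X.
Proof.
split=> [h v|h v]; first by rewrite -mxcol_quad; exact: h.
by rewrite -(submxcolK v) mxcol_quad; exact: h.
Qed.

Lemma bpsd_adj k n (X : 'I_k -> 'I_k -> 'M[C]_n) i j : bpsd X -> (X i j) ^t* = X j i.
Proof.
move=> /psdm_mxblock/psdm_adj h.
have E : (\mxblock_(i < k, j < k) X i j) ^t* = \mxblock_(i < k, j < k) (X j i) ^t*.
  by apply/matrixP => a b; rewrite !mxE.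
by rewrite E in h; have /eq_mxblockP/(_ j i) := h.
Qed.

Lemma bpsd_gram k n m (z : 'I_k -> 'M[C]_(m, n)) : bpsd (fun i j => (z i) ^t* *m z j).
Proof.
move=> v; have := psdm_gram (\sum_j z j *m v j) 1%:M.
rewrite adj1 mul1mx mulmx1; congr (0 <= _).
have -> : (\sum_j z j *m v j) ^t* = \sum_i (v i) ^t* *m (z i) ^t*.
  rewrite raddf_sum (raddf_sum (map_mx Num.conj)) /=.
  by apply: eq_bigr => i _; rewrite -adjM.
rewrite mulmx_suml summxE; apply: eq_bigr => i _; rewrite mulmx_sumr summxE.
by apply: eq_bigr => j _; rewrite !mulmxA.
Qed.

Lemma psdm_sqrt n (X : 'M[C]_n) : psdm X -> exists Q : 'M[C]_n, X = Q ^t* *m Q.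
Proof.
move=> hX; exists (spfun sqrtC X); rewrite spfun_adj spfunM -[LHS]spfun_id ?psdm_adj //.
apply: eq_spfun => i; have e0 := eigv_ge0 i hX.
by rewrite (ge0_conj (_ : 0 <= sqrtC _)) ?sqrtC_ge0 // -expr2 sqrtCK.
Qed.

Lemma psdm_tr_mul_ge0 n (X Y : 'M[C]_n) : psdm X -> psdm Y -> 0 <= \tr (X *m Y).
Proof.
move=> hX /psdm_sqrt[Q ->]; rewrite mulmxA mxtrace_mulC !mulmxA.
rewrite -{1}(trmxCK Q); apply: psdm_tr_ge0; exact: psdm_conj.
Qed.

Lemma eigv_real n (X : 'M[C]_n) i : X ^t* = X -> spectral_diag X 0 i \is Num.real.
Proof.
move=> hX; pose u := (spectralmx X) ^t* *m (delta_mx i 0 : 'cV_n).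
have E : spectral_diag X 0 i = (u ^t* *m X *m u) 0 0.
  rewrite adjM trmxCK adj_delta -[X in _ *m X *m _](spfun_id hX) spfunE !mulmxA.
  rewrite -[_ *m spectralmx X *m (spectralmx X) ^t*]mulmxA spectralmxK mulmx1.
  rewrite -[_ *m spectralmx X *m (spectralmx X) ^t*]mulmxA spectralmxK mulmx1.
  by rewrite delta_quad !mxE eqxx mulr1n.
by apply/CrealP; rewrite E; move: u {E} => u; rewrite -adjE !adjM trmxCK hX mulmxA.
Qed.

(** With f the negative part, X f(X) = - f(X) ^ 2 makes tr (X f(X)) minus a squared norm. The
    witness is a function of X so that [spfun_closed] can be applied to it. *)
Lemma psdm_neg_part n (X : 'M[C]_n) : X ^t* = X ->
  exists2 f, psdm (spfun f X) & X *m spfun f X = - (spfun f X *m spfun f X) /\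
    psdm (X + spfun f X).
Proof.
move=> hX; exists (fun x => if x < 0 then - x else 0).
  by apply: psdm_spfun => i; case: ifP => // x0; rewrite oppr_ge0 ltW.
split.
  rewrite spfun_mul_id // spfunM -[RHS]scaleN1r spfunZ; apply: eq_spfun => i.
  by case: ifP => _; ring.
rewrite -[X in X + _](spfun_id hX) spfunD; apply: psdm_spfun => i.
have := eigv_real i hX; case: ifP => [_ _|/negbT x0 xr]; first by rewrite subrr.
by rewrite addr0 real_leNgt ?real0.
Qed.

(* The values of [T] lie in [A] while [N] is completely positive on [A] only; this suffices,
   since the negative part of a block matrix over [A] has its blocks in [A]. *)
Lemma dual_completely_positive n m (A : {vspace 'M[C]_n})
    (N : 'M[C]_n -> 'M[C]_m) (T : 'M[C]_m -> 'M[C]_n) :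
  1%:M \in A -> (forall x y, x \in A -> y \in A -> x *m y \in A) ->
  (forall x, x \in A -> x ^t* \in A) -> (forall x, T x \in A) ->
  (forall a x, a \in A -> \tr (N a *m x) = \tr (a *m T x)) ->
  (forall k (X : 'I_k -> 'I_k -> 'M[C]_n), (forall i j, X i j \in A) -> bpsd X ->
     bpsd (fun i j => N (X i j))) ->
  forall k (X : 'I_k -> 'I_k -> 'M[C]_m), bpsd X -> bpsd (fun i j => T (X i j)).
Proof.
move=> A1 AM Aadj TA dual Ncp k X hX.
(* The off-diagonal blocks of the image of the Gram matrix of 1 and a are adjoint to each other. *)
have Nadj a : a \in A -> (N a) ^t* = N (a ^t*).
  move=> aA; pose z (i : 'I_2) : 'M[C]_n := if i == 0 then 1%:M else a.
  have zA i : z i \in A by rewrite /z; case: ifP.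
  have h := Ncp _ _ (fun i j => AM _ _ (Aadj _ (zA i)) (zA j)) (bpsd_gram z).
  have := bpsd_adj 0 1 h; rewrite /z /= adj1 mul1mx mulmx1; exact.
have tr_eq0 (x : 'M[C]_n) : x \in A -> (forall a, a \in A -> \tr (a *m x) = 0) -> x = 0.
  by move=> xA h; apply: gram_eq0; apply: h; exact: Aadj.
have Tadj x : (T x) ^t* = T (x ^t*).
  apply/eqP; rewrite -subr_eq0; apply/eqP/tr_eq0; first by rewrite memvB // Aadj.
  move=> a aA; rewrite mulmxBr raddfB /= -dual //; apply/eqP; rewrite subr_eq0; apply/eqP.
  rewrite -[a in LHS](trmxCK a) -adjM mxtrace_adj mxtrace_mulC -dual ?Aadj //.
  by rewrite -mxtrace_adj adjM Nadj ?Aadj // trmxCK mxtrace_mulC.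
pose Z := \mxblock_(i < k, j < k) T (X i j).
have hZ : Z ^t* = Z.
  have -> : Z ^t* = \mxblock_(i < k, j < k) (T (X j i)) ^t*.
    by apply/matrixP => a b; rewrite !mxE.
  by apply: eq_mxblock => i j; rewrite Tadj (bpsd_adj _ _ hX).
have [f fpsd [Zf Zf2]] := psdm_neg_part hZ.
set Y := spfun f Z in fpsd Zf Zf2.
have YA i j : submxblock Y i j \in A.
  move: i j; apply: (@spfun_closed _ _ (fun W => forall i j, submxblock W i j \in A)) => //.
  - by move=> i j; rewrite /Z mxblockK.
  - move=> i j; rewrite -mxdiagZ /mxdiag mxblockK.
    by case: ifP => _; rewrite ?conform_mx_id ?mem0v.
  - move=> W V hW hV i j.
    have -> : submxblock (W + V) i j = submxblock W i j + submxblock V i j.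
      by apply/matrixP => a b; rewrite !mxE.
    exact: memvD.
  - move=> c W hW i j.
    have -> : submxblock (c *: W) i j = c *: submxblock W i j.
      by apply/matrixP => a b; rewrite !mxE.
    exact: memvZ.
  - move=> W V hW hV i j; rewrite -(submxblockK W) -(submxblockK V) mul_mxblock mxblockK.
    by apply: memv_suml => l _; exact: AM.
have hNY : bpsd (fun i j => N (submxblock Y i j)).
  by apply: Ncp => //; apply/psdm_mxblock; rewrite submxblockK.
have trE : \tr (\mxblock_(i < k, j < k) N (submxblock Y i j) *m \mxblock_(i < k, j < k) X i j)
    = \tr (Y *m Z).
  rewrite -{2}(submxblockK Y) /Z !mul_mxblock !mxtrace_mxblock; apply: eq_bigr => i _.
  by rewrite !raddf_sum /=; apply: eq_bigr => j _; rewrite dual.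
(* By duality tr (Y Z) pairs the positive block matrices N(Y) and X, so it is nonnegative; it is
   also minus the squared norm of Y. *)
have Y0 : Y = 0.
  apply: gram_eq0; rewrite (psdm_adj fpsd); apply/eqP; rewrite eq_le; apply/andP; split.
    rewrite -oppr_ge0 -raddfN /= -Zf mxtrace_mulC -trE; apply: psdm_tr_mul_ge0.
      exact/psdm_mxblock.
    exact/psdm_mxblock.
  by rewrite -{1}(psdm_adj fpsd); apply: psdm_tr_ge0; exact: psdm_gram.
by apply/psdm_mxblock; rewrite -/Z -[Z]addr0 -Y0.
Qed.

End BlockMatrices.

Section GramPolarization.
Context {C : numClosedFieldType}.

Lemma spfun_invmx n (f : C -> C) (X : 'M[C]_n) : spfun f X =
  invmx (spectralmx X) *m diag_mx (map_mx f (spectral_diag X)) *m spectralmx X.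
Proof. by rewrite spfunE invmx_unitary ?spectral_unitarymx. Qed.

(** Evaluating at the Gram matrix of 1 + c a for c = 1 and c = i isolates h(a). *)
Lemma gram_polarization n (A : {vspace 'M[C]_n}) (h : 'M[C]_n -> C) :
  1%:M \in A -> (forall x y, x \in A -> y \in A -> x *m y \in A) ->
  (forall x, x \in A -> x ^t* \in A) ->
  (forall c x y, x \in A -> y \in A -> h (c *: x + y) = c * h x + h y) ->
  (forall c, c \in A -> h (c ^t* *m c) = 0) -> forall a, a \in A -> h a = 0.
Proof.
move=> A1 AM Aadj hlin h0 a aA.
have hD x y : x \in A -> y \in A -> h (x + y) = h x + h y.
  by move=> xA yA; rewrite -[x]scale1r hlin // mul1r scale1r.
have hz : h 0 = 0 by have := hlin (-1) 0 0 (mem0v _) (mem0v _); rewrite scaler0 addr0 mulN1r addNr.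
have hZ c x : x \in A -> h (c *: x) = c * h x.
  by move=> xA; rewrite -[c *: x]addr0 hlin ?mem0v // hz addr0.
have key (c : C) : c * h a + c^* * h (a ^t*) = 0.
  have := h0 (1%:M + c *: a) (memvD A1 (memvZ c aA)).
  have aaA := AM _ _ (Aadj _ aA) aA.
  rewrite adjD adj1 adjZ mulmxDl !mulmxDr mulmx1 !mul1mx mulmx1.
  rewrite -scalemxAl -scalemxAr !hD ?hZ ?memvD ?memvZ ?Aadj //.
  have := h0 1%:M A1; rewrite adj1 mulmx1 => ->; rewrite h0 // !mulr0 add0r addr0 => <-.
  by rewrite addrC.
have := key 1; have := key 'i; rewrite conjCi rmorph1 !mul1r mulNr -mulrBr => /eqP.
rewrite mulf_eq0 (negbTE (neq0Ci _)) /= subr_eq0 => /eqP <-.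
by move/eqP; rewrite -mulr2n mulrn_eq0 => /eqP.
Qed.

End GramPolarization.

(** * Cauchy-Schwarz inequalities for unital completely positive maps *)

Section UnitalCompletelyPositive.
Context {C : numClosedFieldType} (n m : nat) (T : 'M[C]_m -> 'M[C]_n).
Hypothesis Tlin : forall c x y, T (c *: x + y) = c *: T x + T y.
Hypothesis Tcp : forall k (X : 'I_k -> 'I_k -> 'M[C]_m), bpsd X -> bpsd (fun i j => T (X i j)).
Hypothesis T1 : T 1%:M = 1%:M.

Lemma map_lin0 : T 0 = 0.
Proof. by have := Tlin (-1) 0 0; rewrite scaler0 addr0 scaleN1r addNr. Qed.

Lemma map_linD x y : T (x + y) = T x + T y.
Proof. by rewrite -[x]scale1r Tlin !scale1r. Qed.

Lemma map_linZ c x : T (c *: x) = c *: T x.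
Proof. by rewrite -[c *: x]addr0 Tlin map_lin0 addr0. Qed.

Lemma map_linB x y : T (x - y) = T x - T y.
Proof. by rewrite map_linD -scaleN1r map_linZ scaleN1r. Qed.

Lemma map_lin_sum (I : Type) (s : seq I) (F : I -> 'M[C]_m) :
  T (\sum_(i <- s) F i) = \sum_(i <- s) T (F i).
Proof.
by elim: s => [|i s ih]; rewrite ?big_nil ?map_lin0 // !big_cons map_linD ih.
Qed.

Lemma cp_positive X : psdm X -> psdm (T X).
Proof.
move=> hX; have hb : bpsd (fun _ _ : 'I_1 => X) by move=> v; rewrite !big_ord1; exact: hX.
by move=> v; have := Tcp hb (fun=> v); rewrite !big_ord1.
Qed.

Lemma cp_adj x : (T x) ^t* = T (x ^t*).
Proof.
pose z (i : 'I_2) : 'M[C]_m := if i == 0 then 1%:M else x.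
have := bpsd_adj 0 1 (Tcp (bpsd_gram z)).
by rewrite /z /= adj1 mul1mx mulmx1.
Qed.

Lemma cp_quad (x y : 'M[C]_m) (v w : 'cV[C]_n) : 0 <= (v ^t* *m T (x ^t* *m x) *m v) 0 0 +
  (v ^t* *m T (x ^t* *m y) *m w) 0 0 + ((v ^t* *m T (x ^t* *m y) *m w) 0 0)^* +
  (w ^t* *m T (y ^t* *m y) *m w) 0 0.
Proof.
pose z (i : 'I_2) : 'M[C]_m := if i == 0 then x else y.
pose u (i : 'I_2) : 'cV[C]_n := if i == 0 then v else w.
have := Tcp (bpsd_gram z) u; rewrite !big_ord_recl !big_ord0 /z /u /= !addr0.
have -> : ((v ^t* *m T (x ^t* *m y) *m w) 0 0)^* = (w ^t* *m T (y ^t* *m x) *m v) 0 0.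
  by rewrite -adjE !adjM !cp_adj adjM !trmxCK mulmxA.
by rewrite !addrA.
Qed.

(** Positivity and T(1) = 1 allow the corner T(x' x) of [cp_quad], x' being the adjoint of x, to be
    raised to the identity. *)
Lemma cp_contraction_quad (x y : 'M[C]_m) (v w : 'cV[C]_n) : psdm (1%:M - x ^t* *m x) ->
  0 <= (v ^t* *m v) 0 0 + (v ^t* *m T (x ^t* *m y) *m w) 0 0 +
    ((v ^t* *m T (x ^t* *m y) *m w) 0 0)^* + (w ^t* *m T (y ^t* *m y) *m w) 0 0.
Proof.
move=> /cp_positive; rewrite map_linB T1 => hx.
have := addr_ge0 (hx v) (cp_quad x y v w).
rewrite mulmxBr mulmxBl mulmx1 submxE !addrA subrK; exact.
Qed.

Lemma cp_contraction_quad1 (y : 'M[C]_m) (v w : 'cV[C]_n) : psdm (1%:M - y ^t* *m y) ->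
  0 <= (v ^t* *m v) 0 0 + (v ^t* *m T y *m w) 0 0 +
    ((v ^t* *m T y *m w) 0 0)^* + (w ^t* *m w) 0 0.
Proof.
move=> hy; have h1 : psdm (1%:M - (1%:M : 'M[C]_m) ^t* *m 1%:M).
  by rewrite adj1 mulmx1 subrr; exact: psdm0.
have := cp_contraction_quad y v w h1; rewrite adj1 mul1mx => h.
have := cp_positive hy; rewrite map_linB T1 => /(_ w).
rewrite mulmxBr mulmxBl mulmx1 submxE => /(addr_ge0 h).
by rewrite addrACA subrr addr0 -!addrA addrC -!addrA.
Qed.

(** The sum over k of [cp_contraction_quad1] at the vectors a' e_k and b e_k, with a' the adjoint of
    a. *)
Lemma tr_contraction (y : 'M[C]_m) (a : 'M[C]_n) (b : 'M[C]_n) : psdm (1%:M - y ^t* *m y) ->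
  - (\tr (a *m T y *m b) + (\tr (a *m T y *m b))^*) <= \tr (a *m a ^t*) + \tr (b ^t* *m b).
Proof.
move=> hy; rewrite -subr_ge0 opprK.
have : 0 <= \sum_k ((a *m a ^t*) k k + (a *m T y *m b) k k + ((a *m T y *m b) k k)^* +
    (b ^t* *m b) k k).
  apply: sumr_ge0 => k _.
  have := cp_contraction_quad1 (a ^t* *m delta_mx k 0) (b *m delta_mx k 0) hy.
  rewrite !adjM !adj_delta trmxCK !mulmxA.
  rewrite -[_ *m a *m a ^t*]mulmxA -[_ *m b ^t* *m b]mulmxA.
  have -> : (delta_mx 0 k : 'rV[C]_n) *m a *m T y *m b = delta_mx 0 k *m (a *m T y *m b).
    by rewrite -!mulmxA.
  by rewrite !delta_quad.
have -> : \sum_k ((a *m a ^t*) k k + (a *m T y *m b) k k + ((a *m T y *m b) k k)^* +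
    (b ^t* *m b) k k) = \tr (a *m a ^t*) + \tr (a *m T y *m b) +
    (\tr (a *m T y *m b))^* + \tr (b ^t* *m b).
  by rewrite !big_split /= -rmorph_sum.
by congr (0 <= _); ring.
Qed.

End UnitalCompletelyPositive.

(** * The holomorphic function of the recovery problem *)

Section StripBoundary.
Context {C : numClosedFieldType} (pw : C -> C -> C) (hpw : is_power pw).
Context (n m : nat) (T : 'M[C]_m -> 'M[C]_n).
Hypothesis Tlin : forall c x y, T (c *: x + y) = c *: T x + T y.
Hypothesis Tcp : forall k (X : 'I_k -> 'I_k -> 'M[C]_m), bpsd X -> bpsd (fun i j => T (X i j)).
Hypothesis T1 : T 1%:M = 1%:M.
Context (rho sigma : 'M[C]_n) (r s : 'M[C]_m).
Hypotheses (rho_psd : psdm rho) (sigma_psd : psdm sigma) (r_psd : psdm r) (s_psd : psdm s).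
Hypotheses (dual_r : forall x, \tr (r *m x) = \tr (rho *m T x))
  (dual_s : forall x, \tr (s *m x) = \tr (sigma *m T x)).
Hypothesis rho_supp : suppmx pw sigma *m rho = rho.
Hypothesis rho_tr : \tr rho = 1.
Local Notation "X ^^ z" := (mpow pw X z) (at level 30).
Local Notation supp := (suppmx pw).
Implicit Types (u z c : C).

Lemma rho_suppr : rho *m supp sigma = rho.
Proof.
have := congr1 (fun X : 'M[C]_n => X ^t*) rho_supp.
by rewrite adjM (suppmx_adj hpw) (psdm_adj rho_psd).
Qed.

(** The trace of this product of positive matrices is tr (x (1 - supp x)) = 0 by duality. *)
Lemma mulmx_map_csupp_eq0 (X : 'M[C]_n) (x : 'M[C]_m) : psdm X -> psdm x ->
  (forall y, \tr (x *m y) = \tr (X *m T y)) -> X *m T (1%:M - supp x) = 0.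
Proof.
move=> hX hx dual; apply: (psdm_tr_mul_eq0 hpw) => //.
  by apply: (cp_positive Tcp); exact: (psdm_csuppmx hpw).
by rewrite -dual mulmxBr mulmx1 (mulmx_supp hpw) // subrr mxtrace0.
Qed.

Lemma rho_map_supp : rho *m T (supp r) = rho.
Proof.
have /eqP := mulmx_map_csupp_eq0 rho_psd r_psd dual_r.
by rewrite (map_linB Tlin) T1 mulmxBr mulmx1 subr_eq0 => /eqP.
Qed.

(** T(1 - supp s) is annihilated by sigma, hence by rho = rho sigma^(-1) sigma; duality carries this
    back to r. *)
Lemma r_supp : r *m supp s = r.
Proof.
have h : rho *m T (1%:M - supp s) = 0.
  have E : rho = rho *m sigma ^^ (-1) *m sigma.
    by rewrite -[X in _ *m X](mpow1 hpw) // -mulmxA (mpowD hpw) addNr; exact/esym/rho_suppr.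
  by rewrite E -mulmxA (mulmx_map_csupp_eq0 sigma_psd s_psd dual_s) mulmx0.
have : r *m (1%:M - supp s) = 0.
  apply: (psdm_tr_mul_eq0 hpw) => //; first exact: (psdm_csuppmx hpw).
  by rewrite dual_r h mxtrace0.
by rewrite mulmxBr mulmx1 => /eqP; rewrite subr_eq0 => /eqP.
Qed.

Lemma supp_r_s : supp r *m supp s = supp r.
Proof.
have -> : supp r = r ^^ (-1) *m r.
  by rewrite -[X in _ *m X](mpow1 hpw) // (mpowD hpw) addNr.
by rewrite -mulmxA r_supp.
Qed.

Lemma s_supp : supp s *m r = r.
Proof.
have := congr1 (fun X : 'M[C]_m => X ^t*) r_supp.
by rewrite adjM (suppmx_adj hpw) (psdm_adj r_psd).
Qed.

(* The function [f] to which the three lines estimate is applied. *)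
Definition strip_fun z : C :=
  \tr (rho ^^ (1 - z / 2) *m T (r ^^ (z / 2) *m s ^^ (- (z / 2))) *m sigma ^^ (z / 2)).

(** Letting [c] range over the unit disc expresses |f| <= 1 through real parts, and leaves room for
    the phase of the factor exp (- c z) used later. *)
Lemma strip_fun_left c u : u^* = - u -> `|c| <= 1 ->
  c * strip_fun (2 * u) + (c * strip_fun (2 * u))^* <= 2.
Proof.
move=> hu c1; have E : 2 * u / 2 = u by field.
rewrite /strip_fun E; set y := r ^^ u *m s ^^ (- u).
have hNu : (- u)^* = - - u by rewrite rmorphN /= hu.
have hy : psdm (1%:M - y ^t* *m y).
  have -> : 1%:M - y ^t* *m y = (1%:M - (s ^^ (- u)) ^t* *m s ^^ (- u)) +
      (s ^^ (- u)) ^t* *m (1%:M - (r ^^ u) ^t* *m r ^^ u) *m s ^^ (- u).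
    rewrite adjM mulmxBr mulmxBl mulmx1 !mulmxA addrA subrK //.
  apply: psdmD; first exact: (mpow_contraction hpw).
  by apply: psdm_conj; exact: (mpow_contraction hpw).
(* rho is split evenly between the two sides, so that each squared norm is at most 1; the minus sign
   cancels the one in [tr_contraction]. *)
pose a := (- c) *: rho ^^ (2^-1 - u); pose b := sigma ^^ u *m rho ^^ 2^-1.
have := tr_contraction Tlin Tcp T1 a b hy.
have -> : \tr (a *m T y *m b) = - (c * \tr (rho ^^ (1 - u) *m T y *m sigma ^^ u)).
  rewrite /a /b -!scalemxAl mxtraceZ mulNr mulmxA mxtrace_mulC !mulmxA (mpowD hpw).
  by rewrite (_ : 2^-1 + (2^-1 - u) = 1 - u) //; field.
rewrite rmorphN -opprD opprK => /le_trans; apply.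
have -> : \tr (a *m a ^t*) = `|c| ^+ 2.
  rewrite /a adjZ -scalemxAl -scalemxAr scalerA mxtraceZ (mpow_adj hpw) (mpowD hpw).
  rewrite rmorphB /= hu (CrealP half_real) opprK (_ : 2^-1 - u + (2^-1 + u) = 1); last by field.
  by rewrite (mpow1 hpw) // rho_tr mulr1 rmorphN mulrNN normCK.
have -> : \tr (b ^t* *m b) = 1.
  rewrite /b adjM (mpow_half_adj hpw) (mpow_adj hpw) hu mulmxA -[_ *m _ *m sigma ^^ u]mulmxA.
  rewrite (mpowD hpw) addNr mxtrace_mulC mulmxA (mpow_half_mul hpw) //.
  by rewrite rho_suppr.
by rewrite [leRHS](_ : 2 = 1 + 1) // lerD2r exprn_ile1.
Qed.

Definition rotated u : 'M[C]_n := sigma ^^ (2^-1 - u) *m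
  T (s ^^ (- 2^-1 + u) *m r *m s ^^ (- 2^-1 - u)) *m sigma ^^ (2^-1 + u).

(** The off-diagonal block Z: c f(1 + 2 u) is its overlap with rho^(1/2), and with corners 1 and
    [rotated u] it forms a positive block matrix. *)
Definition rotated_factor c u : 'M[C]_n :=
  c *: rho ^^ (- u) *m T (r ^^ (2^-1 + u) *m s ^^ (- 2^-1 - u)) *m sigma ^^ (2^-1 + u).

Lemma strip_fun_right c u :
  c * strip_fun (1 + 2 * u) = \tr (rho ^^ 2^-1 *m rotated_factor c u).
Proof.
rewrite /strip_fun /rotated_factor -!scalemxAl -scalemxAr mxtraceZ !mulmxA (mpowD hpw).
rewrite (_ : 1 - (1 + 2 * u) / 2 = 2^-1 - u); last by field.
rewrite (_ : (1 + 2 * u) / 2 = 2^-1 + u); last by field.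
by rewrite opprD.
Qed.

(** Cauchy-Schwarz for T with x = r^(- u), a contraction, and y = r^(1/2) s^(- 1/2 - u); the outer
    powers of rho and sigma are absorbed into the two vectors. *)
Lemma rotated_block c u (v w : 'cV[C]_n) : u^* = - u -> `|c| <= 1 ->
  0 <= (v ^t* *m v) 0 0 + (v ^t* *m rotated_factor c u *m w) 0 0 +
     ((v ^t* *m rotated_factor c u *m w) 0 0)^* + (w ^t* *m rotated u *m w) 0 0.
Proof.
move=> hu c1; have hNu : (- u)^* = - - u by rewrite rmorphN /= hu.
have hr : 2^-1^* = 2^-1 :> C by apply/CrealP/half_real.
pose x := r ^^ (- u); pose y := r ^^ 2^-1 *m s ^^ (- 2^-1 - u).
pose v' := (c *: rho ^^ (- u)) ^t* *m v; pose w' := sigma ^^ (2^-1 + u) *m w.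
have hx : psdm (1%:M - x ^t* *m x) by exact: (mpow_contraction hpw).
have := cp_contraction_quad Tlin Tcp T1 y v' w' hx.
have -> : x ^t* *m y = r ^^ (2^-1 + u) *m s ^^ (- 2^-1 - u).
  by rewrite /x (mpow_adj hpw) hNu opprK /y mulmxA (mpowD hpw) addrC.
have -> : v' ^t* *m T (r ^^ (2^-1 + u) *m s ^^ (- 2^-1 - u)) *m w' =
    v ^t* *m rotated_factor c u *m w.
  by rewrite /v' /w' /rotated_factor adjM trmxCK !mulmxA.
have -> : w' ^t* *m T (y ^t* *m y) *m w' = w ^t* *m rotated u *m w.
  rewrite /w' adjM (mpow_adj hpw) rmorphD /= hr hu /rotated /y adjM (mpow_half_adj hpw).
  rewrite (mpow_adj hpw) rmorphB rmorphN /= hr hu opprK !mulmxA.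
  by rewrite -[_ *m r ^^ 2^-1 *m r ^^ 2^-1]mulmxA (mpow_half_mul hpw).
move=> h; apply: (le_trans h); rewrite !lerD2r.
have -> : v' ^t* *m v' = (`|c| ^+ 2) *: (v ^t* *m supp rho *m v).
  have -> : v' = c^* *: (rho ^^ u *m v).
    by rewrite /v' adjZ (mpow_adj hpw) hNu opprK scalemxAl.
  rewrite adjZ conjCK adjM (mpow_adj hpw) hu -scalemxAl -scalemxAr scalerA -normCK.
  by rewrite mulmxA -[_ *m rho ^^ (- u) *m rho ^^ u]mulmxA (mpowD hpw) addNr.
rewrite scalemxE.
have h1 : 0 <= (v ^t* *m supp rho *m v) 0 0.
  by apply: (psdm_mpow hpw); exact: real0.
have h2 : (v ^t* *m supp rho *m v) 0 0 <= (v ^t* *m v) 0 0.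
  have := psdm_csuppmx hpw rho v; rewrite mulmxBr mulmxBl mulmx1 submxE subr_ge0; exact.
by apply: le_trans h2; rewrite ler_piMl // exprn_ile1.
Qed.

(** [strip_fun] with arbitrary functions for its four powers, so that f and the logarithmic traces
    in f'(0) expand over the same quadruples of eigenprojections. *)
Definition qtrace (f1 f2 f3 f4 : C -> C) : C :=
  \tr (spfun f1 rho *m T (spfun f2 r *m spfun f3 s) *m spfun f4 sigma).

Definition qindex : finType := ('I_n * ('I_m * ('I_m * 'I_n)))%type.

Definition qcoef (k : qindex) : C := \tr (eigproj rho k.1 *m
  T (eigproj r k.2.1 *m eigproj s k.2.2.1) *m eigproj sigma k.2.2.2).

Lemma qtrace_sum f1 f2 f3 f4 : qtrace f1 f2 f3 f4 = \sum_(k : qindex)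
  f1 (spectral_diag rho 0 k.1) * f2 (spectral_diag r 0 k.2.1) *
  f3 (spectral_diag s 0 k.2.2.1) * f4 (spectral_diag sigma 0 k.2.2.2) * qcoef k.
Proof.
pose F a b e d := f1 (spectral_diag rho 0 a) * f2 (spectral_diag r 0 b) *
  f3 (spectral_diag s 0 e) * f4 (spectral_diag sigma 0 d) * qcoef (a, (b, (e, d))).
transitivity (\sum_a \sum_b \sum_e \sum_d F a b e d); last first.
  rewrite -(pair_bigA _ (fun a (p : 'I_m * ('I_m * 'I_n)) => F a p.1 p.2.1 p.2.2)) /=.
  apply: eq_bigr => a _.
  rewrite -(pair_bigA _ (fun b (p : 'I_m * 'I_n) => F a b p.1 p.2)) /=.
  apply: eq_bigr => b _.
  by rewrite -(pair_bigA _ (fun e d => F a b e d)).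
rewrite /qtrace (spfun_sum f1) !mulmx_suml raddf_sum; apply: eq_bigr => a _ /=.
rewrite (spfun_sum f2) mulmx_suml (map_lin_sum Tlin) mulmx_sumr mulmx_suml raddf_sum.
apply: eq_bigr => b _ /=.
rewrite (spfun_sum f3) mulmx_sumr (map_lin_sum Tlin) mulmx_sumr mulmx_suml raddf_sum.
apply: eq_bigr => e _ /=.
rewrite (spfun_sum f4) mulmx_sumr raddf_sum; apply: eq_bigr => d _ /=.
set k2 := f2 _; set k3 := f3 _.
have -> : T ((k2 *: eigproj r b) *m (k3 *: eigproj s e)) =
    (k2 * k3) *: T (eigproj r b *m eigproj s e).
  by rewrite -scalemxAl -scalemxAr scalerA (map_linZ Tlin).
rewrite -!(scalemxAl, scalemxAr).
by rewrite !mxtraceZ /F /qcoef /= /k2 /k3; ring.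
Qed.

Lemma strip_fun_qtrace z :
  strip_fun z = qtrace (pw (1 - z / 2)) (pw (z / 2)) (pw (- (z / 2))) (pw (z / 2)).
Proof. by []. Qed.

Lemma spfun_powM z (f : C -> C) k (X : 'M[C]_k) :
  spfun (fun x => pw z x * f x) X = X ^^ z *m spfun f X.
Proof. by rewrite /mpow spfunM. Qed.

Lemma spfun_pw0 k (X : 'M[C]_k) : spfun (pw 0) X = supp X.
Proof. by []. Qed.

Lemma qtrace1 : qtrace (pw 1) (pw 0) (pw 0) (pw 0) = 1.
Proof.
rewrite /qtrace !spfun_pw0 -/(mpow pw rho 1) (mpow1 hpw) // supp_r_s rho_map_supp rho_suppr.
exact: rho_tr.
Qed.

Variable lg : C -> C.
Hypothesis lg_supp : forall x, pw 0 x * lg x = lg x.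
Local Notation logm := (spfun lg).

Lemma supp_logm k (X : 'M[C]_k) : supp X *m logm X = logm X.
Proof. by rewrite -spfun_powM; apply: eq_spfun => i; rewrite lg_supp. Qed.

Lemma logm_supp k (X : 'M[C]_k) : logm X *m supp X = logm X.
Proof.
by rewrite /suppmx /mpow spfunM; apply: eq_spfun => i; rewrite mulrC lg_supp.
Qed.

(** This and the next three are the contributions of the four factors to f'(0), up to sign and
    scale; the support identities absorb the projections left by the other factors. *)
Lemma qtrace_log1 :
  qtrace (fun x => pw 1 x * lg x) (pw 0) (pw 0) (pw 0) = \tr (rho *m logm rho).
Proof.
rewrite /qtrace spfun_powM !spfun_pw0 (mpow1 hpw) // supp_r_s.
rewrite mxtrace_mulC !mulmxA rho_supp.
have -> : rho *m logm rho = logm rho *m rho.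
  by rewrite -[X in X *m _](mpow1 hpw) // -[X in _ = _ *m X](mpow1 hpw) // /mpow !spfunM;
     apply: eq_spfun => i; rewrite mulrC.
by rewrite -mulmxA rho_map_supp.
Qed.

Lemma qtrace_log2 :
  qtrace (pw 1) (fun x => pw 0 x * lg x) (pw 0) (pw 0) = \tr (r *m logm r).
Proof.
rewrite /qtrace spfun_powM !spfun_pw0 supp_logm -/(mpow pw rho 1) (mpow1 hpw) //.
have -> : logm r *m supp s = logm r by rewrite -(logm_supp r) -mulmxA supp_r_s.
by rewrite mxtrace_mulC mulmxA rho_supp dual_r.
Qed.

Lemma qtrace_log3 :
  qtrace (pw 1) (pw 0) (fun x => pw 0 x * lg x) (pw 0) = \tr (r *m logm s).
Proof.
rewrite /qtrace spfun_powM !spfun_pw0 supp_logm -/(mpow pw rho 1) (mpow1 hpw) //.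
by rewrite mxtrace_mulC mulmxA rho_supp -dual_r mulmxA (mulmx_supp hpw).
Qed.

Lemma qtrace_log4 :
  qtrace (pw 1) (pw 0) (pw 0) (fun x => pw 0 x * lg x) = \tr (rho *m logm sigma).
Proof.
rewrite /qtrace spfun_powM !spfun_pw0 supp_logm -/(mpow pw rho 1) (mpow1 hpw) //.
by rewrite supp_r_s rho_map_supp.
Qed.

End StripBoundary.

(** * The averaged recovery map *)

Section Mean.
Context {C : numClosedFieldType} {I : Type}.

(* [W] is the mean of the functions in the class [P] against a probability measure on [I]. *)
Record is_mean (P : (I -> C) -> Prop) (W : (I -> C) -> C) : Prop := IsMean {
  mean_cstP : forall c, P (fun=> c);
  mean_addP : forall f g, P f -> P g -> P (fun t => f t + g t);
  mean_mulP : forall f g, P f -> P g -> P (fun t => f t * g t);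
  mean_conjP : forall f, P f -> P (fun t => (f t)^*);
  mean_cst : forall c, W (fun=> c) = c;
  mean_add : forall f g, P f -> P g -> W (fun t => f t + g t) = W f + W g;
  mean_scale : forall c f, P f -> W (fun t => c * f t) = c * W f;
  mean_conj : forall f, P f -> W (fun t => (f t)^*) = (W f)^*;
  mean_ge0 : forall f, P f -> (forall t, 0 <= f t) -> 0 <= W f }.

Context {P : (I -> C) -> Prop} {W : (I -> C) -> C} (hW : is_mean P W).

Definition mxP m n (F : I -> 'M[C]_(m, n)) : Prop := forall i j, P (fun t => F t i j).
Definition mxW m n (F : I -> 'M[C]_(m, n)) : 'M[C]_(m, n) := \matrix_(i, j) W (fun t => F t i j).

Lemma mean_sum (J : Type) (s : seq J) (h : J -> I -> C) : (forall j, P (h j)) ->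
  P (fun t => \sum_(j <- s) h j t) /\ W (fun t => \sum_(j <- s) h j t) = \sum_(j <- s) W (h j).
Proof.
move=> hP; elim: s => [|j s [ih1 ih2]].
  rewrite big_nil (_ : (fun t => _) = fun=> 0); last by apply/funext => t; rewrite big_nil.
  by split; [exact: (mean_cstP hW)|exact: (mean_cst hW)].
rewrite big_cons (_ : (fun t => _) = fun t => h j t + \sum_(j <- s) h j t); last first.
  by apply/funext => t; rewrite big_cons.
by split; [exact: (mean_addP hW)|rewrite (mean_add hW) ?ih2].
Qed.

Lemma mean_scaleP c f : P f -> P (fun t => c * f t).
Proof. by move=> hf; apply: (mean_mulP hW) => //; exact: (mean_cstP hW). Qed.

(** A linear functional is a finite combination of entries, so additivity and homogeneity of [W]
    suffice. *)
Lemma mean_lin m n (L : 'M[C]_(m, n) -> C) (F : I -> 'M[C]_(m, n)) :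
  (forall c X Y, L (c *: X + Y) = c * L X + L Y) -> mxP F ->
  P (fun t => L (F t)) /\ W (fun t => L (F t)) = L (mxW F).
Proof.
move=> Llin hF.
have L0 : L 0 = 0 by have := Llin (-1) 0 0; rewrite scaler0 addr0 mulN1r addNr.
have LD X Y : L (X + Y) = L X + L Y by rewrite -[X]scale1r Llin mul1r scale1r.
have LZ c X : L (c *: X) = c * L X by rewrite -[c *: X]addr0 Llin L0 addr0.
have Lsum (J : Type) (s : seq J) (G : J -> 'M[C]_(m, n)) :
    L (\sum_(j <- s) G j) = \sum_(j <- s) L (G j).
  by elim: s => [|j s ih]; rewrite ?big_nil // !big_cons LD ih.
have LE X : L X = \sum_i \sum_j L (delta_mx i j) * X i j.
  rewrite [X in L X]matrix_sum_delta Lsum; apply: eq_bigr => i _.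
  by rewrite Lsum; apply: eq_bigr => j _; rewrite LZ mulrC.
have h i := @mean_sum _ (index_enum 'I_n) (fun j t => L (delta_mx i j) * F t i j)
  (fun j => mean_scaleP _ (hF i j)).
have [h1 h2] := @mean_sum _ (index_enum 'I_m) (fun i t => \sum_j L (delta_mx i j) * F t i j)
  (fun i => (h i).1).
rewrite (_ : (fun t => _) = fun t => \sum_i \sum_j L (delta_mx i j) * F t i j); last first.
  by apply/funext => t; exact: LE.
split=> //; rewrite h2 LE; apply: eq_bigr => i _; rewrite (h i).2.
by apply: eq_bigr => j _; rewrite (mean_scale hW) // mxE.
Qed.

Lemma mxP_mul m n p (F : I -> 'M[C]_(m, n)) (G : I -> 'M[C]_(n, p)) :
  mxP F -> mxP G -> mxP (fun t => F t *m G t).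
Proof.
move=> hF hG i j.
rewrite (_ : (fun t => _) = fun t => \sum_k F t i k * G t k j); last first.
  by apply/funext => t; rewrite mxE.
by have [] := @mean_sum _ (index_enum 'I_n) (fun k t => F t i k * G t k j)
  (fun k => mean_mulP hW (hF i k) (hG k j)).
Qed.

Lemma mxP_cst m n (M : 'M[C]_(m, n)) : mxP (fun=> M).
Proof. by move=> i j; exact: (mean_cstP hW). Qed.

Lemma mxP_scale m n (c : I -> C) (F : I -> 'M[C]_(m, n)) :
  P c -> mxP F -> mxP (fun t => c t *: F t).
Proof.
move=> hc hF i j; rewrite (_ : (fun t => _) = fun t => c t * F t i j).
  exact: (mean_mulP hW).
by apply/funext => t; rewrite mxE.
Qed.

Lemma mxP_lin m n p q (T : 'M[C]_(m, n) -> 'M[C]_(p, q)) (F : I -> 'M[C]_(m, n)) :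
  (forall c X Y, T (c *: X + Y) = c *: T X + T Y) -> mxP F -> mxP (fun t => T (F t)).
Proof.
move=> Tlin hF i j; have [] // := @mean_lin _ _ (fun X => T X i j) F _ hF.
by move=> c X Y; rewrite Tlin addmxE scalemxE.
Qed.

Lemma mxW_add m n (F G : I -> 'M[C]_(m, n)) : mxP F -> mxP G ->
  mxW (fun t => F t + G t) = mxW F + mxW G.
Proof.
move=> hF hG; apply/matrixP => i j; rewrite !mxE -(mean_add hW) //.
by congr W; apply/funext => t; rewrite mxE.
Qed.

Lemma mxW_scale m n c (F : I -> 'M[C]_(m, n)) : mxP F -> mxW (fun t => c *: F t) = c *: mxW F.
Proof.
move=> hF; apply/matrixP => i j; rewrite !mxE -(mean_scale hW) //.
by congr W; apply/funext => t; rewrite mxE.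
Qed.

Lemma quad_lin n (v w : 'cV[C]_n) c (X Y : 'M[C]_n) : (v ^t* *m (c *: X + Y) *m w) 0 0 =
  c * (v ^t* *m X *m w) 0 0 + (v ^t* *m Y *m w) 0 0.
Proof. by rewrite mulmxDr mulmxDl -scalemxAr -scalemxAl addmxE scalemxE. Qed.

Lemma mxtrace_lin n p (M : 'M[C]_(p, n)) c (X Y : 'M[C]_(n, p)) :
  \tr (M *m (c *: X + Y)) = c * \tr (M *m X) + \tr (M *m Y).
Proof. by rewrite mulmxDr -scalemxAr mxtraceD mxtraceZ. Qed.

(* A vector lies in [A] when its image under the projection
   onto a complement vanishes. *)
Lemma mxW_mem n (A : {vspace 'M[C]_n}) (F : I -> 'M[C]_n) : mxP F ->
  (forall t, F t \in A) -> mxW F \in A.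
Proof.
move=> hF FA; suff -> : mxW F = projv A (mxW F) by exact: memv_proj.
apply/matrixP => i j; rewrite mxE.
have [|_ <-] // := @mean_lin _ _ (fun X => (projv A X) i j) F _ hF.
  by move=> c X Y; rewrite linearP addmxE scalemxE.
by congr W; apply/funext => t; rewrite projv_id.
Qed.

Lemma bpsd_mxW k n (X : I -> 'I_k -> 'I_k -> 'M[C]_n) :
  (forall i j, mxP (fun t => X t i j)) -> (forall t, bpsd (X t)) ->
  bpsd (fun i j => mxW (fun t => X t i j)).
Proof.
move=> hX hp v.
pose q i j t := ((v i) ^t* *m X t i j *m v j) 0 0.
have hq i j := @mean_lin _ _ (fun Y => ((v i) ^t* *m Y *m v j) 0 0) _
  (quad_lin (v i) (v j)) (hX i j).
have h i := @mean_sum _ (index_enum 'I_k) (q i) (fun j => (hq i j).1).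
have [h1 h2] := @mean_sum _ (index_enum 'I_k) (fun i t => \sum_j q i j t) (fun i => (h i).1).
have -> : \sum_i \sum_j ((v i) ^t* *m mxW (fun t => X t i j) *m v j) 0 0 =
    W (fun t => \sum_i \sum_j q i j t).
  rewrite h2; apply: eq_bigr => i _; rewrite (h i).2.
  by apply: eq_bigr => j _; rewrite -(hq i j).2.
by apply: (mean_ge0 hW) => // t; exact: hp.
Qed.

Section RecoveryMap.
Context {pw : C -> C -> C} (hpw : is_power pw).
Context {n m : nat} {T : 'M[C]_m -> 'M[C]_n}.
Hypothesis Tlin : forall c x y, T (c *: x + y) = c *: T x + T y.
Hypothesis Tcp : forall k (X : 'I_k -> 'I_k -> 'M[C]_m), bpsd X -> bpsd (fun i j => T (X i j)).
Hypothesis T1 : T 1%:M = 1%:M.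
Context {rho sigma : 'M[C]_n} {r s : 'M[C]_m}.
Hypotheses (rho_psd : psdm rho) (sigma_psd : psdm sigma) (r_psd : psdm r) (s_psd : psdm s).
Hypothesis dual_s : forall x, \tr (s *m x) = \tr (sigma *m T x).
Variable u : I -> C.
Hypothesis u_conj : forall t, (u t)^* = - u t.
Hypothesis u_pow : forall k (X : 'M[C]_k), mxP (fun t => mpow pw X (u t)).
Hypothesis u_powN : forall k (X : 'M[C]_k), mxP (fun t => mpow pw X (- u t)).
Local Notation "X ^^ z" := (mpow pw X z) (at level 30).
Local Notation supp := (suppmx pw).

Definition rotated_map (g : 'M[C]_m) (z : C) : 'M[C]_n := sigma ^^ (2^-1 - z) *m
  T (s ^^ (- 2^-1 + z) *m g *m s ^^ (- 2^-1 - z)) *m sigma ^^ (2^-1 + z).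

Definition mean_recovery (g : 'M[C]_m) : 'M[C]_n := mxW (fun t => rotated_map g (u t)).

Lemma mxP_pow k (X : 'M[C]_k) c : mxP (fun t => X ^^ (c + u t)).
Proof.
rewrite (_ : (fun t => _) = fun t => X ^^ c *m X ^^ u t).
  by apply: mxP_mul; [exact: mxP_cst|exact: u_pow].
by apply/funext => t; rewrite (mpowD hpw).
Qed.

Lemma mxP_powN k (X : 'M[C]_k) c : mxP (fun t => X ^^ (c - u t)).
Proof.
rewrite (_ : (fun t => _) = fun t => X ^^ c *m X ^^ (- u t)).
  by apply: mxP_mul; [exact: mxP_cst|exact: u_powN].
by apply/funext => t; rewrite (mpowD hpw).
Qed.

Lemma mxP_rotated g : mxP (fun t => rotated_map g (u t)).
Proof.
apply: mxP_mul; last exact: mxP_pow.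
apply: mxP_mul; first exact: mxP_powN.
apply: mxP_lin => //; apply: mxP_mul; last exact: mxP_powN.
by apply: mxP_mul; [exact: mxP_pow|exact: mxP_cst].
Qed.

Lemma rotated_mapE g z : sigma ^^ (- z) *m (sigma ^^ 2^-1 *m
    T (s ^^ (- 2^-1) *m (s ^^ z *m g *m s ^^ (- z)) *m s ^^ (- 2^-1)) *m sigma ^^ 2^-1) *m
    sigma ^^ z = rotated_map g z.
Proof.
rewrite /rotated_map !mulmxA !(mpowD hpw) [- z + _]addrC.
rewrite -[_ *m sigma ^^ 2^-1 *m sigma ^^ z]mulmxA (mpowD hpw).
by rewrite -[_ *m s ^^ (- z) *m s ^^ (- 2^-1)]mulmxA (mpowD hpw) [- z + _]addrC.
Qed.

Lemma rotated_map_lin z c x y :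
  rotated_map (c *: x + y) z = c *: rotated_map x z + rotated_map y z.
Proof.
by rewrite /rotated_map mulmxDr mulmxDl -scalemxAr -scalemxAl Tlin mulmxDr mulmxDl
   -scalemxAr -scalemxAl.
Qed.

Lemma mean_recovery_lin c x y :
  mean_recovery (c *: x + y) = c *: mean_recovery x + mean_recovery y.
Proof.
rewrite /mean_recovery -mxW_scale; last exact: mxP_rotated.
rewrite -mxW_add; last 2 first.
- by apply: mxP_scale; [exact: (mean_cstP hW)|exact: mxP_rotated].
- exact: mxP_rotated.
by congr mxW; apply/funext => t; rewrite rotated_map_lin.
Qed.

Lemma mean_recovery_mem (A : {vspace 'M[C]_n}) g :
  (forall x y, x \in A -> y \in A -> x *m y \in A) -> (forall x, T x \in A) ->
  (forall z, sigma ^^ z \in A) -> mean_recovery g \in A.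
Proof.
move=> AM TA sA; apply: mxW_mem => [|t]; first exact: mxP_rotated.
by apply: (AM) => //; apply: (AM).
Qed.

Lemma pow_adj_half k (X : 'M[C]_k) (a z : C) : a \is Num.real -> z^* = - z ->
  (X ^^ (a + z)) ^t* = X ^^ (a - z).
Proof. by move=> ar hz; rewrite (mpow_adj hpw) rmorphD /= hz (CrealP ar). Qed.

Lemma bpsd_congr k p q (X : 'I_k -> 'I_k -> 'M[C]_p) (a : 'M[C]_(q, p)) : bpsd X ->
  bpsd (fun i j => a *m X i j *m a ^t*).
Proof.
move=> hX v; have := hX (fun i => a ^t* *m v i).
congr (0 <= _); apply: eq_bigr => i _; apply: eq_bigr => j _.
by rewrite adjM trmxCK !mulmxA.
Qed.

(** For imaginary u the outer factors on either side are adjoint to each other, so each rotated map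
    is T between two congruences; the mean preserves positivity of the quadratic form. *)
Lemma mean_recovery_cp k (X : 'I_k -> 'I_k -> 'M[C]_m) :
  bpsd X -> bpsd (fun i j => mean_recovery (X i j)).
Proof.
move=> hX; apply: (@bpsd_mxW k n (fun t i j => rotated_map (X i j) (u t))).
  by move=> i j; exact: mxP_rotated.
move=> t; have Nr : - 2^-1 \is @Num.real C by rewrite rpredN half_real.
have uN : (- u t)^* = - - u t by rewrite rmorphN /= u_conj.
have h1 := bpsd_congr (s ^^ (- 2^-1 + u t)) hX.
have h2 := bpsd_congr (sigma ^^ (2^-1 - u t)) (Tcp h1).
move=> v; have := h2 v; congr (0 <= _); apply: eq_bigr => i _; apply: eq_bigr => j _.
by rewrite /rotated_map (pow_adj_half _ Nr (u_conj t)) (pow_adj_half _ half_real uN) opprK.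
Qed.

(** By cyclicity the powers of sigma recombine to sigma, and duality with s turns each trace into tr
    (g supp s), whatever the rotation. *)
Lemma mean_recovery_tr g : psdm g -> \tr (mean_recovery g) <= \tr g.
Proof.
move=> hg.
have trl c (X Y : 'M[C]_n) : \tr (c *: X + Y) = c * \tr X + \tr Y by rewrite mxtraceD mxtraceZ.
have [_ <-] := @mean_lin _ _ (fun X => \tr X) _ trl (mxP_rotated g).
rewrite (_ : (fun t => _) = fun=> \tr (g *m supp s)); last first.
  apply/funext => t; rewrite /rotated_map mxtrace_mulC mulmxA (mpowD hpw).
  rewrite (_ : 2^-1 + u t + (2^-1 - u t) = 1); last by field.
  rewrite (mpow1 hpw) // -dual_s mulmxA mxtrace_mulC !mulmxA.
  rewrite -{2}(mpow1 hpw s_psd) !(mpowD hpw) mxtrace_mulC.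
  by rewrite (_ : - 2^-1 - u t + 1 + (- 2^-1 + u t) = 0) //; field.
rewrite (mean_cst hW) -subr_ge0 -raddfB /= -{1}[g]mulmx1 -mulmxBr.
by apply: psdm_tr_mul_ge0 => //; exact: (psdm_csuppmx hpw).
Qed.

Hypothesis dual_r : forall x, \tr (r *m x) = \tr (rho *m T x).
Hypothesis rho_supp : suppmx pw sigma *m rho = rho.
Hypothesis rho_tr : \tr rho = 1.

(** The block inequality is linear in both Z and the rotated state, so it survives averaging; the
    fidelity bound is then applied once, to the averaged blocks. *)
Lemma mean_strip_fun_le (c : I -> C) (X := rho ^^ 2^-1 *m (mean_recovery r) ^^ 2^-1) :
  P c -> (forall t, `|c t| <= 1) ->
  W (fun t => c t * strip_fun pw T rho sigma r s (1 + 2 * u t)) +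
  (W (fun t => c t * strip_fun pw T rho sigma r s (1 + 2 * u t)))^* <=
  2 * \tr ((X ^t* *m X) ^^ 2^-1).
Proof.
move=> Pc c1; pose Z t := rotated_factor pw T rho sigma r s (c t) (u t).
have PZ : mxP Z.
  apply: mxP_mul; last exact: mxP_pow.
  apply: mxP_mul; first by apply: mxP_scale => //; exact: u_powN.
  by apply: mxP_lin => //; apply: mxP_mul; [exact: mxP_pow|exact: mxP_powN].
have [_ E] := @mean_lin _ _ (fun Y => \tr (rho ^^ 2^-1 *m Y)) Z (mxtrace_lin _) PZ.
rewrite (_ : (fun t => _) = fun t => \tr (rho ^^ 2^-1 *m Z t)); last first.
  by apply/funext => t; rewrite (strip_fun_right hpw).
rewrite E; apply: (block_fidelity_le hpw) => //.
  have hb : bpsd (fun _ _ : 'I_1 => r) by move=> v; rewrite !big_ord1; exact: r_psd.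
  by move=> v; have := mean_recovery_cp hb (fun=> v); rewrite !big_ord1.
move=> v w.
have [P1 E1] := mean_lin (quad_lin v w) PZ.
have [P2 E2] := mean_lin (quad_lin w w) (mxP_rotated r).
rewrite -E1 -(mean_conj hW) // -E2.
pose q0 := (v ^t* *m v) 0 0; pose q1 t := (v ^t* *m Z t *m w) 0 0.
pose q2 t := (w ^t* *m rotated_map r (u t) *m w) 0 0.
have Pq0 : P (fun=> q0) := mean_cstP hW q0.
have Pc1 := mean_conjP hW P1; have P01 := mean_addP hW Pq0 P1.
have P011 := mean_addP hW P01 Pc1.
have -> : q0 + W q1 + W (fun t => (q1 t)^*) + W q2 =
    W (fun t => q0 + q1 t + (q1 t)^* + q2 t).
  by rewrite (mean_add hW P011 P2) (mean_add hW P01 Pc1) (mean_add hW Pq0 P1) (mean_cst hW).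
apply: (mean_ge0 hW); first exact: (mean_addP hW P011 P2).
by move=> t; apply: (rotated_block hpw Tlin Tcp T1).
Qed.

End RecoveryMap.

End Mean.

(** * Complex matrices *)

Section ConcreteMean.
Local Open Scope complex_scope.
Context {R : realType}.
Local Notation C := R[i].
Notation mu := (@lebesgue_measure R).
Implicit Types (h : R -> C).

Lemma ReM (x y : C) : complex.Re (x * y) =
  complex.Re x * complex.Re y - complex.Im x * complex.Im y.
Proof. by case: x => a b; case: y. Qed.

Lemma ImM (x y : C) : complex.Im (x * y) =
  complex.Re x * complex.Im y + complex.Im x * complex.Re y.
Proof. by case: x => a b; case: y. Qed.

Lemma ReD (x y : C) : complex.Re (x + y) = complex.Re x + complex.Re y.
Proof. by case: x => a b; case: y. Qed.

Lemma ImD (x y : C) : complex.Im (x + y) = complex.Im x + complex.Im y.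
Proof. by case: x => a b; case: y. Qed.

Lemma complex_eqP (x y : C) : complex.Re x = complex.Re y -> complex.Im x = complex.Im y -> x = y.
Proof. by case: x => a b; case: y => c d /= -> ->. Qed.

(** Bounded measurable functions: closed under products, and integrable against [beta0]. *)
Definition bmeas h : Prop := [/\ measurable_fun setT (fun t => complex.Re (h t)),
  measurable_fun setT (fun t => complex.Im (h t)) &
  exists M, forall t, `|complex.Re (h t)| <= M /\ `|complex.Im (h t)| <= M].

Definition wint h : C := (\int[mu]_t (beta0 t * complex.Re (h t))) +i*
  (\int[mu]_t (beta0 t * complex.Im (h t))).

Lemma bmeas_Re h : bmeas h ->
  mu.-integrable setT (EFin \o (fun t => beta0 t * complex.Re (h t))).
Proof. by move=> [mh _ [M hM]]; apply: (@integrable_beta0_dom _ _ M) => // t; case: (hM t). Qed.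

Lemma bmeas_Im h : bmeas h ->
  mu.-integrable setT (EFin \o (fun t => beta0 t * complex.Im (h t))).
Proof. by move=> [_ mh [M hM]]; apply: (@integrable_beta0_dom _ _ M) => // t; case: (hM t). Qed.

Lemma bmeas_cst (c : C) : bmeas (fun=> c).
Proof.
split; [exact: measurable_cst|exact: measurable_cst|].
by exists (Num.max `|complex.Re c| `|complex.Im c|) => t; rewrite !le_max !lexx orbT.
Qed.

Lemma bmeas_add f g : bmeas f -> bmeas g -> bmeas (fun t => f t + g t).
Proof.
move=> [f1 f2 [M hM]] [g1 g2 [K hK]]; split.
- by under eq_fun do rewrite ReD; exact: measurable_funD.
- by under eq_fun do rewrite ImD; exact: measurable_funD.
exists (M + K) => t; rewrite ReD ImD; have [? ?] := hM t; have [? ?] := hK t.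
by split; apply: (le_trans (ler_normD _ _)); apply: lerD.
Qed.

Lemma bmeas_mul f g : bmeas f -> bmeas g -> bmeas (fun t => f t * g t).
Proof.
move=> [f1 f2 [M hM]] [g1 g2 [K hK]]; split.
- by under eq_fun do rewrite ReM; apply: measurable_funB; exact: measurable_funM.
- by under eq_fun do rewrite ImM; apply: measurable_funD; exact: measurable_funM.
exists (M * K + M * K) => t; rewrite ReM ImM; have [? ?] := hM t; have [? ?] := hK t.
split; first apply: (le_trans (ler_normB _ _)); last apply: (le_trans (ler_normD _ _)).
  by rewrite !normrM; apply: lerD; exact: ler_pM.
by rewrite !normrM; apply: lerD; exact: ler_pM.
Qed.

Lemma ReJ (z : C) : complex.Re (z^*)%R = complex.Re z.
Proof. by case: z. Qed.

Lemma ImJ (z : C) : complex.Im (z^*)%R = - complex.Im z.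
Proof. by case: z. Qed.

Lemma bmeas_conj h : bmeas h -> bmeas (fun t => (h t)^*)%R.
Proof.
move=> [h1 h2 [M hM]]; split.
- by under eq_fun do rewrite ReJ.
- by under eq_fun do rewrite ImJ; exact: measurableT_comp.
by exists M => t; rewrite ReJ ImJ normrN; exact: hM.
Qed.

Lemma wint_mean : is_mean bmeas wint.
Proof.
split.
- exact: bmeas_cst.
- exact: bmeas_add.
- exact: bmeas_mul.
- exact: bmeas_conj.
- move=> c; rewrite /wint !RintegralZr ?Rintegral_beta0 ?mul1r; last first.
  + exact: integrable_beta0.
  + exact: measurableT.
  + exact: integrable_beta0.
  + exact: measurableT.
  by case: c.
- move=> f g hf hg; apply: complex_eqP; rewrite ?ReD ?ImD /=.
  + rewrite -RintegralD; [|exact: measurableT|exact: bmeas_Re|exact: bmeas_Re].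
    by apply: eq_Rintegral => t _; rewrite ReD mulrDr.
  + rewrite -RintegralD; [|exact: measurableT|exact: bmeas_Im|exact: bmeas_Im].
    by apply: eq_Rintegral => t _; rewrite ImD mulrDr.
- move=> c f hf; apply: complex_eqP; rewrite ?ReM ?ImM /=.
  + rewrite -!RintegralZl; [|exact: measurableT|exact: bmeas_Im|exact: measurableT|exact: bmeas_Re].
    rewrite -RintegralB;
      [|exact: measurableT|exact/integrable_scale/bmeas_Re|exact/integrable_scale/bmeas_Im].
    by apply: eq_Rintegral => t _; rewrite ReM; ring.
  + rewrite -!RintegralZl; [|exact: measurableT|exact: bmeas_Re|exact: measurableT|exact: bmeas_Im].
    rewrite -RintegralD;
      [|exact: measurableT|exact/integrable_scale/bmeas_Im|exact/integrable_scale/bmeas_Re].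
    by apply: eq_Rintegral => t _; rewrite ImM; ring.
- move=> f hf; apply: complex_eqP; rewrite ?ReJ ?ImJ /=.
  + by apply: eq_Rintegral => t _; rewrite ReJ.
  + rewrite -mulN1r -RintegralZl; [|exact: measurableT|exact: bmeas_Im].
    by apply: eq_Rintegral => t _; rewrite ImJ; ring.
- move=> f hf f0; rewrite lecE /=; apply/andP; split; last first.
    apply: Rintegral_ge0 => t _; rewrite mulr_ge0 ?(ltW (beta0_gt0 t)) //.
    by have := f0 t; rewrite lecE => /andP[].
  apply/eqP; rewrite -[RHS](Rintegral_set0 mu (fun=> 0)) /=.
  transitivity (\int[mu]_(t in [set: R]) (0 : R)); last first.
    by rewrite Rintegral_cst ?mul0r ?Rintegral_set0 //; exact: measurableT.
  apply: eq_Rintegral => t _; have := f0 t; rewrite lecE => /andP[/eqP /= -> _].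
  exact: mulr0.
Qed.

Definition pwR (z x : C) : C :=
  if 0 < complex.Re x then expC (z * (ln (complex.Re x))%:C) else 0.

Lemma expCD (z w : C) : expC (z + w) = expC z * expC w.
Proof.
by case: z => a b; case: w => c d; apply: complex_eqP;
   rewrite /expC /= expRD ?sinD ?cosD; ring.
Qed.

Lemma expC_real (a : R) : expC a%:C = (expR a)%:C.
Proof. by apply: complex_eqP; rewrite /expC /= cos0 sin0; ring. Qed.

Lemma expC_conj (z : C) : ((expC z)^*)%R = expC (z^*)%R.
Proof. by case: z => a b; apply: complex_eqP; rewrite /expC /= ?sinN ?cosN; ring. Qed.

Lemma pwR_power : is_power pwR.
Proof.
split=> [z w x|z x|z x zr|x x0]; rewrite /pwR.
- by case: ifP => _; rewrite ?mul0r // mulrDl expCD.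
- case: ifP => _; last by rewrite rmorph0.
  rewrite expC_conj rmorphM; congr (expC (_ * _)).
  by apply: complex_eqP; rewrite ?ReJ ?ImJ //= oppr0.
- case: ifP => // _; have -> : z = (complex.Re z)%:C.
    apply: complex_eqP => //=; have /CrealP/(congr1 (@complex.Im R)) := zr.
    by rewrite ImJ => /eqP; rewrite eqNr => /eqP.
  by rewrite -rmorphM expC_real lecR expR_ge0.
- have [xi xr] : complex.Im x = 0 /\ 0 <= complex.Re x.
    by move: x0; rewrite lecE => /andP[/eqP].
  case: ifP => [h|/negbT].
    by rewrite mul1r expC_real lnK ?posrE //; apply: complex_eqP.
  by rewrite -leNgt => h; apply: complex_eqP => //=; apply/eqP; rewrite eq_le xr.
Qed.

End ConcreteMean.

Section ConcretePowers.
Local Open Scope complex_scope.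
Context {R : realType}.
Local Notation C := R[i].

Lemma mxfun_spfun n (f : R -> C) (X : 'M[C]_n) :
  mxfun f X = spfun (fun x => f (complex.Re x)) X.
Proof. by rewrite spfun_invmx. Qed.

Lemma mxpow_mpow n (X : 'M[C]_n) (z : C) : mxpow X z = mpow pwR X z.
Proof. exact: mxfun_spfun. Qed.

Definition lgR (b : R) (x : C) : C := (ln (complex.Re x) / ln b)%:C.

Lemma mxlog_spfun b n (X : 'M[C]_n) : mxlog b X = spfun (lgR b) X.
Proof. exact: mxfun_spfun. Qed.

Lemma lgR_supp b (x : C) : pwR 0 x * lgR b x = lgR b x.
Proof.
rewrite /pwR /lgR; case: ltP => h.
  by rewrite mul0r (expC_real 0) expR0 mul1r.
by rewrite ln0 // !mul0r.
Qed.

Lemma real_halfE : (2^-1)%:C = 2^-1 :> C.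
Proof. by rewrite fmorphV rmorph_nat. Qed.

Lemma mxsqrt_mpow n (X : 'M[C]_n) : mxsqrt X = mpow pwR X 2^-1.
Proof. by rewrite /mxsqrt mxpow_mpow real_halfE. Qed.

Lemma supp_sub_suppmx n (rho sigma : 'M[C]_n) : psdm sigma ->
  supp_sub rho sigma = (suppmx pwR sigma *m rho == rho).
Proof.
move=> hs; apply/idP/eqP => [/submxP[D /(congr1 trmx)]|E].
  rewrite trmxK trmx_mul trmxK => ->; rewrite mulmxA.
  by rewrite (mul_suppmx pwR_power hs).
have -> : rho = sigma *m (mpow pwR sigma (-1) *m rho).
  rewrite mulmxA -{1}(mpow1 pwR_power hs) (mpowD pwR_power) subrr.
  exact/esym/E.
by rewrite /supp_sub trmx_mul submxMl.
Qed.

End ConcretePowers.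

(** * The adjoint of a channel as a unital completely positive map *)

Section AdjointMap.
Local Open Scope complex_scope.
Context {R : realType} {n m : nat}.
Local Notation C := R[i].
Context {A : {vspace 'M[C]_n}} {B : {vspace 'M[C]_m}} {N : 'M[C]_n -> 'M[C]_m}.
Hypothesis hA : vn_algebra A.
Hypothesis hN : channel A B N.
Local Notation T := (adjoint_map A N).

Lemma adjoint_mem x : T x \in A.
Proof. by have [[Nl _] _] := hN; have [] := adjoint_mapP hA x Nl. Qed.

Lemma channel_lin c x y : x \in A -> y \in A -> N (c *: x + y) = c *: N x + N y.
Proof. by have [[[_ h] _] _] := hN; exact: h. Qed.

(** The defining property speaks of states only. A nonzero Gram matrix divided by its trace is a
    state, and polarization reaches the rest of [A]. *)
Lemma adjoint_dual a x : a \in A -> \tr (N a *m x) = \tr (a *m T x).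
Proof.
have [A1 AM Aadj] := hA; have [[Nl _] _] := hN; have [_ hT] := adjoint_mapP hA x Nl.
have N0 : N 0 = 0.
  by have := channel_lin (-1) (mem0v A) (mem0v A); rewrite scaler0 addr0 scaleN1r addNr.
have NZ c y : y \in A -> N (c *: y) = c *: N y.
  by move=> yA; rewrite -[c *: y]addr0 channel_lin ?mem0v // N0 addr0.
pose h (a : 'M[C]_n) : C := \tr (N a *m x) - \tr (a *m T x).
suff h0 : forall a, a \in A -> h a = 0.
  by move=> aA; apply/eqP; rewrite -subr_eq0; apply/eqP; exact: h0.
apply: gram_polarization => // [c y z yA zA|c cA].
  by rewrite /h channel_lin // !mulmxDl -!scalemxAl !mxtraceD !mxtraceZ; ring.
have gA : c ^t* *m c \in A by rewrite AM // Aadj.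
have [t0|t0] := eqVneq (\tr (c ^t* *m c)) 0.
  by rewrite /h (mxtrace_adj_eq0 t0) mulmx0 N0 !mul0mx !mxtrace0 subrr.
have tg := psdm_tr_ge0 (psdm_gram c).
have hs : state A ((\tr (c ^t* *m c))^-1 *: (c ^t* *m c)).
  split; first by rewrite memvZ.
  split; last by rewrite mxtraceZ mulVf.
  by apply: (@psdmZ _ n); [rewrite invr_ge0|exact: psdm_gram].
have := hT _ hs; rewrite /expect NZ // -!scalemxAl !mxtraceZ => /(mulfI _) E.
by rewrite /h E ?subrr // invr_eq0.
Qed.

Lemma adjoint_lin c x y : T (c *: x + y) = c *: T x + T y.
Proof.
apply: (adjoint_map_uniq hA).
  by rewrite memvD ?memvZ ?adjoint_mem.
move=> rho [rhoA _]; rewrite /expect !mulmxDr -!scalemxAr !mxtraceD !mxtraceZ.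
by rewrite !adjoint_dual.
Qed.

Lemma adjoint_unital : T 1%:M = 1%:M.
Proof.
have [A1 AM Aadj] := hA; have [_ Ntr] := hN.
apply: (adjoint_map_uniq hA) => // rho [rhoA _].
by rewrite /expect !mulmx1 Ntr.
Qed.

Lemma channel_bpsd k (X : 'I_k -> 'I_k -> 'M[C]_n) : (forall i j, X i j \in A) ->
  bpsd X -> bpsd (fun i j => N (X i j)).
Proof.
by move=> XA /psdm_mxblock hX; apply/psdm_mxblock; have [[_ h] _] := hN; exact: h.
Qed.

Lemma adjoint_cp k (X : 'I_k -> 'I_k -> 'M[C]_m) : bpsd X -> bpsd (fun i j => T (X i j)).
Proof.
have [A1 AM Aadj] := hA.
exact: (dual_completely_positive A1 AM Aadj adjoint_mem adjoint_dual channel_bpsd).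
Qed.

Lemma channel_psd x : x \in A -> psdm x -> psdm (N x).
Proof.
move=> xA hx; have hb : bpsd (fun _ _ : 'I_1 => x) by move=> v; rewrite !big_ord1; exact: hx.
by move=> v; have := channel_bpsd (fun _ _ => xA) hb (fun=> v); rewrite !big_ord1.
Qed.

End AdjointMap.

(** * The recovery integral as a mean *)

Section ConcreteRecovery.
Local Open Scope complex_scope.
Context {R : realType}.
Local Notation C := R[i].
Notation mu := (@lebesgue_measure R).

Definition phase (t : R) : C := 0 +i* (t / 2).

Lemma phase_conj t : ((phase t)^*)%R = - phase t.
Proof. by apply: complex_eqP; rewrite ?ReJ ?ImJ /= ?oppr0. Qed.

Lemma bmeas_expC (a : R) : bmeas (fun t => expC (0 +i* (a * t))).
Proof.
have ct : continuous (fun t : R => a * t) by apply: der_continuous => t; eexists; der.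
have ca : continuous (fun t : R => cos (a * t)).
  by apply: (der_continuous (f := fun t => cos (a * t))) => t; eexists; der.
have sa : continuous (fun t : R => sin (a * t)).
  by apply: (der_continuous (f := fun t => sin (a * t))) => t; eexists; der.
have E t : complex.Re (expC (0 +i* (a * t))) = cos (a * t).
  by rewrite /expC /= expR0; ring.
have E' t : complex.Im (expC (0 +i* (a * t))) = sin (a * t).
  by rewrite /expC /= expR0; ring.
split.
- by under eq_fun do rewrite E; exact: continuous_measurable_fun.
- by under eq_fun do rewrite E'; exact: continuous_measurable_fun.
exists 1 => t; rewrite E E' !ler_norml cos_geN1 cos_le1 sin_geN1 sin_le1.
by [].
Qed.

(** Each entry is a finite combination of the oscillations exp (i e t ln x) over the positive
    eigenvalues x. *)
Lemma mxP_mpow (e : R) k (X : 'M[C]_k) :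
  mxP (P := bmeas) (fun t => mpow pwR X (0 +i* (e * t))).
Proof.
move=> i j; rewrite (_ : (fun t => _) = fun t => \sum_l
    pwR (0 +i* (e * t)) (spectral_diag X 0 l) * eigproj X l i j); last first.
  by apply/funext => t; rewrite /mpow spfun_sum summxE; apply: eq_bigr => l _; rewrite mxE.
have [|//] := @mean_sum _ _ _ _ wint_mean _ (index_enum 'I_k)
  (fun l t => pwR (0 +i* (e * t)) (spectral_diag X 0 l) * eigproj X l i j).
move=> l; apply: bmeas_mul; last exact: bmeas_cst.
rewrite /pwR; case: (0 < complex.Re (spectral_diag X 0 l)); last exact: bmeas_cst.
set y := ln _; rewrite (_ : (fun t => _) = fun t => expC (0 +i* ((e * y) * t))).
  exact: bmeas_expC.
apply/funext => t; congr expC; apply: complex_eqP; rewrite ?ReM ?ImM /=; ring.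
Qed.

Lemma mxP_phase k (X : 'M[C]_k) : mxP (P := bmeas) (fun t => mpow pwR X (phase t)).
Proof.
rewrite (_ : (fun t => _) = fun t => mpow pwR X (0 +i* (2^-1 * t))).
  exact: mxP_mpow.
by apply/funext => t; rewrite /phase mulrC.
Qed.

Lemma mxP_phaseN k (X : 'M[C]_k) : mxP (P := bmeas) (fun t => mpow pwR X (- phase t)).
Proof.
rewrite (_ : (fun t => _) = fun t => mpow pwR X (0 +i* (- 2^-1 * t))).
  exact: mxP_mpow.
by apply/funext => t; congr mpow; apply: complex_eqP => /=; rewrite ?oppr0 // mulNr mulrC.
Qed.

Lemma recovery_mean n m (A : {vspace 'M[C]_n}) (sigma : 'M[C]_n) (N : 'M[C]_n -> 'M[C]_m)
    (g : 'M[C]_m) :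
  recovery A sigma N g = mean_recovery (W := wint) (pw := pwR) (T := adjoint_map A N)
    (sigma := sigma) (s := N sigma) phase g.
Proof.
have pE (t : R) : 0 +i* (t / 2) = phase t by [].
have pN (t : R) : 0 +i* (- (t / 2)) = - phase t.
  by apply: complex_eqP => //=; rewrite oppr0.
have hE : (- 2^-1)%:C = - 2^-1 :> C.
  by rewrite -real_halfE; apply: complex_eqP => //=; rewrite oppr0.
have E (t : R) : mxpow sigma (0 +i* (- (t / 2))) *m petz A sigma N
     (mxpow (N sigma) (0 +i* (t / 2)) *m g *m mxpow (N sigma) (0 +i* (- (t / 2))))
     *m mxpow sigma (0 +i* (t / 2)) =
     rotated_map (pw := pwR) (T := adjoint_map A N) (sigma := sigma) (s := N sigma) g (phase t).
  have e1 : mxpow sigma (0 +i* (- (t / 2))) = mpow pwR sigma (- phase t) by rewrite pN mxpow_mpow.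
  have e2 : mxpow (N sigma) (0 +i* (- (t / 2))) = mpow pwR (N sigma) (- phase t).
    by rewrite pN mxpow_mpow.
  have e3 := mxpow_mpow sigma (phase t); have e4 := mxpow_mpow (N sigma) (phase t).
  have e5 := mxsqrt_mpow sigma.
  have e6 : mxpow (N sigma) (- 2^-1)%:C = mpow pwR (N sigma) (- 2^-1).
    exact: (etrans (mxpow_mpow _ _) (congr1 (mpow pwR (N sigma)) hE)).
  by rewrite /petz e1 e2 e3 e4 e5 e6 (rotated_mapE pwR_power).
apply/matrixP => i j; rewrite !mxE /wint.
congr (_ +i* _); apply: eq_Rintegral => t _; rewrite mxE E ?ReM ?ImM /=; ring.
Qed.

End ConcreteRecovery.

(** * The boundary estimate for complex exponential sums *)

Section StripEstimate.
Local Open Scope complex_scope.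
Context {R : realType}.
Local Notation C := R[i].
Notation mu := (@lebesgue_measure R).

Lemma Re_sum (I : Type) (s : seq I) (F : I -> C) :
  complex.Re (\sum_(i <- s) F i) = \sum_(i <- s) complex.Re (F i).
Proof. by elim: s => [|i s ih]; rewrite ?big_nil // !big_cons ReD ih. Qed.

Lemma Re_le (z w : C) : z <= w -> complex.Re z <= complex.Re w.
Proof. by rewrite lecE => /andP[]. Qed.

Lemma Re_real_half (z : C) (k : R) : z + (z^*)%R <= 2 * k%:C -> complex.Re z <= k.
Proof.
move=> /Re_le; rewrite ReD ReJ mulr_natl mulr2n ReD /=; lra.
Qed.

(** The phase of exp (- c z) at height t; its modulus on Re z = 1 is the factor exp (- c) of the
    final bound. *)
Definition exp_phase (c t : R) : C := expC (0 +i* (- (c * t))).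

Lemma exp_phase_norm c t : `|exp_phase c t| <= 1.
Proof.
rewrite normc_def lecR /exp_phase /expC /= expR0 !mul1r !mul0r subr0 addr0.
by rewrite cos2Dsin2 sqrtr1.
Qed.

Lemma bmeas_exp_phase c : bmeas (exp_phase c).
Proof.
rewrite (_ : exp_phase c = fun t => expC (0 +i* ((- c) * t))); first exact: bmeas_expC.
by apply/funext => t; rewrite /exp_phase mulNr.
Qed.

Lemma strip_estimate (I : finType) (cf : I -> C) (l : I -> R) (f : C -> C) (F c : R) :
  (forall z, f z = \sum_k cf k * expC (z * (l k)%:C)) -> f 0 = 1 ->
  (forall a t, `|a| <= 1 -> a * f (2 * phase t) + ((a * f (2 * phase t))^*)%R <= 2) ->
  (forall a, bmeas a -> (forall t, `|a t| <= 1) ->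
     wint (fun t => a t * f (1 + 2 * phase t)) +
     ((wint (fun t => a t * f (1 + 2 * phase t)))^*)%R <= 2 * F%:C) ->
  complex.Re (\sum_k cf k * (l k)%:C) - c <= expR (- c) * F - 1.
Proof.
move=> fE f1 left right.
pose a k := complex.Re (cf k); pose b k := complex.Im (cf k); pose d k := l k - c.
have p2 t : 2 * phase t = 0 +i* t :> C.
  by apply: complex_eqP; rewrite mulr_natl mulr2n ?ReD ?ImD /phase /=; field.
have expE (x t : R) k : exp_phase c t * expC ((x +i* t) * (l k)%:C) =
    (expR (x * l k))%:C * (cos (d k * t) +i* sin (d k * t)).
  rewrite /exp_phase -expCD.
  have -> : 0 +i* (- (c * t)) + (x +i* t) * (l k)%:C = (x * l k) +i* (d k * t).
    by apply: complex_eqP => /=; rewrite /d; ring.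
  by [].
have Ref (x t : R) : complex.Re (exp_phase c t * f (x +i* t)) =
    \sum_k expR (x * l k) * (a k * cos (d k * t) - b k * sin (d k * t)).
  rewrite fE mulr_sumr Re_sum; apply: eq_bigr => k _.
  by rewrite mulrCA expE !ReM /= /a /b; ring.
have suma : \sum_k a k = 1.
  have <- : complex.Re (f 0) = 1 by rewrite f1.
  rewrite fE Re_sum; apply: eq_bigr => k _.
  by rewrite mul0r (expC_real 0) expR0 mulr1.
(* Adding the estimates at t and - t removes the sines, so only the real parts of the coefficients
   remain. *)
have leftcos t : \sum_k a k * cos (d k * t) <= 1.
  have h s : complex.Re (exp_phase c s * f (0 +i* s)) <= 1.
    apply: Re_real_half; rewrite -p2 mulr1; apply: left; exact: exp_phase_norm.
  have := lerD (h t) (h (- t)); rewrite !Ref -big_split /= => h2.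
  rewrite -(ler_pM2l (_ : 0 < 2)) // mulr_sumr mulr1; apply: le_trans h2.
  rewrite le_eqVlt; apply/orP; left; apply/eqP; apply: eq_bigr => k _.
  by rewrite mul0r expR0 mulrN cosN sinN; ring.
pose H t : R := \sum_k expR (l k) * (a k * cos (d k * t) - b k * sin (d k * t)).
have HE t : complex.Re (exp_phase c t * f (1 + 2 * phase t)) = H t.
  have -> : 1 + 2 * phase t = 1 +i* t by rewrite p2; apply: complex_eqP => /=; ring.
  by rewrite Ref; apply: eq_bigr => k _; rewrite mul1r.
have HW : \int[mu]_t (beta0 t * H t) <= F.
  have := Re_real_half (right _ (bmeas_exp_phase c) (exp_phase_norm c)).
  by rewrite /wint /=; under eq_Rintegral do rewrite HE.
have cH : continuous H.
  apply: der_continuous => t; eexists; apply: der_sum => k; der.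
have bH t : `|H t| <= \sum_k expR (l k) * (`|a k| + `|b k|).
  apply: (le_trans (ler_norm_sum _ _ _)); apply: ler_sum => k _.
  rewrite normrM (gtr0_norm (expR_gt0 _)) ler_wpM2l ?expR_ge0 //.
  apply: (le_trans (ler_normB _ _)); rewrite !normrM.
  by apply: lerD; rewrite ler_piMr // ler_norml ?cos_geN1 ?cos_le1 ?sin_geN1 ?sin_le1.
have := @boundary_inequality R I a d (fun t _ => leftcos t) suma.
have -> : \sum_k a k * d k = complex.Re (\sum_k cf k * (l k)%:C) - c.
  rewrite Re_sum -[c in RHS]mul1r -suma mulr_suml -sumrB; apply: eq_bigr => k _.
  by rewrite ReM /= /a /d; ring.
move=> /le_trans; apply; rewrite lerD2r.
apply: (@le_trans _ _ (expR (- c) * \int[mu]_t (beta0 t * H t))); last first.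
  by rewrite ler_wpM2l ?expR_ge0.
rewrite (Rintegral_beta0_fold cH bH).
have i1 : mu.-integrable `[0%R, +oo[ (EFin \o (fun t => beta0 t * (H t + H (- t)))).
  pose M := \sum_k expR (l k) * (`|a k| + `|b k|).
  apply: (@integrable_beta0_bounded R _ (M + M)).
    by move=> t; apply: cvgD; [exact: cH|apply: continuous_comp; [exact: opp_continuous|exact: cH]].
  by move=> t _; apply: (le_trans (ler_normD _ _)); apply: lerD.
have i2 : mu.-integrable `[0%R, +oo[
    (EFin \o (fun t => beta0 t * \sum_k a k * expR (d k) * cos (d k * t))).
  apply: (@integrable_beta0_bounded R _ (\sum_k `|a k * expR (d k)|)).
    by apply: der_continuous => t; eexists; apply: der_sum => k; der.
  move=> t _; apply: (le_trans (ler_norm_sum _ _ _)); apply: ler_sum => k _.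
  by rewrite normrM ler_piMr // ler_norml cos_geN1 cos_le1.
rewrite -[leLHS]RintegralZl; [|exact: measurable_itv|exact: i2].
rewrite -[leRHS]RintegralZl; [|exact: measurable_itv|exact: i1].
rewrite le_eqVlt; apply/orP; left; apply/eqP; apply: eq_Rintegral => t _.
rewrite mulrCA [RHS]mulrCA; congr (_ * _); rewrite -big_split !mulr_sumr.
apply: eq_bigr => k _ /=; rewrite /d expRD mulrN cosN sinN; ring.
Qed.

End StripEstimate.

(** * The entropy difference as a derivative at the boundary *)

Section RecoverabilityBound.
Local Open Scope complex_scope.
Context {R : realType} {n m : nat}.
Local Notation C := R[i].
Context {T : 'M[C]_m -> 'M[C]_n} {rho sigma : 'M[C]_n} {r s : 'M[C]_m}.
Local Notation ev X i := (complex.Re (spectral_diag X 0 i)).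
Local Notation qc := (qcoef T rho sigma r s).
Local Notation qt := (qtrace T rho sigma r s).

(** A quadruple with a nonpositive eigenvalue contributes nothing, because one of its powers
    vanishes for every exponent. *)
Definition all_pos (k : qindex n m) : bool := [&& 0 < ev rho k.1, 0 < ev r k.2.1,
  0 < ev s k.2.2.1 & 0 < ev sigma k.2.2.2].

Definition strip_coef (k : qindex n m) : C :=
  if all_pos k then (ev rho k.1)%:C * qc k else 0.

(** The rate in z of the product of the four powers. The power 1 - z/2 of an eigenvalue of rho
    leaves that eigenvalue itself in [strip_coef]. *)
Definition strip_exp (k : qindex n m) : R := (- ln (ev rho k.1) + ln (ev r k.2.1)
  - ln (ev s k.2.2.1) + ln (ev sigma k.2.2.2)) / 2.

Lemma pwR1 (x : C) : 0 < complex.Re x -> pwR 1 x = (complex.Re x)%:C.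
Proof. by move=> x0; rewrite /pwR x0 mul1r expC_real lnK. Qed.

Lemma pwR_pos z (x : C) : 0 < complex.Re x -> pwR z x = expC (z * (ln (complex.Re x))%:C).
Proof. by move=> x0; rewrite /pwR x0. Qed.

Lemma pwR_npos z (x : C) : ~~ (0 < complex.Re x) -> pwR z x = 0.
Proof. by move=> x0; rewrite /pwR (negbTE x0). Qed.

Lemma pwR0 (x : C) : 0 < complex.Re x -> pwR 0 x = 1.
Proof. by move=> x0; rewrite /pwR x0 mul0r (expC_real 0) expR0. Qed.

Lemma strip_term (k : qindex n m) z :
  pwR (1 - z / 2) (spectral_diag rho 0 k.1) * pwR (z / 2) (spectral_diag r 0 k.2.1) *
  pwR (- (z / 2)) (spectral_diag s 0 k.2.2.1) * pwR (z / 2) (spectral_diag sigma 0 k.2.2.2) *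
  qc k = strip_coef k * expC (z * (strip_exp k)%:C).
Proof.
rewrite /strip_coef; case: ifPn => [/and4P[h1 h2 h3 h4]|].
  have -> : (ev rho k.1)%:C = expC (ln (ev rho k.1))%:C by rewrite expC_real lnK.
  rewrite !pwR_pos // [RHS]mulrAC -!expCD; congr (expC _ * _).
  by rewrite /strip_exp rmorphM fmorphV rmorph_nat !rmorphD !rmorphN /=; field.
by rewrite /all_pos !negb_and mul0r => /or4P[] h; rewrite !(pwR_npos _ h) ?mulr0 !mul0r.
Qed.

Lemma log_term (k : qindex n m) (b : R) : 1 < b ->
  strip_coef k * (strip_exp k)%:C = (ln b / 2)%:C * (
   - (pwR 1 (spectral_diag rho 0 k.1) * lgR b (spectral_diag rho 0 k.1) *
      pwR 0 (spectral_diag r 0 k.2.1) * pwR 0 (spectral_diag s 0 k.2.2.1) *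
      pwR 0 (spectral_diag sigma 0 k.2.2.2) * qc k)
   + pwR 1 (spectral_diag rho 0 k.1) *
      (pwR 0 (spectral_diag r 0 k.2.1) * lgR b (spectral_diag r 0 k.2.1)) *
      pwR 0 (spectral_diag s 0 k.2.2.1) * pwR 0 (spectral_diag sigma 0 k.2.2.2) * qc k
   - pwR 1 (spectral_diag rho 0 k.1) * pwR 0 (spectral_diag r 0 k.2.1) *
      (pwR 0 (spectral_diag s 0 k.2.2.1) * lgR b (spectral_diag s 0 k.2.2.1)) *
      pwR 0 (spectral_diag sigma 0 k.2.2.2) * qc k
   + pwR 1 (spectral_diag rho 0 k.1) * pwR 0 (spectral_diag r 0 k.2.1) *
      pwR 0 (spectral_diag s 0 k.2.2.1) *
      (pwR 0 (spectral_diag sigma 0 k.2.2.2) * lgR b (spectral_diag sigma 0 k.2.2.2)) * qc k).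
Proof.
move=> b1; have lb : (ln b)%:C != 0 :> C.
  by rewrite fmorph_eq0 gt_eqF // ln_gt0.
rewrite /strip_coef; case: ifPn => [/and4P[h1 h2 h3 h4]|].
  rewrite pwR1 // !pwR0 // /strip_exp /lgR !rmorphM !fmorphV !rmorph_nat !rmorphD !rmorphN /=.
  by field.
rewrite /all_pos !negb_and => /or4P[] h; rewrite !(pwR_npos _ h); ring.
Qed.

Hypothesis Tlin : forall c x y, T (c *: x + y) = c *: T x + T y.
Hypothesis Tcp : forall k (X : 'I_k -> 'I_k -> 'M[C]_m), bpsd X -> bpsd (fun i j => T (X i j)).
Hypothesis T1 : T 1%:M = 1%:M.
Hypotheses (rho_psd : psdm rho) (sigma_psd : psdm sigma) (r_psd : psdm r) (s_psd : psdm s).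
Hypotheses (dual_r : forall x, \tr (r *m x) = \tr (rho *m T x))
  (dual_s : forall x, \tr (s *m x) = \tr (sigma *m T x)).
Hypothesis rho_supp : suppmx pwR sigma *m rho = rho.
Hypothesis rho_tr : \tr rho = 1.

Lemma strip_funE z : strip_fun pwR T rho sigma r s z =
  \sum_k strip_coef k * expC (z * (strip_exp k)%:C).
Proof.
by rewrite strip_fun_qtrace qtrace_sum //; apply: eq_bigr => k _; exact: strip_term.
Qed.

Lemma sum_log_term (b : R) : 1 < b -> \sum_k strip_coef k * (strip_exp k)%:C =
  (ln b / 2)%:C * (- \tr (rho *m mxlog b rho) + \tr (r *m mxlog b r)
    - \tr (r *m mxlog b s) + \tr (rho *m mxlog b sigma)).
Proof.
move=> b1; rewrite !mxlog_spfun.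
have q1 := qtrace_log1 pwR_power Tlin Tcp T1 rho_psd sigma_psd r_psd s_psd dual_r dual_s
  rho_supp (lgR b).
have q2 := qtrace_log2 pwR_power Tcp rho_psd sigma_psd r_psd s_psd dual_r dual_s
  rho_supp (lgR_supp b).
have q3 := qtrace_log3 pwR_power s rho_psd r_psd dual_r rho_supp (lgR_supp b).
have q4 := qtrace_log4 pwR_power Tlin Tcp T1 rho_psd sigma_psd r_psd s_psd dual_r dual_s rho_supp
  (lgR_supp b).
rewrite -q1 -q2 -q3 -q4 !(qtrace_sum Tlin).
rewrite -!sumrN -!big_split /= mulr_sumr.
by apply: eq_bigr => k _; rewrite (log_term k b1).
Qed.

Lemma recoverability_bound (b c : R) : 1 < b ->
  - (ln b / 2 * (complex.Re (\tr (rho *m mxlog b rho - rho *m mxlog b sigma)) -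
      complex.Re (\tr (r *m mxlog b r - r *m mxlog b s)))) - c <=
  expR (- c) * fidelity rho (mean_recovery (W := wint) (pw := pwR) (T := T)
    (sigma := sigma) (s := s) phase r) - 1.
Proof.
move=> b1; set F := fidelity _ _.
have f0 : strip_fun pwR T rho sigma r s 0 = 1.
  rewrite strip_fun_qtrace mul0r subr0 oppr0.
  exact: (qtrace1 pwR_power Tlin Tcp T1 rho_psd sigma_psd r_psd s_psd dual_r dual_s
    rho_supp rho_tr).
have left (a : C) (t : R) := @strip_fun_left _ _ pwR_power _ _ _ Tlin Tcp T1 _ _ r s
  rho_psd rho_supp rho_tr a _ (phase_conj t).
have right (a : R -> C) : bmeas a -> (forall t, `|a t| <= 1) ->
     wint (fun t => a t * strip_fun pwR T rho sigma r s (1 + 2 * phase t)) +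
     ((wint (fun t => a t * strip_fun pwR T rho sigma r s (1 + 2 * phase t)))^*)%R <= 2 * F%:C.
  move=> ba a1; have h := mean_strip_fun_le (sigma := sigma) (s := s) wint_mean pwR_power
    Tlin Tcp T1 rho_psd r_psd
    phase_conj (@mxP_phase R) (@mxP_phaseN R) ba a1.
  apply: (le_trans h); rewrite /F /fidelity /trnorm !mxsqrt_mpow.
  set Y := mpow pwR _ 2^-1; have : 0 <= \tr Y.
    by apply: psdm_tr_ge0; apply: (psdm_mpow pwR_power); exact: half_real.
  rewrite lecE /= => /andP[/eqP hi _].
  rewrite (_ : (complex.Re (\tr Y))%:C = \tr Y) //; exact: complex_eqP.
have := strip_estimate c strip_funE f0 left right.
rewrite (sum_log_term b1); congr (_ - _ <= _).
by rewrite !raddfB /= ReM /= mul0r subr0 !ReD !raddfN /=; ring.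
Qed.

End RecoverabilityBound.

Local Open Scope ereal_scope.

Lemma elog_bound_of_family (R : realType) (b d F : R) : (1 < b)%R ->
  (forall c : R, (- (ln b / 2 * d) - c <= expR (- c) * F - 1)%R) ->
  (- 2)%:E * elog b F <= d%:E.
Proof.
move=> b1 h; have lb : (0 < ln b)%R by apply: ln_gt0.
have F0 : (0 < F)%R.
  (* At this [c] the left side is 0, while for F <= 0 the right side is at most - 1. *)
  rewrite ltNge; apply/negP => F0; have := h (- (ln b / 2 * d))%R.
  have : (expR (- - (ln b / 2 * d)) * F <= 0)%R by rewrite mulr_ge0_le0 ?expR_ge0.
  by set e := (expR _ * F)%R; lra.
have := h (ln F); rewrite expRN lnK ?posrE // mulVf ?gt_eqF // subrr => hF.
rewrite /elog lne_EFin // -!EFinM lee_fin mulrA mulrAC ler_pdivrMr //; lra.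
Qed.

Theorem lemma2 (R : realType) (n m : nat)
  (A : {vspace 'M[R[i]]_n}) (B : {vspace 'M[R[i]]_m})
  (N : 'M[R[i]]_n -> 'M[R[i]]_m) (rho sigma : 'M[R[i]]_n) (b : R) :
  vn_algebra A -> vn_algebra B -> channel A B N ->
  state A rho -> state A sigma -> supp_sub rho sigma -> (1 < b)%R ->
  [/\ (forall t : R, (0 <= beta0 t)%R) /\
        \int[lebesgue_measure]_(t in [set: R]) (beta0 t)%:E = 1,
      operation B A (recovery A sigma N)
    & rel_entropy b rho sigma - rel_entropy b (N rho) (N sigma) >=
        (- 2)%:E * elog b (fidelity rho (recovery A sigma N (N rho)))].
Proof.
move=> hA hB hN [rhoA [rho_psd rho_tr]] [sigmaA [sigma_psd sigma_tr]] hsupp b1.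
have [A1 AM Aadj] := hA; have [_ Ntr] := hN.
have Tlin := adjoint_lin hA hN; have Tcp := @adjoint_cp _ _ _ _ _ _ hA hN.
have T1 := adjoint_unital hA hN; have TA := adjoint_mem hA hN.
have dual_r x := adjoint_dual hA hN x rhoA.
have dual_s x := adjoint_dual hA hN x sigmaA.
have r_psd := channel_psd hN rhoA rho_psd.
have s_psd := channel_psd hN sigmaA sigma_psd.
have sE := recovery_mean A sigma N.
have rho_supp : (suppmx pwR sigma *m rho = rho)%R.
  by apply/eqP; rewrite -(supp_sub_suppmx _ sigma_psd).
split.
- split; first by move=> t; exact/ltW/beta0_gt0.
  exact: integral_beta0.
- split; first split; first split.
  + move=> x xB; rewrite sE; apply: (mean_recovery_mem wint_mean pwR_power Tlin
      (@mxP_phase R) (@mxP_phaseN R)) => // z.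
    (* Powers of sigma stay in [A], being polynomials in sigma. *)
    apply: (@spfun_closed _ _ (fun X => X \in A)) => //.
    * exact: psdm_adj sigma_psd.
    * by move=> Y Z; exact: memvD.
    * by move=> c Y; exact: memvZ.
  + move=> c x y xB yB; rewrite !sE.
    exact: (mean_recovery_lin wint_mean pwR_power Tlin (@mxP_phase R) (@mxP_phaseN R)).
  + move=> k X XB /psdm_mxblock hX.
    have -> : (\mxblock_(i < k, j < k) recovery A sigma N (X i j) = \mxblock_(i < k, j < k)
        mean_recovery (W := wint) (pw := pwR) (T := adjoint_map A N)
          (sigma := sigma) (s := N sigma) phase (X i j))%R.
      by apply: eq_mxblock => i j; exact: sE.
    apply/psdm_mxblock.
    exact: (mean_recovery_cp wint_mean pwR_power Tlin Tcp phase_conj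
      (@mxP_phase R) (@mxP_phaseN R) hX).
  + move=> x xB hx; rewrite sE.
    exact: (mean_recovery_tr wint_mean pwR_power Tlin sigma_psd s_psd dual_s
      (@mxP_phase R) (@mxP_phaseN R) hx).
(* With both supports included, both entropies are finite and their extended difference is a real
   one. *)
have hsupp' : supp_sub (N rho) (N sigma).
  rewrite (supp_sub_suppmx _ s_psd); apply/eqP.
  exact: (s_supp pwR_power Tcp rho_psd sigma_psd r_psd s_psd dual_r dual_s rho_supp).
rewrite /rel_entropy hsupp hsupp' -EFinB; apply: elog_bound_of_family => // c.
rewrite sE; exact: (recoverability_bound Tlin Tcp T1 rho_psd sigma_psd r_psd s_psd
  dual_r dual_s rho_supp rho_tr c b1).
Qed.
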